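(* When $\alpha,\beta\in\sigma(A)$, $$K(\alpha,\beta)=\lim_{p\rightarrow\infty}\langle[u^{p}_{\beta}]_{2}\,|\,B^{m}([u^{p}_{\alpha}]_{2})\rangle.$$
   Context: Inner products are linear in the second argument. $H$ is a (nonzero) separable complex Hilbert space and $A=qV$ with $q\in\mathbb{C}\setminus\{0\}$ and $V$ unitary on $H$; thus $A^{*}A=AA^{*}=r_{A}I$ with $r_A=|q|^2$. For $P\in\mathbb{C}[X,Y]$, $P(A,A^{*})$ is obtained by substituting $A$ for $X$ and $A^{*}$ for $Y$. $\phi\in H$ is a fixed unit vector that is cyclic: $\{P(A,A^{*})(\phi)\mid P\in\mathbb{C}[X,Y]\}$ is dense in $H$. For $N\in\omega$: $H_N$ is the span of $\{A^{i}(A^{*})^{j}\phi\mid i\le N,\ j\le N\}$, $H_N^{-}$ the span of those with $i<N,\ j\le N$, $H_N^{+}$ the span of those with $0<i\le N,\ j\le N$; $W^{\pm}$ are the orthogonal complements of $H_N^{\pm}$ in $H_N$ (of equal dimension). Fix a unitary $U_N:W^{-}\to W^{+}$ and let $A_N$ be the linear operator on $H_N$ with $A_N(u)=A(u)$ for $u\in H_N^{-}$ and $A_N(u)=\sqrt{r_A}\,U_N(u)$ for $u\in W^{-}$; $A_N$ is normal. $D_N=\dim H_N$ and $u_N(n)$, $n<D_N$, is an orthonormal basis of eigenvectors of $A_N$ with eigenvalues $\lambda_N(n)$, chosen so that $\xi_N(n)=\langle u_N(n)|\phi\rangle$ is a non-negative real. $M$ is a natural number strictly greater than $\|A\|$ and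 $\sqrt{r_A}$, $S=\{\lambda\in\mathbb{C}\mid |\mathrm{Re}\,\lambda|\le M,\ |\mathrm{Im}\,\lambda|\le M\}$. $\sigma(A)$ is the spectrum of $A$. $\mathcal{U}$ is an ultrafilter on $\omega$ such that for all $m\ge1$, $\{N\ge1\mid\sqrt N\in\omega,\ m\text{ divides }\sqrt N\}\in\mathcal{U}$. $H^{u}=\prod_NH_N/\mathcal{U}$ (an element need only be specified on a set of $N$ in $\mathcal U$); $\|\cdot\|_2^u$, $\langle\cdot|\cdot\rangle^u$ are the ultraproducts of the norms and inner products; $u\sim v$ iff $\|u-v\|_2^u$ is infinitesimal; $H^m$ is the Hilbert space of classes $v/\sim$ with $\|v\|_2^u$ bounded by a natural number, where $\langle u|v\rangle$ is the complex number infinitely close to $\langle u|v\rangle^u$. $[(v_N)_N]_2$ denotes $(v_N)_N/\mathcal U/\sim$. $G^m:H\to H^m$ is the isometric embedding given by $G^m(P(A,A^* )\phi)=(P(A,A^* )\phi)_{N<\omega}/\mathcal{U}/\sim$ and continuity, and $H^{Im}$ is its range. Measure: for $X\subseteq\mathbb{C}$, $\mu_N(X)=\sum\{\xi_N(n)^2\mid n<D_N,\ \lambda_N(n)\in X\}$ and $\mu^{\mathrm n}(X)=\lim_{\mathcal U}\mu_N(X)$. For $r\in[-M,M]$, $\varepsilon>0$: $I_r=\{\lambda\in S\mid\mathrm{Re}\,\lambda=r\}$, $J_r=\{\lambda\in S\mid\mathrm{Im}\,\lambda=r\}$, $I_r^\varepsilon=\{\lambda\in S\mid|\mathrm{Re}\,\lambda-r|<\varepsilon\}$,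 $J_r^\varepsilon=\{\lambda\in S\mid|\mathrm{Im}\,\lambda-r|<\varepsilon\}$; $r$ is nice if for all $\delta>0$ there is $\varepsilon>0$ with $\mu^{\mathrm n}(I_r^\varepsilon),\mu^{\mathrm n}(J_r^\varepsilon)<\delta$. $NI$ is a fixed countable dense subset of $[-M,M]$ of nice reals with $\pm M\in NI$. $Sq^*$ is the family of sets $\{\lambda\in S\mid r_0<\mathrm{Re}\,\lambda<r_1,\ r_2<\mathrm{Im}\,\lambda<r_3\}$, $r_0,\dots,r_3\in NI$. For $Y\subseteq\mathrm{Int}(S)$, $\mu^*(Y)=\inf\{\sum_{i}\mu^{\mathrm n}(X_i)\mid X_i\in Sq^*,\ Y\subseteq\bigcup_{i<\omega}X_i\}$; for $Y\subseteq\mathbb C$, $\mu^*(Y)=\mu^*(Y\cap\mathrm{Int}(S))$; $\mu$ is the restriction of $\mu^*$ to the Carathéodory measurable sets, a Borel probability measure on $S$ with $\mu(S\setminus\sigma(A))=0$. Kernel: for $P\in\mathbb C[X,Y]$ let $f_P(\lambda)=P(\lambda,\overline\lambda)$. $G:L_2(S,\mu)\to H$ is the isometric isomorphism determined by $G(f_P)=P(A,A^* )(\phi)$; $L_2(S,\mu)$ is identified with $L_2(\sigma(A),\mu\restriction\sigma(A))$ by restriction. $B$ is a bounded linear operator on $H$ with a continuous kernel: with $B_D=G^{-1}BG$, there is a continuous $K:\sigma(A)^2\to\mathbb C$ such that for all $P$, the function $y\mapsto\int_{\sigma(A)}K(x,y)f_P(x)\,d\mu(x)$, $y\in\sigma(A)$,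 is a representative of $B_D(f_P)$. Approximations: $B_N$ ($N<\omega$) are any linear operators on $H_N$ such that (C1) there is a natural number $K_D$ with $\|B_N(v)\|\le K_D\|v\|$ for all $N$ and $v\in H_N$, and (C2) the bounded operator $B^m$ on $H^m$ induced by the ultraproduct of the $B_N$ satisfies $B^m\restriction H^{Im}=G^mB(G^m)^{-1}$. Rectangles: given $\alpha,\beta\in\sigma(A)$, fix reals $r^n_i\in[-M,M]$ ($n<\omega$, $i<2^{n+2}+1$) with $r^n_i<r^n_{i+1}$ and $r^n_{i+1}-r^n_i<2M/(n+1)$; $r^0_0=-M$, $r^0_4=M$; each $r^n_i$ equal to some $r^{n+1}_j$; for all $m<\omega$ neither $\alpha$ nor $\beta$ lies on any line $I_{r^m_i}$ or $J_{r^m_i}$, and for all $\delta>0$ there is $\varepsilon>0$ with $\mu^{\mathrm n}(R^m_\varepsilon)<\delta$, where $R^m_\varepsilon=\bigcup_{i<2^{m+2}+1}(I^\varepsilon_{r^m_i}\cup J^\varepsilon_{r^m_i})$. For $i,j<2^{p+2}$ let $B^p_{ij}=\{\lambda\in S\mid r^p_i<\mathrm{Re}\,\lambda<r^p_{i+1},\ r^p_j<\mathrm{Im}\,\lambda<r^p_{j+1}\}$. For $\gamma\in\{\alpha,\beta\}$, $B^p_\gamma$ is the $B^p_{ij}$ containing $\gamma$, and $u^p_\gamma=(u^p_\gamma(N))_N$ with $u^p_\gamma(N)=\sum_{\lambda_N(k)\in B^p_\gamma}(\xi_N(k)/\mu_N(B^p_\gamma))\,u_N(k)$. *)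

(* Defs.v *)
From HB Require Import structures.
From mathcomp Require Import all_boot all_order all_algebra.
From mathcomp Require Import generic_quotient polyXY complex.
From mathcomp Require Import all_classical all_reals all_analysis.

Set Implicit Arguments.
Unset Strict Implicit.
Unset Printing Implicit Defensive.

Import Order.TTheory GRing.Theory Num.Theory.
Import numFieldNormedType.Exports.

Local Open Scope quotient_scope.
Local Open Scope classical_set_scope.
Local Open Scope complex_scope.
Local Open Scope ring_scope.

Local Notation Re := complex.Re.
Local Notation Im := complex.Im.

(* The library puts the topology and norm of a numeric field on abstract      *)
(* field structures only; this makes them available on the concrete R[i].     *)
HB.instance Definition _ (R : rcfType) := PseudoPointedMetric.copy R[i] R[i]^o.
HB.instance Definition _ (R : rcfType) := NormedModule.copy R[i] R[i]^o.

(* The inner product is linear in the second argument.                        *)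
HB.mixin Record isHilbert (R : realType) H of CompleteNormedModule R[i] H := {
  hdot : H -> H -> R[i] ;
  hdotDr : forall x y z, hdot x (y + z) = hdot x y + hdot x z ;
  hdotZr : forall a x y, hdot x (a *: y) = a * hdot x y ;
  hdotC : forall x y, hdot y x = (hdot x y)^* ;
  hdot_norm : forall x, hdot x x = `|x| ^+ 2 }.

#[short(type="hilbertType")]
HB.structure Definition Hilbert (R : realType) :=
  {H of isHilbert R H & CompleteNormedModule R[i] H}.

(* In R[i], x <= y and x < y entail that y - x is real, and norms are         *)
(* nonnegative reals of R[i]; cmod is the norm as an element of R.            *)
Definition cmod (R : realType) (V : normedModType R[i]) (x : V) : R :=
  Re `|x|.

Section operators.
Context (R : realType) (H : hilbertType R).
Implicit Types (A As T f : H -> H) (S W : set H).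

Definition separable_space := exists2 X : set H, countable X & dense X.

Definition lin_span (X : set H) : set H :=
  [set v | exists s : seq (R[i] * H),
     (forall p, p \in s -> X p.2) /\ v = \sum_(p <- s) p.1 *: p.2].

Definition maps_to S W f := forall u, S u -> W (f u).

Definition linear_on S f :=
  forall a u v, S u -> S v -> f (a *: u + v) = a *: f u + f v.

Definition orth_compl S W : set H :=
  [set v | S v /\ forall w, W w -> hdot w v = 0].

Definition unitary_between S W f :=
  [/\ linear_on S f, f @` S = W &
      forall u v, S u -> S v -> hdot (f u) (f v) = hdot u v].

Definition adjoint A As := forall x y, hdot (As x) y = hdot x (A y).

Definition bounded_op T := exists k : R, forall x, `|T x| <= k%:C * `|x|.

Definition opnorm T : R := sup [set cmod (T x) | x in [set x : H | cmod x <= 1]].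

Definition spectrum A : set R[i] :=
  [set l | ~ exists T : {linear H -> H}, bounded_op T /\
     forall x, T (A x - l *: x) = x /\ A (T x) - l *: T x = x].

(* P : {poly {poly R[i]}} stands for P(X, Y) with X the outer variable:       *)
(* P`_i`_j is the coefficient of X^i Y^j, in accordance with P.[x, y].        *)
Definition op_eval (P : {poly {poly R[i]}}) A As (v : H) : H :=
  \sum_(i < size P) \sum_(j < size P`_i) P`_i`_j *: iter i A (iter j As v).

Definition cyclic_vec A As (phi : H) :=
  dense [set op_eval P A As phi | P in setT].

Definition HN A As phi (N : nat) : set H :=
  lin_span [set v | exists i j : nat,
    [/\ (i <= N)%N, (j <= N)%N & v = iter i A (iter j As phi)]].

Definition HNm A As phi (N : nat) : set H :=
  lin_span [set v | exists i j : nat,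
    [/\ (i < N)%N, (j <= N)%N & v = iter i A (iter j As phi)]].

Definition HNp A As phi (N : nat) : set H :=
  lin_span [set v | exists i j : nat,
    [/\ (0 < i <= N)%N, (j <= N)%N & v = iter i A (iter j As phi)]].

Definition Wm A As phi N := orth_compl (HN A As phi N) (HNm A As phi N).
Definition Wp A As phi N := orth_compl (HN A As phi N) (HNp A As phi N).

Definition fin_approx A As phi (rA : R) N (UN AN : H -> H) :=
  [/\ maps_to (HN A As phi N) (HN A As phi N) AN,
      linear_on (HN A As phi N) AN,
      forall u, HNm A As phi N u -> AN u = A u &
      forall u, Wm A As phi N u -> AN u = (Num.sqrt rA)%:C *: UN u].

Definition eigen_basis S T (D : nat) (u : 'I_D -> H) (lam : 'I_D -> R[i]) :=
  [/\ forall n m, hdot (u n) (u m) = (n == m)%:R,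
      lin_span (range u) = S &
      forall n, T (u n) = lam n *: u n].

(* Re only changes the type: the basis is chosen with <u N n | phi> >= 0.     *)
Definition xi_of (phi : H) (D : nat -> nat) (u : forall N, 'I_(D N) -> H)
  (N : nat) (n : 'I_(D N)) : R := Re (hdot (u N n) phi).

End operators.

Definition f_poly (R : realType) (P : {poly {poly R[i]}}) (l : R[i]) : R[i] :=
  P.[l, l^*].

Record div_ultrafilter := DivUltrafilter {
  ufilter :> set_system nat ;
  ufilter_ultra : UltraFilter ufilter ;
  ufilter_div : forall m : nat, (0 < m)%N ->
    ufilter [set N | (0 < N)%N /\
      exists2 k : nat, N = (k ^ 2)%N & (m %| k)%N] }.

#[global] Instance ufilter_UltraFilter (U : div_ultrafilter) :
  UltraFilter (ufilter U) := ufilter_ultra U.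

Section ultraproduct.
Context (R : realType) (H : hilbertType R) (U : div_ultrafilter).
Context (A As : H -> H) (phi : H).

(* Representatives of the elements of the ultraproduct of the H_N whose norm  *)
(* is bounded by a natural number.                                            *)
Definition um_seq : {pred nat -> H} := [pred v : nat -> H | `[<
  (\forall N \near ufilter U, HN A As phi N (v N)) /\
  exists k : nat, \forall N \near ufilter U, `|v N| <= k%:R >]].

Definition um_type := {v : nat -> H | v \in um_seq}.

(* ||v - w||_2^u is infinitesimal; sequences that agree on a set of U are     *)
(* identified by this relation, so that a single quotient suffices.           *)
Definition um_sim (v w : um_type) : bool := `[<
  forall e : R, 0 < e ->
    \forall N \near ufilter U, `|val v N - val w N| < e%:C >].

Lemma um_sim_refl : reflexive um_sim.
Proof.
move=> v; apply/asboolP => e e0; apply: nearW => N.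
by rewrite subrr normr0 ltcR.
Qed.

Lemma um_sim_sym : symmetric um_sim.
Proof.
move=> v w; apply/asboolP/asboolP => vw e /vw; apply: filterS => N.
all: by rewrite distrC.
Qed.

Lemma um_sim_trans : transitive um_sim.
Proof.
move=> w v x /asboolP vw /asboolP wx; apply/asboolP => e e0.
have e2 : 0 < e / 2 by rewrite divr_gt0.
apply: filterS2 (vw _ e2) (wx _ e2) => N vwN wxN.
rewrite [e]splitr raddfD /=.
by apply: le_lt_trans (ler_distD (val w N) _ _) _; exact: ltrD.
Qed.

Canonical um_sim_equiv := EquivRel um_sim um_sim_refl um_sim_sym um_sim_trans.

Lemma um_seq0 : (fun=> 0) \in um_seq.
Proof.
rewrite unfold_in /=; apply/asboolP; split.
  by apply: nearW => N; exists [::]; rewrite big_nil.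
by exists 0%N; apply: nearW => N; rewrite normr0.
Qed.

Definition Hm := {eq_quot um_sim}.

(* The class [v]_2; the class of 0 if v does not represent an element of H^m. *)
Definition hm_class (v : nat -> H) : Hm :=
  \pi_Hm (insubd (exist _ (fun=> 0) um_seq0 : um_type) v).

Definition hm_rep (c : Hm) : nat -> H := val (repr c).

Definition hm_dot (c d : Hm) : R[i] :=
  lim ((fun N => hdot (hm_rep c N) (hm_rep d N)) @ ufilter U).

Definition Bm (BN : nat -> H -> H) (c : Hm) : Hm :=
  hm_class (fun N => BN N (hm_rep c N)).

(* G^m : isometric (hence continuous), and prescribed on a dense set.         *)
Definition is_Gm (Gm : H -> Hm) :=
  (forall P, Gm (op_eval P A As phi) = hm_class (fun=> op_eval P A As phi)) /\
  (forall x y, hm_dot (Gm x) (Gm y) = hdot x y).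

End ultraproduct.

Section measure.
Context (R : realType) (U : div_ultrafilter).
Context (D : nat -> nat) (lam : forall N, 'I_(D N) -> R[i]).
Context (xi : forall N, 'I_(D N) -> R).
Implicit Types (X Y : set R[i]) (M : nat).

Definition muN (N : nat) X : R :=
  \sum_(n < D N | `[< X (lam n) >]) xi n ^+ 2.

Definition mun X : R := lim ((fun N => muN N X) @ ufilter U).

Definition Sq M : set R[i] := [set l | `|Re l| <= M%:R /\ `|Im l| <= M%:R].

Definition Iline M (r : R) : set R[i] := [set l | Sq M l /\ Re l = r].
Definition Jline M (r : R) : set R[i] := [set l | Sq M l /\ Im l = r].
Definition Istrip M (r e : R) : set R[i] := [set l | Sq M l /\ `|Re l - r| < e].
Definition Jstrip M (r e : R) : set R[i] := [set l | Sq M l /\ `|Im l - r| < e].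

Definition rect M (r0 r1 r2 r3 : R) : set R[i] :=
  [set l | [/\ Sq M l, r0 < Re l < r1 & r2 < Im l < r3]].

Definition nice M (r : R) :=
  forall d : R, 0 < d -> exists2 e : R, 0 < e &
    mun (Istrip M r e) < d /\ mun (Jstrip M r e) < d.

Record nice_set M := NiceSet {
  nset : set R ;
  nset_countable : countable nset ;
  nset_sub : nset `<=` `[- M%:R, M%:R] ;
  nset_dense : `[- M%:R, M%:R] `<=` closure nset ;
  nset_nice : forall r, nset r -> nice M r ;
  nset_bounds : nset M%:R /\ nset (- M%:R) }.

Definition Sqstar M (NI : nice_set M) : set (set R[i]) :=
  [set X | exists r0 r1 r2 r3 : R,
    [/\ nset NI r0, nset NI r1, nset NI r2, nset NI r3 &
        X = rect M r0 r1 r2 r3]].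

Definition star_cover M (NI : nice_set M) Y : set ((set R[i])^nat) :=
  [set X | (forall i, Sqstar NI (X i)) /\
           Y `&` interior (Sq M) `<=` \bigcup_i X i].

Definition mu_star M (NI : nice_set M) Y : \bar R :=
  ereal_inf [set (\sum_(0 <= i <oo) (mun (X i))%:E)%E | X in star_cover NI Y].

Lemma mun_ge0 X : 0 <= mun X.
Proof.
rewrite /mun; have [|h] := pselect (cvg ((fun N => muN N X) @ ufilter U)).
  move=> h; apply: (limr_ge h); apply: nearW => N.
  by apply: sumr_ge0 => n _; exact: sqr_ge0.
by rewrite (dvgP h).
Qed.

Lemma mun0 : mun set0 = 0.
Proof.
rewrite /mun (_ : (fun N => _) = fun=> 0) ?lim_cst//.
by apply/funext => N; rewrite /muN big1// => n /asboolP.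
Qed.

Section outer.
Context (M : nat) (NI : nice_set M).
Local Open Scope ereal_scope.

Let Sqstar0 : Sqstar NI set0.
Proof.
have [NM _] := nset_bounds NI.
exists M%:R, M%:R, M%:R, M%:R; split => //.
apply/seteqP; split => // l [_ /andP[h1 h2]].
by have := lt_trans h1 h2; rewrite ltxx.
Qed.

Lemma mu_star_ge0 Y : 0 <= mu_star NI Y.
Proof.
apply: le_ereal_inf_tmp => x [X _ <-{x}].
by apply: nneseries_ge0 => i _ _; rewrite lee_fin mun_ge0.
Qed.

Lemma mu_star0 : mu_star NI set0 = 0.
Proof.
apply/eqP; rewrite eq_le mu_star_ge0 andbT.
apply: ereal_inf_lbound; exists (fun=> set0); first by split=> //; rewrite set0I.
by rewrite eseries0// => i _ _; rewrite mun0.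
Qed.

Lemma le_mu_star : {homo mu_star NI : Y Z / Y `<=` Z >-> Y <= Z}.
Proof.
move=> Y Z YZ; apply: ereal_inf_le_tmp => x [X [SX ZX] <-{x}].
by exists X => //; split => //; apply: subset_trans ZX; exact: setSI.
Qed.


Lemma mu_star_sigma_subadditive : sigma_subadditive (mu_star NI).
Proof.
move=> Y; have [[i ioo]|] := pselect (exists i, mu_star NI (Y i) = +oo).
  rewrite (eseries_pinfty _ _ ioo) ?leey// => n _.
  by rewrite -ltNye (lt_le_trans _ (mu_star_ge0 _)).
rewrite -forallNE => Yoo.
suff add2e (e : {posnum R}) : mu_star NI (\bigcup_n Y n) <=
    \sum_(i <oo) mu_star NI (Y i) + e%:num%:E.
  by apply/lee_addgt0Pr => _/posnumP[].
rewrite (le_trans _ (epsilon_trick _ _ _))//; last first.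
  by move=> n; exact: mu_star_ge0.
pose P n (X : (set R[i])^nat) := star_cover NI (Y n) X /\
  \sum_(0 <= k <oo) (mun (X k))%:E
    <= mu_star NI (Y n) + (e%:num / (2 ^ n.+1)%:R)%:E.
have [G PG] : {G : ((set R[i])^nat)^nat & forall n, P n (G n)}.
  apply: (@choice _ _ P) => n; rewrite /P /mu_star.
  set S := (X in ereal_inf X); move infS : (ereal_inf S) => iS.
  case: iS infS => [r Sr|Soo|Soo].
  - have en1 : (0 < e%:num / (2 ^ n.+1)%:R)%R by [].
    have /(lb_ereal_inf_adherent en1) : ereal_inf S \is a fin_num by rewrite Sr.
    move=> [x [X cX <-] xS].
    by exists X; split => //; rewrite -Sr; exact/ltW.
  - by have := Yoo n; rewrite /mu_star Soo.
  - suff : lbound S 0 by move/le_ereal_inf_tmp; rewrite Soo.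
    move=> /= _ [X _ <-]; apply: nneseries_ge0 => i _ _.
    by rewrite lee_fin mun_ge0.
pose m X : \bar R := (mun X)%:E.
have m_ge0 X : 0 <= m X by rewrite lee_fin mun_ge0.
have mG_ge0 x : 0 <= (m \o uncurry G) x by exact: m_ge0.
apply: (@le_trans _ _ (\esum_(i in setT) (m \o uncurry G) i)).
  rewrite /mu_star; apply: ereal_inf_lbound => /=.
  have /card_esym/ppcard_eqP[f] := card_nat2.
  exists (uncurry G \o f).
    split => [i|].
      by rewrite /=; case: (f i) => a b; exact: (PG a).1.1.
    apply: (@subset_trans _ (\bigcup_n \bigcup_k G n k)) => [t [[i _ Yit] It]|].
      by have [j _ Gij] := (PG i).1.2 t (conj Yit It); exists i => //; exists j.
    move=> t [i _ [j _ Bijt]]; exists (f^-1%FUN (i, j)) => //=.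
    by rewrite invK ?inE.
  rewrite -(esum_pred_image (m \o uncurry G) _ xpredT) ?[fun=> _]set_true//.
  by rewrite image_eq.
rewrite (_ : esum _ _ = \sum_(i <oo) \sum_(j <oo ) m (G i j)); last first.
  pose J : nat -> set (nat * nat) := fun i => [set (i, j) | j in setT].
  rewrite (_ : setT = \bigcup_k J k); last first.
    by rewrite predeqE => -[a b]; split => // _; exists a => //; exists b.
  rewrite esum_bigcupT /=; last 2 first.
    - apply/trivIsetP => i j _ _ ij.
      rewrite predeqE => -[n k] /=; split => //= -[] [_] _ [<-{n} _].
      by move=> [m' _] [] /esym/eqP; rewrite (negbTE ij).
    - by move=> /= [n k]; exact: m_ge0.
  rewrite -(image_id [set: nat]) -fun_true esum_pred_image//; last first.
    by move=> n _; exact: esum_ge0.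
  apply: eq_eseriesr => /= j _.
  rewrite -(esum_pred_image (m \o uncurry G) (pair j) predT)//=; last first.
    by move=> ? ? _ _; exact: (@can_inj _ _ _ snd).
  by congr esum; rewrite predeqE => -[a b]; split; move=> [i _ <-]; exists i.
apply: lee_lim.
- apply: is_cvg_nneseries => n *.
  by apply: nneseries_ge0 => k *; exact: (mG_ge0 (n, k)).
- by apply: is_cvg_nneseries => n *; apply: adde_ge0 => //; exact: mu_star_ge0.
- by near=> n; apply: lee_sum => i _; exact: (PG i).2.
Unshelve. all: by end_near. Qed.

HB.instance Definition _ := isOuterMeasure.Build R R[i] (mu_star NI)
  mu_star0 mu_star_ge0 le_mu_star mu_star_sigma_subadditive.

End outer.

Definition idx (n : nat) : nat := (2 ^ n.+2).+1.

Record grid M (a b : R[i]) (r : nat -> nat -> R) : Prop := Grid {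
  grid_in : forall n i, (i < idx n)%N -> - M%:R <= r n i <= M%:R ;
  grid_incr : forall n i, (i.+1 < idx n)%N -> r n i < r n i.+1 ;
  grid_mesh : forall n i, (i.+1 < idx n)%N ->
    r n i.+1 - r n i < 2 * M%:R / n.+1%:R ;
  grid_left : r 0 0 = - M%:R ;
  grid_right : r 0 4 = M%:R ;
  grid_refine : forall n i, (i < idx n)%N ->
    exists2 j, (j < idx n.+1)%N & r n i = r n.+1 j ;
  grid_off : forall n i, (i < idx n)%N ->
    forall c, c = a \/ c = b ->
      ~ Iline M (r n i) c /\ ~ Jline M (r n i) c ;
  grid_nice : forall (n : nat) (d : R), 0 < d -> exists2 e : R, 0 < e &
    mun (\bigcup_(i in `I_(idx n)) (Istrip M (r n i) e `|` Jstrip M (r n i) e))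
      < d }.

Definition grid_cell M (r : nat -> nat -> R) (p i j : nat) : set R[i] :=
  rect M (r p i) (r p i.+1) (r p j) (r p j.+1).

Definition cell_of M (r : nat -> nat -> R) (p : nat) (c : R[i]) : set R[i] :=
  xget set0 [set X | exists i j, [/\ (i < 2 ^ p.+2)%N, (j < 2 ^ p.+2)%N,
    X = grid_cell M r p i j & X c]].

Definition delta_vec (H : hilbertType R) (u : forall N, 'I_(D N) -> H)
    (X : set R[i]) (N : nat) : H :=
  \sum_(k < D N | `[< X (lam k) >]) (xi k / muN N X)%:C *: u N k.

End measure.

Section kernels.
Context (R : realType) (mu : {outer_measure set R[i] -> \bar R}).
Local Notation T := (caratheodory_type mu).
Implicit Types (S : set R[i]) (f g : R[i] -> R[i]).

(* mu restricted to its Caratheodory measurable sets.                         *)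
Definition cara_measure : {measure set T -> \bar R} := (mu : set T -> \bar R).

Definition cmeasurable S f :=
  measurable_fun (S : set T) (fun x : T => Re (f x)) /\
  measurable_fun (S : set T) (fun x : T => Im (f x)).

Definition cintegral S f : R[i] :=
  (\int[cara_measure]_(x in (S : set T)) Re (f x))%R +i*
  (\int[cara_measure]_(x in (S : set T)) Im (f x))%R.

Definition L2sqnorm S f : \bar R :=
  (\int[cara_measure]_(x in (S : set T)) (cmod (f x) ^+ 2)%:E)%E.

Definition in_L2 S f := cmeasurable S f /\ (L2sqnorm S f < +oo)%E.

(* Elements of L_2(S, mu) are given by representatives; isometry and          *)
(* linearity force G to identify those that agree almost everywhere.          *)
Record L2_iso (H : hilbertType R) (A As : H -> H) (phi : H) S
    (G : (R[i] -> R[i]) -> H) : Prop := L2Iso {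
  L2_iso_linear : forall a f g, in_L2 S f -> in_L2 S g ->
    G (fun x => a * f x + g x) = a *: G f + G g ;
  L2_iso_isometric : forall f, in_L2 S f ->
    L2sqnorm S f = (cmod (G f) ^+ 2)%:E ;
  L2_iso_surjective : forall v, exists2 f, in_L2 S f & G f = v ;
  L2_iso_poly : forall P, G (f_poly P) = op_eval P A As phi }.

(* g represents B_D(f_P) = G^-1 B G (f_P) in L_2(S, mu); its restriction to   *)
(* sigma is a.e. equal to y |-> \int_sigma K(x, y) f_P(x) dmu(x).             *)
Definition has_kernel (H : hilbertType R) S (sigma : set R[i])
    (G : (R[i] -> R[i]) -> H) (B : H -> H) (K : R[i] -> R[i] -> R[i]) :=
  {within sigma `*` sigma, continuous (fun z => K z.1 z.2)} /\
  forall P, exists g, [/\ in_L2 S g, G g = B (G (f_poly P)) &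
    {ae cara_measure, forall y : T, sigma y ->
       g y = cintegral sigma (fun x => K x y * f_poly P x)}].

End kernels.

(* Main.v *)
Require Import Defs.
From HB Require Import structures.
From mathcomp Require Import all_boot all_order all_algebra.
From mathcomp Require Import generic_quotient polyXY complex ring lra.
From mathcomp Require Import all_classical all_reals all_analysis measurable_realfun.

(** Why the limit formula holds.  Let [X] and [Y] be the cells of level [p]
    around [alpha] and [beta], and let [e_N(X)] be the sum of
    [xi_N(k) u_N(k)] over the eigenvalues [lambda_N(k)] in [X].  The approximate
    delta function at [alpha] is [e_N(X) / mu_N(X)].

    The sequence [e_N(X)] represents [G 1_X].  Write [v_P] for the polynomial
    vector obtained by applying [P], evaluated at [A] and its adjoint, to [phi].
    The eigenvalues have modulus [|q|] ([eigenvalue_sqnorm]), and for [N] large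
    the coordinates of [v_P] in the eigenbasis are [f_P(lambda_N(k)) xi_N(k)]
    ([basis_op_eval]).  Hence the squared distance of [e_N(X)] from [v_P] is the
    integral of [|1_X - f_P|^2] for the discrete measure [mu_N].  The discrete
    measures converge on the cells of every level, so Riemann sums bound the
    limit of these integrals by the integral for [mu] ([limsup_integral]), which
    is the squared distance of [G 1_X] from [v_P]; and polynomial vectors are
    dense.  On polynomial vectors
    the matrix coefficients of [B_N] tend to those of [B], because [B^m] extends
    [B] along [G^m] ([cvg_BN_poly]).  The expression whose limit is sought is
    therefore [<G 1_Y | B (G 1_X)> / (mu(X) mu(Y))] ([hm_dot_delta]).

    By the kernel formula this quotient is an average of [K] over the points of
    [X * Y] with both coordinates in the spectrum ([kernel_average]).  The cells
    shrink to [alpha] and [beta], and [K] is continuous.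

    Three facts about [mu] enter.  It is a Borel measure: half-planes are
    measurable because the rectangles of a cover can be cut along nice lines
    ([caratheodory_nset]).  It gives a cell the limit of its discrete masses:
    approximation from outside yields one inequality ([nu_box]), and as the
    total mass is [|phi|^2 = 1] on both sides, summing over all cells of a level
    forces equality ([nu_partition]).  Its support is the spectrum of [A],
    because [A] is multiplication by the coordinate ([G_mul_id]): a null disc
    around a point lets one divide by the distance to that point
    ([null_resolvent]), and a bounded inverse excludes functions concentrated
    near the point ([resolvent_null]).  So the cells around points of the
    spectrum have positive mass, and the complement of the spectrum is null. *)

Set Implicit Arguments.
Unset Strict Implicit.
Unset Printing Implicit Defensive.

Import Order.TTheory GRing.Theory Num.Theory.
Import numFieldNormedType.Exports.

Local Open Scope classical_set_scope.
Local Open Scope complex_scope.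
Local Open Scope ring_scope.

Local Notation Re := complex.Re.
Local Notation Im := complex.Im.

(** * Moduli and inner products as real numbers *)

Section modulus.
Context (R : realType).

Lemma norm_cmod (V : normedModType R[i]) (x : V) : `|x| = (cmod x)%:C.
Proof.
have /ger0_Im h := normr_ge0 x; rewrite /cmod.
by case: (`|x|) h => a b /= ->.
Qed.

Lemma cmod_ge0 (V : normedModType R[i]) (x : V) : 0 <= cmod x.
Proof. by rewrite -lecR -norm_cmod normr_ge0. Qed.
Hint Resolve cmod_ge0 : core.

Lemma cmod0 (V : normedModType R[i]) : cmod (0 : V) = 0.
Proof. by rewrite /cmod normr0. Qed.

Lemma cmod_eq0 (V : normedModType R[i]) (x : V) : (cmod x == 0) = (x == 0).
Proof. by rewrite -[RHS]normr_eq0 norm_cmod eq_complex /= eqxx andbT. Qed.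

Lemma le_cmodD (V : normedModType R[i]) (x y : V) :
  cmod (x + y) <= cmod x + cmod y.
Proof. by rewrite -lecR raddfD /= -!norm_cmod ler_normD. Qed.

Lemma cmodN (V : normedModType R[i]) (x : V) : cmod (- x) = cmod x.
Proof. by rewrite /cmod normrN. Qed.

Lemma cmodBC (V : normedModType R[i]) (x y : V) : cmod (x - y) = cmod (y - x).
Proof. by rewrite -cmodN opprB. Qed.

Lemma le_cmodB (V : normedModType R[i]) (x y : V) :
  cmod (x - y) <= cmod x + cmod y.
Proof. by rewrite -(cmodN y) le_cmodD. Qed.

Lemma cmodZ (V : normedModType R[i]) (a : R[i]) (x : V) :
  cmod (a *: x) = cmod a * cmod x.
Proof.
by apply: complexI; rewrite rmorphM /= -!norm_cmod normrZ.
Qed.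

Lemma cmodM (a b : R[i]) : cmod (a * b) = cmod a * cmod b.
Proof. exact: (cmodZ a b). Qed.

Lemma cmod1 : cmod (1 : R[i]) = 1.
Proof. by rewrite /cmod normr1. Qed.

Lemma cmodV (a : R[i]) : cmod (a^-1) = (cmod a)^-1.
Proof.
have [->|a0] := eqVneq a 0; first by rewrite invr0 cmod0 invr0.
have h : cmod a * cmod a^-1 = 1 by rewrite -cmodM divff// cmod1.
by rewrite -[LHS]mul1r -(@mulVf _ (cmod a)) ?cmod_eq0// -mulrA h mulr1.
Qed.

Lemma cmodE (z : R[i]) : cmod z = Num.sqrt (Re z ^+ 2 + Im z ^+ 2).
Proof. by rewrite /cmod normc_def. Qed.

Lemma cmod_sqr (z : R[i]) : cmod z ^+ 2 = Re z ^+ 2 + Im z ^+ 2.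
Proof. by rewrite cmodE sqr_sqrtr// addr_ge0// sqr_ge0. Qed.

Lemma Re_cconj (z : R[i]) : Re z^* = Re z.
Proof. by case: z. Qed.

Lemma Im_cconj (z : R[i]) : Im z^* = - Im z.
Proof. by case: z. Qed.

Lemma conj_real (x : R) : x%:C^* = x%:C.
Proof. exact: conjc_real. Qed.

Lemma cmod_conj (z : R[i]) : cmod z^* = cmod z.
Proof. by rewrite !cmodE Re_cconj Im_cconj sqrrN. Qed.

Lemma cmod_real (x : R) : cmod x%:C = `|x|.
Proof. by rewrite cmodE /= expr0n /= addr0 sqrtr_sqr. Qed.

Lemma le_Re_cmod (z : R[i]) : `|Re z| <= cmod z.
Proof. by rewrite cmodE -sqrtr_sqr ler_wsqrtr// lerDl sqr_ge0. Qed.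

Lemma le_Im_cmod (z : R[i]) : `|Im z| <= cmod z.
Proof. by rewrite cmodE -sqrtr_sqr ler_wsqrtr// lerDr sqr_ge0. Qed.

Lemma cmod_le_ReIm (z : R[i]) : cmod z <= `|Re z| + `|Im z|.
Proof.
rewrite -(@ler_pXn2r _ 2) ?nnegrE ?addr_ge0// cmod_sqr sqrrD !real_normK ?num_real//.
by rewrite lerD2r lerDl mulrn_wge0// mulr_ge0.
Qed.

Lemma Re_add (x y : R[i]) : Re (x + y) = Re x + Re y.
Proof. by case: x y => a b []. Qed.
Lemma Im_add (x y : R[i]) : Im (x + y) = Im x + Im y.
Proof. by case: x y => a b []. Qed.
Lemma Re_opp (x : R[i]) : Re (- x) = - Re x.
Proof. by case: x. Qed.
Lemma Im_opp (x : R[i]) : Im (- x) = - Im x.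
Proof. by case: x. Qed.
Lemma Re_mul (x y : R[i]) : Re (x * y) = Re x * Re y - Im x * Im y.
Proof. by case: x y => a b []. Qed.
Lemma Im_mul (x y : R[i]) : Im (x * y) = Re x * Im y + Im x * Re y.
Proof. by case: x y => a b []. Qed.

Lemma conjM_cmod (z : R[i]) : z^* * z = (cmod z ^+ 2)%:C.
Proof.
rewrite cmod_sqr; apply/eqP; rewrite eq_complex Re_mul Im_mul Re_cconj Im_cconj /=.
by apply/andP; split; apply/eqP; ring.
Qed.

End modulus.
#[local] Hint Resolve cmod_ge0 : core.

Section hilbert.
Context (R : realType) (H : hilbertType R).
Implicit Types x y z : H.

Lemma hdotDl x y z : hdot (x + y) z = hdot x z + hdot y z.
Proof. by rewrite hdotC hdotDr rmorphD /= -!hdotC. Qed.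

Lemma hdotZl a x y : hdot (a *: x) y = a^* * hdot x y.
Proof. by rewrite hdotC hdotZr rmorphM /= -hdotC. Qed.

Lemma hdot0r x : hdot x 0 = 0.
Proof. by rewrite -(scale0r x) hdotZr mul0r. Qed.

Lemma hdot0l x : hdot 0 x = 0.
Proof. by rewrite hdotC hdot0r conjC0. Qed.

Lemma hdotNr x y : hdot x (- y) = - hdot x y.
Proof. by rewrite -scaleN1r hdotZr mulN1r. Qed.

Lemma hdotNl x y : hdot (- x) y = - hdot x y.
Proof. by rewrite hdotC hdotNr rmorphN /= -hdotC. Qed.

Lemma hdotBr x y z : hdot x (y - z) = hdot x y - hdot x z.
Proof. by rewrite hdotDr hdotNr. Qed.

Lemma hdotBl x y z : hdot (x - y) z = hdot x z - hdot y z.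
Proof. by rewrite hdotDl hdotNl. Qed.

Lemma hdot_sumr x (I : Type) (s : seq I) (P : pred I) (F : I -> H) :
  hdot x (\sum_(i <- s | P i) F i) = \sum_(i <- s | P i) hdot x (F i).
Proof. by apply: (big_morph _ (hdotDr x)); exact: hdot0r. Qed.

Lemma hdot_suml x (I : Type) (s : seq I) (P : pred I) (F : I -> H) :
  hdot (\sum_(i <- s | P i) F i) x = \sum_(i <- s | P i) hdot (F i) x.
Proof.
by apply: (big_morph (fun y => hdot y x) (fun y z => hdotDl y z x)); exact: hdot0l.
Qed.

Lemma hdotxx x : hdot x x = (cmod x ^+ 2)%:C.
Proof. by rewrite hdot_norm norm_cmod rmorphXn. Qed.

Lemma pythagoras x y : hdot x y = 0 ->
  cmod (x + y) ^+ 2 = cmod x ^+ 2 + cmod y ^+ 2.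
Proof.
move=> xy; apply: complexI; rewrite raddfD /= -!hdotxx hdotDl !hdotDr xy.
by rewrite (hdotC x y) xy conjC0 addr0 add0r.
Qed.

Lemma cauchy_schwarz x y : cmod (hdot x y) <= cmod x * cmod y.
Proof.
have [->|x0] := eqVneq x 0; first by rewrite hdot0l !cmod0 mul0r.
have nx0 : 0 < cmod x by rewrite lt_neqAle eq_sym cmod_eq0 x0 cmod_ge0.
pose c := hdot x y / (cmod x ^+ 2)%:C.
have n0 : (cmod x ^+ 2)%:C != 0 :> R[i].
  by rewrite (inj_eq (@complexI _)) expf_neq0// gt_eqF.
pose w := y - c *: x.
have xw : hdot (c *: x) w = 0.
  by rewrite hdotZl /w hdotBr hdotZr hdotxx divfK// subrr mulr0.
have : cmod y ^+ 2 = cmod (c *: x) ^+ 2 + cmod w ^+ 2.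
  by rewrite -pythagoras// /w addrC subrK.
rewrite cmodZ /c cmodM cmodV cmod_real ger0_norm ?sqr_ge0// => e.
have : (cmod (hdot x y) / cmod x ^+ 2 * cmod x) ^+ 2 <= cmod y ^+ 2.
  by rewrite e lerDl sqr_ge0.
have -> : cmod (hdot x y) / cmod x ^+ 2 * cmod x = cmod (hdot x y) / cmod x.
  by rewrite expr2 invfM mulrA divfK// gt_eqF.
rewrite ler_pXn2r ?nnegrE ?divr_ge0 ?cmod_ge0//.
by rewrite ler_pdivrMr// mulrC.
Qed.

End hilbert.

(** * Finite-dimensional approximations *)

Section linear_span.
Context (R : realType) (H : hilbertType R).
Implicit Types (X : set H) (x y v w : H).

Lemma lin_span_comb X a x y :
  lin_span X x -> lin_span X y -> lin_span X (a *: x + y).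
Proof.
move=> [s [Xs ->]] [t [Xt ->]].
exists ([seq (a * p.1, p.2) | p <- s] ++ t); split.
  move=> p; rewrite mem_cat => /orP[/mapP[p' p's ->]|/Xt//]; exact: (Xs p').
rewrite big_cat big_map scaler_sumr; congr (_ + _).
by apply: eq_bigr => p _; rewrite scalerA.
Qed.

Lemma sub_lin_span X : X `<=` lin_span X.
Proof.
move=> x Xx; exists [:: (1, x)]; split; last by rewrite big_seq1 /= scale1r.
by move=> p; rewrite inE => /eqP ->.
Qed.

Lemma lin_span0 X : lin_span X 0.
Proof. by exists [::]; rewrite big_nil. Qed.

Lemma lin_spanZ X a x : lin_span X x -> lin_span X (a *: x).
Proof. by move=> h; rewrite -[_ *: _]addr0; apply: lin_span_comb => //; exact: lin_span0. Qed.

Lemma lin_spanD X x y : lin_span X x -> lin_span X y -> lin_span X (x + y).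
Proof. by move=> h; rewrite -[x in lin_span X (x + _)]scale1r; exact: lin_span_comb. Qed.

Lemma lin_spanB X x y : lin_span X x -> lin_span X y -> lin_span X (x - y).
Proof. by move=> hx hy; rewrite addrC -scaleN1r; exact: lin_span_comb. Qed.

Lemma lin_span_sum X (I : Type) (s : seq I) (P : pred I) (F : I -> H) :
  (forall i, P i -> lin_span X (F i)) -> lin_span X (\sum_(i <- s | P i) F i).
Proof.
by move=> h; apply: big_ind => // [|x y]; [exact: lin_span0|exact: lin_spanD].
Qed.

Lemma lin_span_ind X (Q : H -> Prop) :
  Q 0 -> (forall a x y, X x -> lin_span X y -> Q y -> Q (a *: x + y)) ->
  forall v, lin_span X v -> Q v.
Proof.
move=> Q0 QD v [s [+ ->]]; elim: s => [|p s IH] Xs; first by rewrite big_nil.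
have Xs' p' : p' \in s -> X p'.2 by move=> ps; apply: Xs; rewrite inE ps orbT.
rewrite big_cons; apply: QD; first by apply: Xs; rewrite inE eqxx.
  by exists s.
exact: IH.
Qed.

Lemma lin_span_sub X Y : X `<=` lin_span Y -> lin_span X `<=` lin_span Y.
Proof.
move=> XY; apply: lin_span_ind; first exact: lin_span0.
by move=> a x y /XY Yx _; exact: lin_span_comb.
Qed.

Lemma lin_span_orth X v : (forall x, X x -> hdot x v = 0) ->
  forall w, lin_span X w -> hdot w v = 0.
Proof.
move=> Xv; apply: lin_span_ind; first by rewrite hdot0l.
by move=> a x y Xx _ yv; rewrite hdotDl hdotZl Xv// yv mulr0 addr0.
Qed.

(** Gram-Schmidt, one vector at a time: [x'] is the part of the new vector [x]
    orthogonal to the previous ones. *)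
Lemma orth_projection (s : seq H) v :
  exists2 w, lin_span [set` s] w & forall x, x \in s -> hdot x (v - w) = 0.
Proof.
elim: s v => [|x s IH] v; first by exists 0 => //; exact: lin_span0.
have [p sp px] := IH x; have [w sw wv] := IH v.
pose x' := x - p; pose c := hdot x' (v - w) / hdot x' x'.
have sub : lin_span [set` s] `<=` lin_span [set` x :: s].
  by apply: lin_span_sub => y ys; apply: sub_lin_span; rewrite /= inE ys orbT.
exists (w + c *: x').
  apply: lin_spanD; first exact: sub.
  apply: lin_spanZ; apply: lin_spanB; last exact: sub.
  by apply: sub_lin_span; rewrite /= inE eqxx.
have orth y : y \in s -> hdot y (v - (w + c *: x')) = 0.
  by move=> ys; rewrite opprD addrA hdotBr wv// hdotZr px// mulr0 subrr.
move=> y; rewrite inE => /orP[/eqP->|]; last exact: orth.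
rewrite -[x](subrK p) hdotDl (lin_span_orth orth sp) addr0 -/x'.
rewrite opprD addrA hdotBr hdotZr /c.
have [->|x'0] := eqVneq x' 0; first by rewrite !hdot0l mulr0 subrr.
rewrite divfK ?subrr// hdotxx (inj_eq (@complexI _)) expf_neq0//.
by rewrite cmod_eq0.
Qed.

Lemma orthonormal_sqnorm (D : nat) (u : 'I_D -> H) (c : 'I_D -> R[i]) :
  (forall n m, hdot (u n) (u m) = (n == m)%:R) ->
  cmod (\sum_k c k *: u k) ^+ 2 = \sum_k cmod (c k) ^+ 2.
Proof.
move=> uu; apply: complexI; rewrite -hdotxx rmorph_sum hdot_suml.
apply: eq_bigr => k _; rewrite hdotZl hdot_sumr (bigD1 k)//= big1 => [|j jk].
  by rewrite addr0 hdotZr uu eqxx mulr1 conjM_cmod.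
by rewrite hdotZr uu eq_sym (negbTE jk) mulr0.
Qed.

Lemma orthonormal_expansion (D : nat) (u : 'I_D -> H) v :
  (forall n m, hdot (u n) (u m) = (n == m)%:R) ->
  lin_span (range u) v -> v = \sum_k hdot (u k) v *: u k.
Proof.
move=> uu; move: v; apply: lin_span_ind.
  by rewrite big1// => k _; rewrite hdot0r scale0r.
move=> a _ y [j _ <-] _ {1}->.
rewrite {1}(_ : u j = \sum_k hdot (u k) (u j) *: u k); last first.
  rewrite (bigD1 j)//= big1 ?addr0 ?uu ?eqxx ?scale1r// => k kj.
  by rewrite uu (negbTE kj) scale0r.
rewrite scaler_sumr -big_split /=; apply: eq_bigr => k _.
by rewrite hdotDr hdotZr scalerA scalerDl.
Qed.

End linear_span.

Section linear_operators.
Context (R : realType) (H : hilbertType R) (f : {linear H -> H}).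

Lemma linP a x y : f (a *: x + y) = a *: f x + f y.
Proof. exact: linearP. Qed.

Lemma linZ a x : f (a *: x) = a *: f x.
Proof. exact: linearZ. Qed.

Lemma linB x y : f (x - y) = f x - f y.
Proof. exact: raddfB. Qed.

Lemma lin0 : f 0 = 0.
Proof. exact: raddf0. Qed.

Lemma lin_sum (I : Type) (s : seq I) (P : pred I) (F : I -> H) :
  f (\sum_(i <- s | P i) F i) = \sum_(i <- s | P i) f (F i).
Proof. exact: raddf_sum. Qed.

End linear_operators.

Section polynomial_values.
Context (R : realType) (H : hilbertType R).
Implicit Types P : {poly {poly R[i]}}.

Lemma f_polyE P l :
  f_poly P l = \sum_(i < size P) \sum_(j < size P`_i) P`_i`_j * l ^+ i * l^* ^+ j.
Proof.
rewrite /f_poly (horner_coef P) horner_sum; apply: eq_bigr => i _.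
rewrite hornerM horner_exp hornerC horner_coef mulr_suml.
by apply: eq_bigr => j _; rewrite mulrAC.
Qed.

Lemma f_polyM P Q l : f_poly (P * Q) l = f_poly P l * f_poly Q l.
Proof. by rewrite /f_poly !hornerM. Qed.

Lemma f_polyX (l : R[i]) : f_poly 'X l = l.
Proof. by rewrite /f_poly hornerX hornerC. Qed.

Lemma op_eval_mulX P (A As : {linear H -> H}) v :
  op_eval (P * 'X) A As v = A (op_eval P A As v).
Proof.
have [->|P0] := eqVneq P 0.
  by rewrite mul0r /op_eval size_poly0 big_ord0 lin0.
rewrite /op_eval size_mulX// big_ord_recl coefMX /= size_poly0 big_ord0 add0r.
rewrite lin_sum; apply: eq_bigr => i _; rewrite coefMX /= lin_sum.
by apply: eq_bigr => j _; rewrite linZ.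
Qed.

Lemma op_eval1 (A As : H -> H) v : op_eval 1 A As v = v.
Proof.
rewrite /op_eval size_poly1 big_ord1 coef1 /= size_poly1 big_ord1 coef1 /=.
by rewrite scale1r.
Qed.

Lemma f_poly1 l : f_poly (1 : {poly {poly R[i]}}) l = 1.
Proof. by rewrite /f_poly hornerE hornerC. Qed.

End polynomial_values.

Section finite_approximation.
Context (R : realType) (H : hilbertType R).
Context (q : R[i]) (V A As : {linear H -> H}) (phi : H).
Context (q_neq0 : q != 0)
  (V_unitary : unitary_between [set: H] [set: H] V)
  (A_def : forall v, A v = q *: V v)
  (As_adjoint : adjoint A As).

Let rA := cmod q ^+ 2.

Lemma scaled_unitary_dot x y : hdot (A x) (A y) = rA%:C * hdot x y.
Proof.
have [_ _ VV] := V_unitary.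
by rewrite !A_def hdotZl hdotZr VV// mulrA conjM_cmod.
Qed.

Lemma scaled_unitary_cmod x : cmod (A x) = cmod q * cmod x.
Proof.
have [_ _ VV] := V_unitary; rewrite A_def cmodZ; congr (_ * _).
apply/eqP; rewrite -(@eqrXn2 _ 2) ?cmod_ge0//; apply/eqP; apply: complexI.
by rewrite -!hdotxx VV.
Qed.

Lemma adjoint_scaled_unitaryK x : As (A x) = rA%:C *: x.
Proof.
apply/eqP; rewrite -subr_eq0 -cmod_eq0 -sqrf_eq0.
rewrite -(inj_eq (@complexI R)) -hdotxx.
set y := _ - _; rewrite {1}/y hdotBl As_adjoint scaled_unitary_dot hdotZl.
by rewrite conj_real subrr.
Qed.

Lemma scaled_unitary_adjointK x : A (As x) = rA%:C *: x.
Proof.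
have [_ VT _] := V_unitary.
have [w _ wx] : (range V) (q^-1 *: x) by rewrite VT.
have -> : x = A w by rewrite A_def wx scalerA divff// scale1r.
by rewrite adjoint_scaled_unitaryK linZ.
Qed.

Context (N : nat) (UN AN : H -> H)
  (UN_unitary : unitary_between (Wm A As phi N) (Wp A As phi N) UN)
  (AN_def : fin_approx A As phi rA N UN AN)
  (D : nat) (u : 'I_D -> H) (lam : 'I_D -> R[i])
  (u_basis : eigen_basis (HN A As phi N) AN u lam).

Lemma HN_mon i j : (i <= N)%N -> (j <= N)%N ->
  HN A As phi N (iter i A (iter j As phi)).
Proof. by move=> iN jN; apply: sub_lin_span; exists i, j. Qed.

Lemma HNm_mon i j : (i < N)%N -> (j <= N)%N ->
  HNm A As phi N (iter i A (iter j As phi)).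
Proof. by move=> iN jN; apply: sub_lin_span; exists i, j. Qed.

Lemma HNm_sub : HNm A As phi N `<=` HN A As phi N.
Proof.
by apply: lin_span_sub => _ [i [j [iN jN ->]]]; apply: HN_mon => //; exact: ltnW.
Qed.

Lemma HN_basis k : HN A As phi N (u k).
Proof. by have [_ <- _] := u_basis; apply: sub_lin_span; exists k. Qed.

Lemma HNm_A v : HNm A As phi N v -> HNp A As phi N (A v).
Proof.
move: v; apply: lin_span_ind; first by rewrite lin0; exact: lin_span0.
move=> a _ y [i [j [iN jN ->]]] _ IH; rewrite linP; apply: lin_span_comb => //.
by apply: sub_lin_span; exists i.+1, j.
Qed.

(** On [H_N^-] the operator [A_N] is [A], which stretches by [|q|] and lands in
    [H_N^+]; on the orthogonal complement it is [|q|] times an isometry into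
    the complement of [H_N^+].  Pythagoras then shows that [A_N] stretches
    everything by [|q|]. *)
Lemma eigenvalue_sqnorm k : cmod (lam k) ^+ 2 = rA.
Proof.
have [uu _ ulam] := u_basis; have [_ ANlin ANm ANW] := AN_def.
pose s := [seq iter i A (iter j As phi) | i <- iota 0 N, j <- iota 0 N.+1].
have sE x : x \in s ->
    exists i j, [/\ (i < N)%N, (j <= N)%N & x = iter i A (iter j As phi)].
  move=> /allpairsP[p [+ + ->]]; rewrite !mem_iota !add0n ltnS => iN jN.
  by exists p.1, p.2.
have [a sa ua] := orth_projection s (u k).
have HNa : HNm A As phi N a.
  by apply: (lin_span_sub _ sa) => x /sE[i [j [iN jN ->]]]; exact: HNm_mon.
pose b := u k - a.
have HNb : HN A As phi N b by apply: lin_spanB; [exact: HN_basis|exact: HNm_sub].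
have bm w : HNm A As phi N w -> hdot w b = 0.
  apply: lin_span_orth => _ [i [j [iN jN ->]]]; apply: ua.
  by apply/allpairsP; exists (i, j); rewrite !mem_iota /= add0n iN ltnS jN.
have Wb : Wm A As phi N b by [].
have [_ UNim UNdot] := UN_unitary.
have [_ UNb] : Wp A As phi N (UN b) by rewrite -UNim; exists b.
have e : AN (u k) = A a + (Num.sqrt rA)%:C *: UN b.
  rewrite -(subrK a (u k)) addrC -/b -[a]scale1r ANlin//; last exact: HNm_sub.
  by rewrite !scale1r ANm// ANW.
have ab : cmod (u k) ^+ 2 = cmod a ^+ 2 + cmod b ^+ 2.
  by rewrite -pythagoras ?bm// /b addrC subrK.
have cu : cmod (u k) ^+ 2 = 1.
  by apply: complexI; rewrite -hdotxx uu eqxx.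
have UNnorm : cmod (UN b) ^+ 2 = cmod b ^+ 2.
  by apply: complexI; rewrite -!hdotxx UNdot.
have : cmod (AN (u k)) ^+ 2 = rA.
  rewrite e pythagoras; last by rewrite hdotZr UNb ?mulr0//; exact: HNm_A.
  rewrite scaled_unitary_cmod cmodZ cmod_real ger0_norm ?sqrtr_ge0//.
  rewrite !exprMn sqr_sqrtr ?sqr_ge0// UNnorm -mulrDr -ab cu mulr1//.
by rewrite ulam cmodZ exprMn cu mulr1.
Qed.

Lemma basis_AN v : HN A As phi N v -> forall k,
  hdot (u k) (AN v) = lam k * hdot (u k) v.
Proof.
have [uu uspan ulam] := u_basis; have [_ ANlin _ _] := AN_def.
rewrite -uspan => + k; move: v; apply: lin_span_ind => [|a _ y [j _ <-]].
  have H0 : HN A As phi N 0 by exact: lin_span0.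
  have := ANlin (-1) 0 0 H0 H0; rewrite !scaleN1r addr0 oppr0 addNr => ->.
  by rewrite !hdot0r mulr0.
rewrite uspan => Hy IH; rewrite ANlin//; last exact: HN_basis.
rewrite !hdotDr !hdotZr IH ulam hdotZr uu mulrDr; congr (_ + _).
have [<-|kj] := eqVneq k j; first by rewrite !mulr1 mulrC.
by rewrite !mulr0.
Qed.

Lemma basis_A v : HNm A As phi N v -> forall k,
  hdot (u k) (A v) = lam k * hdot (u k) v.
Proof.
have [_ _ ANm _] := AN_def.
by move=> Hv k; rewrite -ANm// basis_AN//; exact: HNm_sub.
Qed.

(** [A_N^*] acts on [A^{* j} phi] as [A^*]: this follows from
    [A A^* = |q|^2] and [|lam|^2 = |q|^2]. *)
Lemma basis_mon k i j : (0 < N)%N -> (i <= N)%N -> (j <= N)%N ->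
  hdot (u k) (iter i A (iter j As phi)) =
    lam k ^+ i * (lam k)^* ^+ j * hdot (u k) phi.
Proof.
move=> N0; elim: i => [_|i IH iN jN] /=; last first.
  rewrite basis_A; last exact: HNm_mon.
  by rewrite IH ?(ltnW iN)// exprS !mulrA.
rewrite expr0 mul1r; elim: j => [|j IH jN]; first by rewrite expr0 mul1r.
have e : rA%:C * hdot (u k) (iter j As phi) = lam k * hdot (u k) (iter j.+1 As phi).
  by rewrite -hdotZr -scaled_unitary_adjointK -basis_A//; exact: (@HNm_mon 0 j.+1).
have rA0 : rA%:C != 0 :> R[i].
  by rewrite (inj_eq (@complexI _)) expf_neq0// cmod_eq0.
apply: (mulfI rA0); rewrite -{1}(eigenvalue_sqnorm k) -conjM_cmod -mulrA -e.
by rewrite IH ?(ltnW jN)// exprS; ring.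
Qed.

(** The successor makes the level positive, as [basis_mon] requires. *)
Definition poly_level (P : {poly {poly R[i]}}) : nat :=
  (\max_(i < size P) size (P`_i)%R + size P).+1.

Lemma HN_op_eval P : (poly_level P <= N)%N -> HN A As phi N (op_eval P A As phi).
Proof.
move=> PN; apply: lin_span_sum => i _; apply: lin_span_sum => j _.
apply: lin_spanZ; apply: HN_mon; apply: leq_trans (ltnW PN).
  by apply: leq_trans (leq_addl _ _); exact: ltnW.
apply: leq_trans (leq_addr _ _); apply: leq_trans (leq_bigmax i).
exact: ltnW.
Qed.

Lemma basis_op_eval P k : (poly_level P <= N)%N ->
  hdot (u k) (op_eval P A As phi) = f_poly P (lam k) * hdot (u k) phi.
Proof.
move=> PN; rewrite /op_eval f_polyE hdot_sumr mulr_suml; apply: eq_bigr => i _.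
rewrite hdot_sumr mulr_suml; apply: eq_bigr => j _.
rewrite hdotZr basis_mon ?mulrA//.
- exact: leq_trans PN.
- apply: leq_trans (ltnW PN).
  by apply: leq_trans (leq_addl _ _); exact: ltnW.
- apply: leq_trans (ltnW PN).
  apply: leq_trans (leq_addr _ _); apply: leq_trans (leq_bigmax i).
  exact: ltnW.
Qed.

Context (u_phi_ge0 : forall n, 0 <= hdot (u n) phi).

Lemma xiE k : hdot (u k) phi = (Re (hdot (u k) phi))%:C.
Proof. by have /ger0_Im := u_phi_ge0 k; case: (hdot _ _) => a b /= ->. Qed.

(** The projection of [phi] onto the span of the eigenvectors with eigenvalues
    in [X]; dividing it by [mu_N(X)] gives the approximate delta function. *)
Definition spectral_part (X : set R[i]) : H :=
  \sum_(k < D | `[< X (lam k) >]) (Re (hdot (u k) phi))%:C *: u k.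

Lemma HN_spectral_part X : HN A As phi N (spectral_part X).
Proof. by apply: lin_span_sum => k _; apply: lin_spanZ; exact: HN_basis. Qed.

Lemma spectral_part_sub_poly X P : (poly_level P <= N)%N ->
  cmod (spectral_part X - op_eval P A As phi) ^+ 2 =
  \sum_k cmod (\1_X (lam k) - f_poly P (lam k)) ^+ 2 * Re (hdot (u k) phi) ^+ 2.
Proof.
have [uu uspan ulam] := u_basis => PN.
rewrite {1}(@orthonormal_expansion _ _ _ u (op_eval P A As phi))//; last first.
  by rewrite uspan; exact: HN_op_eval.
rewrite /spectral_part big_mkcond -sumrB.
under eq_bigr => k _.
  rewrite (_ : _ - _ = ((\1_X (lam k) - f_poly P (lam k)) *
    (Re (hdot (u k) phi))%:C) *: u k); last first.
    rewrite basis_op_eval// xiE indicE; case: asboolP => Xk.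
      by rewrite mem_set// mulrBl mul1r scalerBl.
    by rewrite memNset//= !sub0r mulNr scaleNr.
  over.
rewrite orthonormal_sqnorm//; apply: eq_bigr => k _.
by rewrite cmodM cmod_real exprMn real_normK ?num_real.
Qed.

Lemma spectral_part_sqnorm X :
  cmod (spectral_part X) ^+ 2 =
  \sum_(k < D | `[< X (lam k) >]) Re (hdot (u k) phi) ^+ 2.
Proof.
have [uu _ _] := u_basis.
rewrite /spectral_part big_mkcond [RHS]big_mkcond /=.
under eq_bigr => k _.
  rewrite (_ : (if _ then _ else _) =
    (if `[< X (lam k) >] then (Re (hdot (u k) phi))%:C else 0) *: u k); last first.
    by case: asboolP => // _; rewrite scale0r.
  over.
rewrite orthonormal_sqnorm//; apply: eq_bigr => k _.
by case: ifP => _; rewrite ?cmod0 ?expr0n// cmod_real real_normK ?num_real.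
Qed.

End finite_approximation.

(** * Limits along the ultrafilter *)

Section ultralimits.
Context (R : realType) (U : div_ultrafilter).

Lemma cvg_cmodP (V : normedModType R[i]) T (F : set_system T) (FF : Filter F)
    (f : T -> V) (l : V) :
  f @ F --> l <-> forall e : R, 0 < e -> \forall t \near F, cmod (f t - l) < e.
Proof.
rewrite cvgrPdistC_lt; split => h e e0.
  have := h e%:C; rewrite ltcR => /(_ e0); apply: filterS => t.
  by rewrite norm_cmod ltcR.
case: e e0 => a b e0; have /= b0 := ger0_Im (ltW e0); rewrite b0 ltcR in e0 *.
by apply: filterS (h _ e0) => t; rewrite norm_cmod ltcR.
Qed.

(** The square of a positive multiple of [m + 1] exceeds [m]. *)
Lemma near_ultra_ge m : \forall N \near ufilter U, (m <= N)%N.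
Proof.
apply: filterS (@ufilter_div U m.+1 isT) => N [N0 [k Nk mk]].
have k0 : (0 < k)%N by case: k Nk {mk} => // Nk; rewrite Nk in N0.
rewrite Nk expnS expn1; apply: leq_trans (leq_pmulr _ k0).
by apply: ltnW; exact: dvdn_leq.
Qed.

Lemma ultra_cvg_bounded (f : nat -> R) (k : R) :
  (\forall N \near ufilter U, `|f N| <= k) -> exists l : R, f @ ufilter U --> l.
Proof.
move=> fk; have : (f @ ufilter U) `[- k, k]%classic.
  by apply: filterS fk => N; rewrite ler_norml /= in_itv.
move=> /(@segment_compact R (- k) k _ _)[l [_ cl]]; exists l => B lB.
have [//|/= h] := in_ultra_setVsetC (f @^-1` B) (ufilter_ultra U).
by have [x []] := cl (~` B) B h lB.
Qed.

Lemma cmod_ultra_cvg_bounded (f : nat -> R[i]) (k : R) :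
  (\forall N \near ufilter U, cmod (f N) <= k) -> exists l : R[i], f @ ufilter U --> l.
Proof.
move=> fk.
have [a fa] : exists a : R, (fun N => Re (f N)) @ ufilter U --> a.
  by apply: (@ultra_cvg_bounded _ k); apply: filterS fk => N; apply/le_trans/le_Re_cmod.
have [b fb] : exists b : R, (fun N => Im (f N)) @ ufilter U --> b.
  by apply: (@ultra_cvg_bounded _ k); apply: filterS fk => N; apply/le_trans/le_Im_cmod.
exists (a +i* b); apply/cvg_cmodP => e e0.
have e2 : 0 < e / 2 by rewrite divr_gt0.
have /cvgrPdistC_lt/(_ _ e2) ha := fa; have /cvgrPdistC_lt/(_ _ e2) hb := fb.
apply: filterS2 ha hb => N ha hb; rewrite [e]splitr.
apply: le_lt_trans (cmod_le_ReIm _) _.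
by rewrite Re_add Im_add Re_opp Im_opp ltrD.
Qed.

End ultralimits.

Section limit_content.
Context (R : realType) (U : div_ultrafilter).
Context (D : nat -> nat) (lam : forall N, 'I_(D N) -> R[i]).
Context (xi : forall N, 'I_(D N) -> R).
Implicit Types X Y : set R[i].

Local Notation muN := (muN lam xi).
Local Notation mun := (mun U lam xi).

Hypothesis xi_unit : forall N, \sum_(n < D N) xi n ^+ 2 = 1.

Lemma muN_ge0 N X : 0 <= muN N X.
Proof. by apply: sumr_ge0 => n _; exact: sqr_ge0. Qed.

Lemma le_muN N X Y : X `<=` Y -> muN N X <= muN N Y.
Proof.
move=> XY; rewrite /Defs.muN big_mkcond [leRHS]big_mkcond /=.
apply: ler_sum => n _; case: asboolP => [/XY Yn|_]; first by case: asboolP.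
by case: asboolP => // _; exact: sqr_ge0.
Qed.

Lemma muN_le1 N X : muN N X <= 1.
Proof.
rewrite -(xi_unit N) /Defs.muN big_mkcond; apply: ler_sum => n _.
by case: ifP => // _; exact: sqr_ge0.
Qed.

Lemma cvg_mun X : (fun N => muN N X) @ ufilter U --> mun X.
Proof.
have [l hl] : exists l : R, (fun N => muN N X) @ ufilter U --> l.
  apply: (@ultra_cvg_bounded _ _ _ 1); apply: nearW => N.
  by rewrite ger0_norm ?muN_ge0// muN_le1.
by rewrite /Defs.mun (cvg_lim _ hl).
Qed.

Lemma le_mun X Y : X `<=` Y -> mun X <= mun Y.
Proof.
move=> XY; apply: (ler_cvg_to (@cvg_mun X) (@cvg_mun Y)); apply: nearW => N.
exact: le_muN.
Qed.

Lemma mun_le1 X : mun X <= 1.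
Proof. by apply: (cvgr_to_le (@cvg_mun X)); apply: nearW => N; exact: muN_le1. Qed.

Lemma cvg_sum_mun (I : Type) (s : seq I) (P : pred I) (F : I -> set R[i]) :
  (fun N => \sum_(i <- s | P i) muN N (F i)) @ ufilter U -->
  \sum_(i <- s | P i) mun (F i).
Proof.
apply: cvg_big => [|i _]; last exact: cvg_mun.
exact: add_continuous.
Qed.

Lemma mun_sum_le (I : Type) (s : seq I) (P : pred I) (F : I -> set R[i]) Y :
  (forall N, \sum_(i <- s | P i) muN N (F i) <= muN N Y) ->
  \sum_(i <- s | P i) mun (F i) <= mun Y.
Proof.
move=> h; apply: (ler_cvg_to (@cvg_sum_mun _ s P F) (@cvg_mun Y)).
exact: nearW.
Qed.

Lemma mun_le_sum (I : Type) (s : seq I) (P : pred I) (F : I -> set R[i]) Y :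
  (forall N, muN N Y <= \sum_(i <- s | P i) muN N (F i)) ->
  mun Y <= \sum_(i <- s | P i) mun (F i).
Proof.
move=> h; apply: (ler_cvg_to (@cvg_mun Y) (@cvg_sum_mun _ s P F)).
exact: nearW.
Qed.

(** Both this and [mun_cover] reduce to counting, for each eigenvalue, the sets
    of the family that contain it. *)
Lemma mun_disjoint (I : finType) (F : I -> set R[i]) Y :
  (forall i, F i `<=` Y) -> (forall i j l, F i l -> F j l -> i = j) ->
  \sum_i mun (F i) <= mun Y.
Proof.
move=> FY Fd; apply: mun_sum_le => N; rewrite /Defs.muN.
under eq_bigr do rewrite big_mkcond /=.
rewrite exchange_big [leRHS]big_mkcond /=; apply: ler_sum => n _.
have [[i Fi]|nF] := pselect (exists i, F i (lam n)); last first.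
  rewrite big1; first by case: ifP => // _; exact: sqr_ge0.
  by move=> i _; case: asboolP => // Fi; case: nF; exists i.
rewrite (bigD1 i)//= big1 ?addr0 => [|j ji].
  by rewrite !asboolT//; exact: FY Fi.
by case: asboolP => // Fj; move: ji; rewrite (Fd _ _ _ Fi Fj) eqxx.
Qed.

Lemma mun_cover (I : finType) (F : I -> set R[i]) Y :
  (forall l, Y l -> exists i, F i l) -> mun Y <= \sum_i mun (F i).
Proof.
move=> YF; apply: mun_le_sum => N; rewrite /Defs.muN.
under [leRHS]eq_bigr do rewrite big_mkcond /=.
rewrite exchange_big big_mkcond /=; apply: ler_sum => n _.
have s0 i : 0 <= if `[< F i (lam n) >] then xi n ^+ 2 else 0.
  by case: ifP => // _; exact: sqr_ge0.
case: asboolP => [/YF[i Fi]|_]; last exact: sumr_ge0.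
by rewrite (bigD1 i)//= asboolT// lerDl sumr_ge0.
Qed.

Lemma mun2_disjoint X1 X2 Y : X1 `<=` Y -> X2 `<=` Y ->
  X1 `&` X2 = set0 -> mun X1 + mun X2 <= mun Y.
Proof.
move=> h1 h2 h12.
have := @mun_disjoint bool (fun b => if b then X1 else X2) Y.
rewrite big_bool; apply => [[]//|[] [] l //= a b]; by
  have : (X1 `&` X2) l by []; rewrite h12.
Qed.

Lemma mun2_cover X1 X2 Y : Y `<=` X1 `|` X2 -> mun Y <= mun X1 + mun X2.
Proof.
move=> h; have := @mun_cover bool (fun b => if b then X1 else X2) Y.
by rewrite big_bool; apply => l /h[]; [exists true|exists false].
Qed.

End limit_content.

(** * The outer measure generated by the limit content *)

Section coordinates.
Context (R : realType).
Implicit Types (l y : R[i]) (b : bool).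

(** Real and imaginary parts as one family, so that vertical and horizontal
    lines are treated together. *)
Definition co b l : R := if b then Re l else Im l.

Definition box (lo hi : bool -> R) : set R[i] :=
  [set l | forall b, lo b < co b l < hi b].

Lemma coB b l y : co b (l - y) = co b l - co b y.
Proof. by case: b; rewrite /= ?Re_add ?Im_add ?Re_opp ?Im_opp. Qed.

Lemma le_co_cmod b l : `|co b l| <= cmod l.
Proof. by case: b; [exact: le_Re_cmod|exact: le_Im_cmod]. Qed.

Lemma cmod_le_co l e : (forall b, `|co b l| <= e) -> cmod l <= e + e.
Proof.
move=> h; apply: le_trans (cmod_le_ReIm l) _.
by apply: lerD; [exact: (h true)|exact: (h false)].
Qed.

Lemma nbhs_cmodP (V : normedModType R[i]) (l : V) (B : set V) :
  nbhs l B <-> exists2 e : R, 0 < e & forall y : V, cmod (y - l) < e -> B y.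
Proof.
split => [/nbhs_normP[e /= e0 eB]|[e e0 eB]].
  case: e e0 eB => a b e0 eB; have /= b0 := ger0_Im (ltW e0).
  rewrite b0 ltcR in e0 eB; exists a => // y ya; apply: eB => /=.
  by rewrite distrC norm_cmod ltcR.
apply/nbhs_normP; exists e%:C => /=; first by rewrite ltcR.
by move=> y /=; rewrite distrC norm_cmod ltcR; exact: eB.
Qed.

Lemma open_box lo hi : open (box lo hi).
Proof.
rewrite openE => l lB; apply/nbhs_cmodP.
pose e b := Num.min (co b l - lo b) (hi b - co b l).
have e0 b : 0 < e b by rewrite lt_min !subr_gt0 lB.
exists (Num.min (e true) (e false)); first by rewrite lt_min !e0.
move=> y ye b; have : `|co b (y - l)| < e b.
  apply: le_lt_trans (le_co_cmod _ _) _; apply: lt_le_trans ye _.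
  by case: b; rewrite ge_min lexx ?orbT.
rewrite coB lt_min !ltr_norml => /andP[/andP[h1 h2] /andP[h3 h4]].
by apply/andP; split; lra.
Qed.

(** The rectangles with rational sides, a countable base of the plane. *)
Definition rbox (n : nat) : set R[i] :=
  if (unpickle n : option ((rat * rat) * (rat * rat))) is Some (p, q)
  then box (fun b => ratr (if b then p.1 else q.1))
           (fun b => ratr (if b then p.2 else q.2))
  else set0.

Lemma open_rbox n : open (rbox n).
Proof.
by rewrite /rbox; case: unpickle => [[p q]|]; [exact: open_box|exact: open0].
Qed.

Lemma rbox_base l B : nbhs l B -> exists n, rbox n l /\ rbox n `<=` B.
Proof.
move=> /nbhs_cmodP[e e0 eB].
have lt1 b : co b l - e / 4 < co b l by rewrite ltrBlDr ltrDl divr_gt0.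
have lt2 b : co b l < co b l + e / 4 by rewrite ltrDl divr_gt0.
have ex1 b := rat_in_itvoo (lt1 b); have ex2 b := rat_in_itvoo (lt2 b).
pose p b := sval (cid (ex1 b)); pose q b := sval (cid (ex2 b)).
have pP b : co b l - e / 4 < ratr (p b) < co b l.
  by have := svalP (cid (ex1 b)); rewrite in_itv.
have qP b : co b l < ratr (q b) < co b l + e / 4.
  by have := svalP (cid (ex2 b)); rewrite in_itv.
exists (pickle ((p true, q true), (p false, q false))).
rewrite /rbox pickleK; split.
  move=> b; have /andP[_ h1] := pP b; have /andP[h2 _] := qP b.
  by case: b h1 h2 => /= -> ->.
move=> y yB; apply: eB; apply: (@le_lt_trans _ _ (e / 4 + e / 4)); last by lra.
apply: cmod_le_co => b; rewrite coB ler_norml.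
have := pP b; have := qP b; have := yB b.
by case: b => /= /andP[h1 h2] /andP[h3 h4] /andP[h5 h6]; apply/andP; split; lra.
Qed.

End coordinates.

Section outer_measure.
Context (R : realType) (U : div_ultrafilter).
Context (D : nat -> nat) (lam : forall N, 'I_(D N) -> R[i]).
Context (xi : forall N, 'I_(D N) -> R).
Hypothesis xi_unit : forall N, \sum_(n < D N) xi n ^+ 2 = 1.
Context (M : nat) (NI : nice_set U lam xi M).
Implicit Types X Y : set R[i].

Local Notation mun := (mun U lam xi).
Local Notation nu := (mu_star NI).
Local Notation Mr := (M%:R : R).

Lemma SqE l : Sq M l <-> forall b, - Mr <= co b l <= Mr.
Proof.
rewrite /Sq /= !ler_norml; split => [[h1 h2] []//|h].
by split; [exact: (h true)|exact: (h false)].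
Qed.

Lemma nset_itv c : nset NI c -> - Mr <= c <= Mr.
Proof. by move=> /(@nset_sub _ _ _ _ _ _ NI); rewrite /= in_itv. Qed.

Lemma Sqstar_box lo hi : (forall b, nset NI (lo b)) -> (forall b, nset NI (hi b)) ->
  Sqstar NI (box lo hi).
Proof.
move=> hlo hhi; exists (lo true), (hi true), (lo false), (hi false); split => //.
apply/seteqP; split => [l lB|l [_ h1 h2] []//].
split; [|exact: (lB true)|exact: (lB false)].
apply/SqE => b; have /andP[h1 h2] := lB b.
have /andP[h3 _] := nset_itv (hlo b); have /andP[_ h4] := nset_itv (hhi b).
by rewrite (le_trans h3 (ltW h1)) (le_trans (ltW h2) h4).
Qed.

Lemma SqstarP X : Sqstar NI X -> exists lo hi,
  [/\ forall b, nset NI (lo b), forall b, nset NI (hi b) & X = box lo hi].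
Proof.
move=> [r0 [r1 [r2 [r3 [h0 h1 h2 h3 ->]]]]].
exists (fun b => if b then r0 else r2), (fun b => if b then r1 else r3).
split; [by case|by case|]; apply/seteqP; split => [l [_ ? ?] []//|l lB].
split; [|exact: (lB true)|exact: (lB false)].
apply/SqE => b; have /andP[h4 h5] := lB b.
have /andP[a1 _] : - Mr <= (if b then r0 else r2) <= Mr.
  by case: (b); exact: nset_itv.
have /andP[_ a2] : - Mr <= (if b then r1 else r3) <= Mr.
  by case: (b); exact: nset_itv.
by rewrite (le_trans a1 (ltW h4)) (le_trans (ltW h5) a2).
Qed.

Lemma Sqstar_set0 : Sqstar NI set0.
Proof.
have [NM _] := nset_bounds NI.
rewrite (_ : set0 = box (fun=> Mr) (fun=> Mr)); first exact: Sqstar_box.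
apply/seteqP; split => // l /(_ true) /andP[h1 h2].
by have := lt_trans h1 h2; rewrite ltxx.
Qed.

Lemma interior_Sq : interior (Sq M) = box (fun=> - Mr) (fun=> Mr).
Proof.
apply/seteqP; split => [l /nbhs_cmodP[e e0 eB] b|]; last first.
  apply: (@subset_trans _ (interior (box (fun=> - Mr) (fun=> Mr)))).
    by have := @open_box R (fun=> - Mr) (fun=> Mr); rewrite openE.
  apply: interiorS => l lB; apply/SqE => b.
  by have /andP[/ltW h1 /ltW h2] := lB b; rewrite h1 h2.
pose d : R[i] := if b then (e / 2)%:C else 0 +i* (e / 2).
have dE : co b d = e / 2 by rewrite /d; case: (b).
have de : cmod d < e.
  have -> : cmod d = e / 2.
    rewrite /d; case: (b); first by rewrite cmod_real ger0_norm// divr_ge0// ltW.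
    by rewrite cmodE /= expr0n add0r sqrtr_sqr ger0_norm// divr_ge0// ltW.
  by lra.
have /SqE/(_ b)/andP[_ h1] : Sq M (l + d) by apply: eB; rewrite addrC addKr.
have /SqE/(_ b)/andP[h2 _] : Sq M (l - d) by apply: eB; rewrite addrC addKr cmodN.
rewrite coB dE in h2; rewrite -[d]opprK coB in h1.
have := coB b 0 d; rewrite sub0r => e1; rewrite e1 dE in h1.
have co0 : co b (0 : R[i]) = 0 by case: (b).
by rewrite co0 in h1; apply/andP; split; lra.
Qed.

Local Open Scope ereal_scope.

Lemma nu_le_single X Y : Sqstar NI Y -> X `&` interior (Sq M) `<=` Y ->
  nu X <= (mun Y)%:E.
Proof.
move=> SY XY; apply: ereal_inf_lbound => /=.
exists (fun i => if i == 0%N then Y else set0).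
  split; first by case => [|i] //=; exact: Sqstar_set0.
  by move=> l /XY Yl; exists 0%N.
rewrite nneseries_recl//=; last by move=> k _; rewrite lee_fin mun_ge0.
rewrite eseries0 ?adde0// => i i1 _.
by case: i i1 => //= i _; rewrite mun0.
Qed.

Lemma nu_le1 X : nu X <= 1.
Proof.
have [NM NM'] := nset_bounds NI.
apply: (@le_trans _ _ (mun (box (fun=> - Mr)%R (fun=> Mr)))%:E).
  by apply: nu_le_single; [exact: Sqstar_box|rewrite interior_Sq; exact: subIsetr].
by rewrite lee_fin mun_le1.
Qed.

Lemma nu_fin X : nu X \is a fin_num.
Proof.
by rewrite ge0_fin_numE ?mu_star_ge0// (le_lt_trans (nu_le1 X))// ltry.
Qed.

Lemma nu_out X : X `&` interior (Sq M) `<=` set0 -> nu X = 0.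
Proof.
move=> h; apply/eqP; rewrite eq_le mu_star_ge0 andbT.
by have := nu_le_single Sqstar_set0 h; rewrite mun0.
Qed.

Lemma nset_between (a c : R) : (- Mr <= a)%R -> (c <= Mr)%R -> (a < c)%R ->
  exists2 x, nset NI x & (a < x < c)%R.
Proof.
move=> Ma cM ac; pose z := ((a + c) / 2)%R.
have az : (a < z < c)%R by rewrite /z; apply/andP; split; lra.
have /(@nset_dense _ _ _ _ _ _ NI) : `[(- Mr)%R, Mr]%classic z.
  by rewrite /= in_itv /=; apply/andP; split; case/andP: az => h1 h2; lra.
have zac : nbhs z `]a, c[%classic.
  by apply: open_nbhs_nbhs; split; [exact: interval_open|rewrite /= in_itv].
by move=> /(_ _ zac)[x [nx]]; rewrite /= in_itv => xac; exists x.
Qed.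

Lemma nu_U2 X Y : nu (X `|` Y) <= nu X + nu Y.
Proof. exact: outer_measureU2. Qed.

(** Niceness of one vertical or horizontal line.  The sides of the cells of the
    grids are nice in this sense but need not belong to [NI]. *)
Definition nice_line b (c : R) := forall d : R, (0 < d)%R -> exists2 e : R, (0 < e)%R &
  (mun [set l | Sq M l /\ (`|co b l - c| < e)%R] < d)%R.

Lemma nset_nice_line b c : nset NI c -> nice_line b c.
Proof.
move=> /(@nset_nice _ _ _ _ _ _ NI) h d /h[e e0 [h1 h2]]; exists e => //.
by case: b; [exact: h1|exact: h2].
Qed.

Lemma nset_below_lt b c (d : R) : (- Mr < c <= Mr)%R -> nice_line b c -> (0 < d)%R ->
  exists c', [/\ nset NI c', (c' < c)%R &
    (mun [set l | Sq M l /\ (c' < co b l <= c)%R] < d)%R].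
Proof.
move=> /andP[Mc cM] nc /nc[e e0 he].
have [||//|c' nc' /andP[h1 h2]] := @nset_between (Num.max (- Mr) (c - e))%R c.
- by rewrite le_max lexx.
- by [].
- by rewrite gt_max Mc ltrBlDr ltrDl.
exists c'; split => //; apply: le_lt_trans he; apply: le_mun => // l [Sl /andP[h3 h4]].
split => //; rewrite gt_max in h1; case/andP: h1 => _ h1.
by rewrite ltr_norml; apply/andP; split; lra.
Qed.

Lemma nset_above_lt b c (d : R) : (- Mr <= c < Mr)%R -> nice_line b c -> (0 < d)%R ->
  exists c', [/\ nset NI c', (c < c')%R &
    (mun [set l | Sq M l /\ (c <= co b l < c')%R] < d)%R].
Proof.
move=> /andP[Mc cM] nc /nc[e e0 he].
have [//||//|c' nc' /andP[h1 h2]] := @nset_between c (Num.min Mr (c + e))%R.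
- by rewrite ge_min lexx.
- by rewrite lt_min cM ltrDl.
exists c'; split => //; apply: le_lt_trans he; apply: le_mun => // l [Sl /andP[h3 h4]].
split => //; rewrite lt_min in h2; case/andP: h2 => _ h2.
by rewrite ltr_norml; apply/andP; split; lra.
Qed.

Lemma nset_below b c (d : R) : (- Mr <= c <= Mr)%R -> nice_line b c -> (0 < d)%R ->
  exists c', [/\ nset NI c', (c' <= c)%R &
    (mun [set l | Sq M l /\ (c' < co b l <= c)%R] < d)%R].
Proof.
move=> /andP[Mc cM] nc d0; have [Mc'|Mc'] := ltP (- Mr)%R c.
  have [|//|//|c' [h1 h2 h3]] := @nset_below_lt b c d; first by rewrite Mc'.
  by exists c'; split => //; exact: ltW.
have -> : c = (- Mr)%R by apply/eqP; rewrite eq_le Mc' Mc.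
exists (- Mr)%R; split => //; first by have [] := nset_bounds NI.
rewrite (_ : mkset _ = set0) ?mun0//; apply/seteqP; split => // l [_].
by move=> /andP[h1 h2]; have := lt_le_trans h1 h2; rewrite ltxx.
Qed.

Lemma nset_above b c (d : R) : (- Mr <= c <= Mr)%R -> nice_line b c -> (0 < d)%R ->
  exists c', [/\ nset NI c', (c <= c')%R &
    (mun [set l | Sq M l /\ (c <= co b l < c')%R] < d)%R].
Proof.
move=> /andP[Mc cM] nc d0; have [cM'|cM'] := ltP c Mr.
  have [|//|//|c' [h1 h2 h3]] := @nset_above_lt b c d; first by rewrite Mc cM'.
  by exists c'; split => //; exact: ltW.
have -> : c = Mr by apply/eqP; rewrite eq_le cM' cM.
exists Mr; split => //; first by have [] := nset_bounds NI.
rewrite (_ : mkset _ = set0) ?mun0//; apply/seteqP; split => // l [_].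
by move=> /andP[h1 h2]; have := le_lt_trans h1 h2; rewrite ltxx.
Qed.

(** Elements of [NI] on both sides of the line bound thin rectangles around
    it. *)
Lemma nu_line b c : nice_line b c -> nu [set l | co b l = c] = 0.
Proof.
move=> nc; have [/andP[h1 h2]|hc] := boolP (- Mr < c < Mr)%R; last first.
  apply: nu_out => l [/= lc]; rewrite interior_Sq => /(_ b).
  by rewrite lc (negbTE hc).
apply/eqP; rewrite eq_le mu_star_ge0 andbT; apply/lee_addgt0Pr => d d0.
have d2 : (0 < d / 2)%R by rewrite divr_gt0.
have [|//|//|c1 [n1 lt1 m1]] := @nset_below_lt b c (d / 2)%R.
  by rewrite h1 ltW.
have [|//|//|c2 [n2 lt2 m2]] := @nset_above_lt b c (d / 2)%R.
  by rewrite h2 ltW.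
have [NM NM'] := nset_bounds NI.
pose lo b' := if b' == b then c1 else (- Mr)%R.
pose hi b' := if b' == b then c2 else Mr.
have SB : Sqstar NI (box lo hi).
  by apply: Sqstar_box => b'; rewrite /lo /hi; case: eqP.
apply: (@le_trans _ _ (mun (box lo hi))%:E).
  apply: nu_le_single => // l [/= lc]; rewrite interior_Sq => lI b'.
  rewrite /lo /hi; case: eqP => [->|_]; last exact: lI.
  by rewrite lc lt1 lt2.
rewrite add0e lee_fin [d]splitr; apply: le_trans (lerD (ltW m1) (ltW m2)).
apply: mun2_cover => // l lB.
have Sl : Sq M l.
  have [lo' [hi' [a1 a2 e]]] := SqstarP SB; rewrite e in lB.
  apply/SqE => b'; have /andP[h4 h5] := lB b'.
  have /andP[h6 _] := nset_itv (a1 b'); have /andP[_ h7] := nset_itv (a2 b').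
  by rewrite (le_trans h6 (ltW h4)) (le_trans (ltW h5) h7).
have := lB b; rewrite /lo /hi eqxx => /andP[h3 h4].
have [h5|h5] := leP (co b l) c; [left|right]; split => //; apply/andP; split => //.
exact: ltW.
Qed.

(** The rectangle need not have its sides in [NI].  Moving them outwards to
    elements of [NI] costs only the mass of thin strips around the sides. *)
Lemma nu_box lo hi :
  (forall b, - Mr <= lo b <= Mr)%R -> (forall b, - Mr <= hi b <= Mr)%R ->
  (forall b, nice_line b (lo b)) -> (forall b, nice_line b (hi b)) ->
  nu (box lo hi) <= (mun (box lo hi))%:E.
Proof.
move=> lo_in hi_in nlo nhi; apply/lee_addgt0Pr => d d0.
have d4 : (0 < d / 4)%R by rewrite divr_gt0.
pose lo' b := sval (cid (nset_below (lo_in b) (nlo b) d4)).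
have lo'P b : [/\ nset NI (lo' b), (lo' b <= lo b)%R &
    (mun [set l | Sq M l /\ (lo' b < co b l <= lo b)%R] < d / 4)%R].
  exact: (svalP (cid (nset_below (lo_in b) (nlo b) d4))).
pose hi' b := sval (cid (nset_above (hi_in b) (nhi b) d4)).
have hi'P b : [/\ nset NI (hi' b), (hi b <= hi' b)%R &
    (mun [set l | Sq M l /\ (hi b <= co b l < hi' b)%R] < d / 4)%R].
  exact: (svalP (cid (nset_above (hi_in b) (nhi b) d4))).
have SB : Sqstar NI (box lo' hi').
  by apply: Sqstar_box => b; [have [] := lo'P b|have [] := hi'P b].
apply: (@le_trans _ _ (mun (box lo' hi'))%:E).
  apply: nu_le_single => // l [lB _] b; have /andP[h1 h2] := lB b.
  have [_ h3 _] := lo'P b; have [_ h4 _] := hi'P b.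
  by rewrite (le_lt_trans h3 h1) (lt_le_trans h2 h4).
rewrite -EFinD lee_fin.
pose Lb b := [set l | Sq M l /\ (lo' b < co b l <= lo b)%R].
pose Hb b := [set l | Sq M l /\ (hi b <= co b l < hi' b)%R].
have Lbd b : (mun (Lb b) <= d / 4)%R by have [_ _ /ltW] := lo'P b.
have Hbd b : (mun (Hb b) <= d / 4)%R by have [_ _ /ltW] := hi'P b.
have m2 b : (mun (Lb b `|` Hb b) <= d / 2)%R.
  apply: (@le_trans _ _ (mun (Lb b) + mun (Hb b))%R); first exact: mun2_cover.
  by have := Lbd b; have := Hbd b; lra.
have m4 : (mun ((Lb true `|` Hb true) `|` (Lb false `|` Hb false)) <= d)%R.
  apply: (@le_trans _ _ (mun (Lb true `|` Hb true) + mun (Lb false `|` Hb false))%R).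
    exact: mun2_cover.
  by have := m2 true; have := m2 false; lra.
apply: le_trans (lerD (lexx _) m4); apply: mun2_cover => // l lB.
have Sl : Sq M l.
  have [lo1 [hi1 [a1 a2 e]]] := SqstarP SB; rewrite e in lB.
  apply/SqE => b'; have /andP[h4 h5] := lB b'.
  have /andP[h6 _] := nset_itv (a1 b'); have /andP[_ h7] := nset_itv (a2 b').
  by rewrite (le_trans h6 (ltW h4)) (le_trans (ltW h5) h7).
have [?|nl] := pselect (box lo hi l); [by left|right].
have [b hb] : exists b, ~~ (lo b < co b l < hi b)%R.
  apply: contrapT => h; apply: nl => b; apply: contrapT => /negP hb.
  by apply: h; exists b.
suff : (Lb b `|` Hb b) l by case: (b); [left|right].
have /andP[h1 h2] := lB b; rewrite negb_and -!leNgt in hb.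
by case/orP: hb => h; [left|right]; split => //; apply/andP.
Qed.

(** Cutting the rectangles of a cover along the line gives covers of both sides
    by rectangles of the same kind, and the line itself is null. *)
Lemma caratheodory_nset b c : nset NI c -> (nu).-caratheodory [set l | (co b l < c)%R].
Proof.
move=> nc; apply: le_caratheodory_measurable => X.
apply: le_ereal_inf_tmp => _ [C [SC XC] <-].
pose C1 i := C i `&` [set l | (co b l < c)%R].
pose C2 i := C i `&` [set l | (c < co b l)%R].
have S1 i : Sqstar NI (C1 i).
  have [lo [hi [hlo hhi e]]] := SqstarP (SC i).
  rewrite (_ : C1 i = box lo (fun b' => if b' == b then Num.min (hi b') c else hi b')).
    apply: Sqstar_box => // b'; case: eqP => // _.
    by rewrite /Num.min; case: ifP.
  rewrite /C1 e; apply/seteqP; split => [l [h1 /= h2] b'|l h].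
    case: eqP => [->|_]; last exact: h1.
    by rewrite lt_min h2 andbT; exact: h1.
  have := h b; rewrite eqxx lt_min => /and3P[h1 h2 h3]; split => // b'.
  by have := h b'; case: eqP => [->|//]; rewrite lt_min => /and3P[-> ->].
have S2 i : Sqstar NI (C2 i).
  have [lo [hi [hlo hhi e]]] := SqstarP (SC i).
  rewrite (_ : C2 i = box (fun b' => if b' == b then Num.max (lo b') c else lo b') hi).
    apply: Sqstar_box => // b'; case: eqP => // _.
    by rewrite /Num.max; case: ifP.
  rewrite /C2 e; apply/seteqP; split => [l [h1 /= h2] b'|l h].
    case: eqP => [->|_]; last exact: h1.
    by rewrite gt_max h2 andbT; exact: h1.
  have := h b; rewrite eqxx gt_max => /andP[/andP[h1 h2] h3]; split => // b'.
  by have := h b'; case: eqP => [->|//]; rewrite gt_max => /andP[/andP[-> _] ->].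
apply: (@le_trans _ _ (\sum_(0 <= i <oo) (mun (C1 i))%:E +
                       \sum_(0 <= i <oo) (mun (C2 i))%:E)); last first.
  rewrite -nneseriesD; last 2 first.
    by move=> i _ _; rewrite lee_fin mun_ge0.
    by move=> i _ _; rewrite lee_fin mun_ge0.
  apply: lee_nneseries => [i _ _|i _]; first by rewrite -EFinD lee_fin addr_ge0// mun_ge0.
  rewrite -EFinD lee_fin; apply: mun2_disjoint => //; try exact: subIsetl.
  apply/seteqP; split => // l [[_ /= h1] [_ /= h2]].
  by have := lt_trans h1 h2; rewrite ltxx.
apply: leeD.
  apply: ereal_inf_lbound; exists C1 => //; split => // l [[Xl lc] lI].
  by have [i _ Cl] := XC l (conj Xl lI); exists i.
apply: (@le_trans _ _ (nu ([set l | co b l = c] `|` (X `&` [set l | (c < co b l)%R])))).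
  apply: le_outer_measure => l [Xl /= /negP]; rewrite -leNgt le_eqVlt.
  by move=> /orP[/eqP->|h]; [left|right].
apply: (@le_trans _ _ (nu [set l | co b l = c] + nu (X `&` [set l | (c < co b l)%R]))).
  exact: outer_measureU2.
rewrite nu_line ?add0e; last exact: nset_nice_line.
apply: ereal_inf_lbound; exists C2 => //; split => // l [[Xl lc] lI].
by have [i _ Cl] := XC l (conj Xl lI); exists i.
Qed.

Local Notation T := (caratheodory_type nu).

Lemma null_measurable X : nu X = 0 -> measurable (X : set T).
Proof.
move=> X0; apply: le_caratheodory_measurable => Z.
have h1 : nu (Z `&` X) <= 0 by rewrite -X0; apply: le_mu_star; exact: subIsetr.
have h2 : nu (Z `&` ~` X) <= nu Z by apply: le_mu_star; exact: subIsetl.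
by have := leeD h1 h2; rewrite add0e.
Qed.

(** Inside the open square a half-plane is a countable union of half-planes
    bounded by lines with coordinates in [NI]; outside everything is null. *)
Lemma measurable_halfplane b (c : R) :
  measurable ([set l | (co b l < c)%R] : set T).
Proof.
have [hc|Mc] := leP c (- Mr)%R.
  apply: null_measurable; apply: nu_out => l [/= lc]; rewrite interior_Sq.
  by move=> /(_ b)/andP[h _]; have := lt_trans h (lt_le_trans lc hc); rewrite ltxx.
have [cM|cM] := leP c Mr; last first.
  rewrite -[X in measurable X]setCK; apply: measurableC.
  apply: null_measurable; apply: nu_out => l [/= lc]; rewrite interior_Sq.
  by move=> /(_ b)/andP[_ h]; apply: lc; exact: lt_trans h cM.
have ex n : exists2 x, nset NI x & (Num.max (- Mr) (c - n.+1%:R^-1) < x < c)%R.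
  apply: nset_between => //; first by rewrite le_max lexx.
  by rewrite gt_max Mc ltrBlDr ltrDl invr_gt0 ltr0n.
pose x n := s2val (cid2 (ex n)).
have xN n : nset NI (x n) by exact: (s2valP (cid2 (ex n))).
have xP n : (Num.max (- Mr) (c - n.+1%:R^-1) < x n < c)%R.
  exact: (s2valP' (cid2 (ex n))).
rewrite (_ : mkset _ = \bigcup_n [set l | (co b l < x n)%R]).
  by apply: bigcupT_measurable => n; exact: caratheodory_nset.
apply/seteqP; split => [l /= lc|l [n _ /= h]]; last first.
  by apply: lt_trans h _; have /andP[] := xP n.
have [n hn] : exists n, (n.+1%:R^-1 < c - co b l)%R.
  have d0 : (0 < c - co b l)%R by rewrite subr_gt0.
  by have [n] := ltr_add_invr d0; rewrite add0r => h; exists n.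
exists n => //=; have /andP[+ _] := xP n; rewrite gt_max => /andP[_].
by apply: le_lt_trans; rewrite lerBrDl -lerBrDr ltW.
Qed.

Lemma measurable_co b : measurable_fun [set: T] (co b : T -> R).
Proof.
apply: (measurability _ (measurable_realfun.RGenInftyO.measurableE R)) => _ [_ [c ->] <-].
rewrite setTI (_ : _ @^-1` _ = [set l | (co b l < c)%R]).
  exact: measurable_halfplane.
by apply/seteqP; split => l /=; rewrite in_itv.
Qed.

Lemma measurable_box lo hi : measurable (box lo hi : set T).
Proof.
have h b : measurable ((co b : T -> R) @^-1` `]lo b, hi b[%classic).
  by rewrite -[X in measurable X]setTI; apply: measurable_co => //; exact: measurable_itv.
rewrite (_ : box lo hi = ((co true : T -> R) @^-1` `]lo true, hi true[%classic) `&`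
   ((co false : T -> R) @^-1` `]lo false, hi false[%classic)); first exact: measurableI.
apply/seteqP; split => [l lB|l [/=]]; first by split; rewrite /= in_itv; exact: lB.
by rewrite !in_itv => h1 h2 [].
Qed.

Lemma measurable_rbox n : measurable (@rbox R n : set T).
Proof.
by rewrite /rbox; case: unpickle => [[p q]|]; [exact: measurable_box|exact: measurable0].
Qed.

Lemma measurable_openT X : open X -> measurable (X : set T).
Proof.
rewrite openE => oX.
rewrite (_ : X = \bigcup_n (if `[< @rbox R n `<=` X >] then @rbox R n else set0)).
  apply: bigcupT_measurable => n; case: ifP => _; first exact: measurable_rbox.
  exact: measurable0.
apply/seteqP; split => [l /oX/rbox_base[n [nl nX]]|l [n _]].
  by exists n => //; rewrite asboolT.
by case: asboolP => // + nl; exact.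
Qed.

End outer_measure.
(** * Functions of polynomials *)

Section polynomial_functions.
Context (R : realType).

Lemma f_poly_ind (Q : (R[i] -> R[i]) -> Prop) :
  (forall c, Q (fun=> c)) -> Q id -> Q (fun l => l^*) ->
  (forall f g, Q f -> Q g -> Q (fun l => f l + g l)) ->
  (forall f g, Q f -> Q g -> Q (fun l => f l * g l)) ->
  forall P, Q (f_poly P).
Proof.
move=> Qc Qid Qj QD QM P.
have Qsum (I : Type) (s : seq I) (F : I -> R[i] -> R[i]) :
    (forall i, Q (F i)) -> Q (fun l => \sum_(i <- s) F i l).
  move=> QF; elim: s => [|i s IH].
    by rewrite (_ : (fun l => _) = fun=> 0)//; apply/funext => l; rewrite big_nil.
  rewrite (_ : (fun l => _) = fun l => F i l + \sum_(j <- s) F j l); first exact: QD.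
  by apply/funext => l; rewrite big_cons.
have QX f n : Q f -> Q (fun l => f l ^+ n).
  move=> Qf; elim: n => [|n IH].
    by rewrite (_ : (fun l => _) = fun=> 1)//; apply/funext => l; rewrite expr0.
  rewrite (_ : (fun l => _) = fun l => f l * f l ^+ n); first exact: QM.
  by apply/funext => l; rewrite exprS.
rewrite (_ : f_poly P = fun l =>
    \sum_(i < size P) \sum_(j < size P`_i) P`_i`_j * l ^+ i * l^* ^+ j); last first.
  by apply/funext => l; rewrite f_polyE.
apply: (Qsum _ _ (fun (i : 'I_(size P)) l => \sum_(j < size P`_i) P`_i`_j * l ^+ i * l^* ^+ j)) => i.
apply: (Qsum _ _ (fun (j : 'I_(size P`_i)) l => P`_i`_j * l ^+ i * l^* ^+ j)) => j.
by apply: (QM _ _ (QM _ _ (Qc _) (QX _ _ Qid)) (QX _ _ Qj)).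
Qed.

Definition bounded_on (S : set R[i]) (f : R[i] -> R[i]) :=
  exists2 C : R, 0 <= C & forall l, S l -> cmod (f l) <= C.

Definition lipschitz_on (S : set R[i]) (f : R[i] -> R[i]) :=
  exists2 C : R, 0 <= C & forall l l', S l -> S l' ->
    cmod (f l - f l') <= C * cmod (l - l').

Lemma f_poly_bounded_lipschitz (S : set R[i]) P : bounded_on S id ->
  bounded_on S (f_poly P) /\ lipschitz_on S (f_poly P).
Proof.
move=> Sb; apply: (@f_poly_ind (fun f => bounded_on S f /\ lipschitz_on S f)).
- move=> c; split; first by exists (cmod c).
  by exists 0 => // l l' _ _; rewrite subrr cmod0 mul0r.
- by split => //; exists 1 => // l l' _ _; rewrite mul1r.
- split; first by case: Sb => C C0 h; exists C => // l /h; rewrite cmod_conj.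
  by exists 1 => // l l' _ _; rewrite -rmorphB cmod_conj mul1r.
- move=> f g [[C1 C10 h1] [L1 L10 k1]] [[C2 C20 h2] [L2 L20 k2]]; split.
    exists (C1 + C2); first exact: addr_ge0.
    move=> l Sl; apply: le_trans (le_cmodD _ _) _.
    by apply: lerD; [exact: h1|exact: h2].
  exists (L1 + L2); first exact: addr_ge0.
  move=> l l' Sl Sl'; rewrite opprD addrACA mulrDl.
  apply: le_trans (le_cmodD _ _) _; apply: lerD; [exact: k1|exact: k2].
- move=> f g [[C1 C10 h1] [L1 L10 k1]] [[C2 C20 h2] [L2 L20 k2]]; split.
    exists (C1 * C2); first exact: mulr_ge0.
    by move=> l Sl; rewrite cmodM; apply: ler_pM; rewrite ?cmod_ge0 ?h1 ?h2.
  exists (C1 * L2 + L1 * C2); first by rewrite addr_ge0// mulr_ge0.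
  move=> l l' Sl Sl'.
  have -> : f l * g l - f l' * g l' = f l * (g l - g l') + (f l - f l') * g l' by ring.
  apply: le_trans (le_cmodD _ _) _; rewrite [leRHS]mulrDl !cmodM; apply: lerD.
    by rewrite -mulrA; apply: ler_pM; rewrite ?cmod_ge0 ?h1 ?k2.
  by rewrite mulrAC; apply: ler_pM; rewrite ?cmod_ge0 ?h2 ?k1.
Qed.

End polynomial_functions.

(** * Square-integrable functions *)

Section square_integrable.
Context (R : realType) (mu : {outer_measure set R[i] -> \bar R}).
Local Notation T := (caratheodory_type mu).
Local Notation m := (cara_measure mu).
Hypothesis open_meas : forall X : set R[i], open X -> measurable (X : set T).
Hypothesis mu_le1 : forall X, (mu X <= 1)%E.
Implicit Types (f g h : R[i] -> R[i]) (D : set R[i]).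

Lemma closed_meas (X : set R[i]) : closed X -> measurable (X : set T).
Proof.
by move=> cX; rewrite -[X in measurable X]setCK; apply: measurableC; apply: open_meas;
  exact: closed_openC.
Qed.

Lemma open_halfplane b (c : R) : open [set l : R[i] | co b l < c].
Proof.
rewrite openE => l /= lc; apply/nbhs_cmodP; exists (c - co b l).
  by rewrite subr_gt0.
move=> y yl /=; have := le_lt_trans (le_trans (ler_norm _) (le_co_cmod b _)) yl.
by rewrite coB ltrD2r.
Qed.

Lemma co_measurable_within b D f : measurable (D : set T) ->
  {within D, continuous f} -> measurable_fun (D : set T) (fun x : T => co b (f x)).
Proof.
move=> mD /continuousP fD.
apply: (measurability _ (measurable_realfun.RGenInftyO.measurableE R)) => _ [_ [c ->] <-].
have /open_subspaceP[V oV VD] := fD _ (@open_halfplane b c).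
rewrite (_ : _ `&` _ = V `&` D); first by apply: measurableI => //; exact: open_meas.
by rewrite VD setIC; congr (_ `&` _); apply/seteqP; split => x /=; rewrite in_itv.
Qed.

Lemma cmeasurable_within D f : measurable (D : set T) ->
  {within D, continuous f} -> cmeasurable mu D f.
Proof.
by move=> mD fD; split;
  [exact: (@co_measurable_within true)|exact: (@co_measurable_within false)].
Qed.

Lemma cmeasurableD D f g : cmeasurable mu D f -> cmeasurable mu D g ->
  cmeasurable mu D (fun l => f l + g l).
Proof.
move=> [f1 f2] [g1 g2]; split.
  by under eq_fun do rewrite Re_add; exact: measurable_funD.
by under eq_fun do rewrite Im_add; exact: measurable_funD.
Qed.

Lemma cmeasurableM D f g : cmeasurable mu D f -> cmeasurable mu D g ->
  cmeasurable mu D (fun l => f l * g l).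
Proof.
move=> [f1 f2] [g1 g2]; split.
  under eq_fun do rewrite Re_mul.
  by apply: measurable_funB; exact: measurable_funM.
under eq_fun do rewrite Im_mul.
by apply: measurable_funD; exact: measurable_funM.
Qed.

Lemma cmeasurable_cst D c : cmeasurable mu D (fun=> c).
Proof. by split; exact: measurable_cst. Qed.

Lemma cmeasurable_id D : measurable (D : set T) -> cmeasurable mu D id.
Proof.
by move=> mD; apply: cmeasurable_within => //; apply: continuous_subspaceT => x; exact: cvg_id.
Qed.

Lemma cmeasurable_f_poly D P : measurable (D : set T) -> cmeasurable mu D (f_poly P).
Proof.
move=> mD; apply: f_poly_ind.
- exact: cmeasurable_cst.
- exact: cmeasurable_id.
- have [h1 h2] := cmeasurable_id mD; split.
    by under eq_fun do rewrite Re_cconj.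
  under eq_fun do rewrite Im_cconj.
  exact: measurable_funN.
- by move=> f g; exact: cmeasurableD.
- by move=> f g; exact: cmeasurableM.
Qed.

Lemma cmeasurable_indic D (X : set R[i]) : measurable (X : set T) ->
  cmeasurable mu D (\1_X : R[i] -> R[i]).
Proof.
move=> mX; split.
  rewrite (_ : (fun x => _) = (\1_(X : set T) : T -> R)); first exact: measurable_indic.
  by apply/funext => x; rewrite !indicE; case: (_ \in _).
rewrite (_ : (fun x => _) = fun=> 0); first exact: measurable_cst.
by apply/funext => x; rewrite indicE; case: (_ \in _).
Qed.

Lemma cmeasurableS D D' f : measurable (D : set T) -> measurable (D' : set T) ->
  D' `<=` D -> cmeasurable mu D f -> cmeasurable mu D' f.
Proof.
by move=> mD mD' DD' [h1 h2]; split; [exact: measurable_funS h1|exact: measurable_funS h2].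
Qed.

Lemma measurable_cmod_sqr D f : cmeasurable mu D f ->
  measurable_fun (D : set T) (fun x : T => (cmod (f x) ^+ 2)%:E).
Proof.
move=> [h1 h2]; apply/measurable_EFinP.
under eq_fun do rewrite cmod_sqr.
by apply: measurable_funD; exact: measurable_funX.
Qed.

Context (S : set R[i]) (mS : measurable (S : set T)).

Lemma L2sqnorm_ge0 f : (0 <= L2sqnorm mu S f)%E.
Proof. by apply: integral_ge0 => x _; rewrite lee_fin sqr_ge0. Qed.

Lemma ae_le_L2sqnorm (c : R) f g : 0 <= c -> cmeasurable mu S f -> cmeasurable mu S g ->
  {ae m, forall x : T, S x -> cmod (f x) <= c * cmod (g x)} ->
  (L2sqnorm mu S f <= (c ^+ 2)%:E * L2sqnorm mu S g)%E.
Proof.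
move=> c0 mf mg fg; rewrite -ge0_integralZl_EFin ?sqr_ge0//; last 2 first.
- by move=> x _; rewrite lee_fin sqr_ge0.
- exact: measurable_cmod_sqr.
apply: ae_ge0_le_integral => //.
- by move=> x _; rewrite lee_fin sqr_ge0.
- exact: measurable_cmod_sqr.
- by move=> x _; rewrite mule_ge0// lee_fin sqr_ge0.
- by apply: measurable_funeM; exact: measurable_cmod_sqr.
apply: filterS fg => x /[apply] h.
by rewrite -EFinM lee_fin -exprMn ler_pXn2r// nnegrE ?cmod_ge0// mulr_ge0// cmod_ge0.
Qed.

Lemma le_L2sqnorm (c : R) f g : 0 <= c -> cmeasurable mu S f -> cmeasurable mu S g ->
  (forall x, S x -> cmod (f x) <= c * cmod (g x)) ->
  (L2sqnorm mu S f <= (c ^+ 2)%:E * L2sqnorm mu S g)%E.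
Proof. by move=> c0 mf mg fg; apply: ae_le_L2sqnorm => //; exact: aeW. Qed.

Lemma L2sqnorm_indic (X : set R[i]) : measurable (X : set T) ->
  L2sqnorm mu S (\1_X : R[i] -> R[i]) = mu (X `&` S).
Proof.
move=> mX; rewrite /L2sqnorm.
under eq_integral => x _.
  rewrite (_ : (_ ^+ 2)%:E = (\1_(X : set T) x)%:E); last first.
    by rewrite !indicE; case: (_ \in _); rewrite ?cmod1 ?cmod0 ?expr1n ?expr0n.
  over.
by rewrite integral_indic.
Qed.

Lemma in_L2_indic (X : set R[i]) : measurable (X : set T) ->
  in_L2 mu S (\1_X : R[i] -> R[i]).
Proof.
move=> mX; split; first exact: cmeasurable_indic.
by rewrite L2sqnorm_indic// (le_lt_trans (mu_le1 _))// ltry.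
Qed.

Lemma in_L2_mul h f : cmeasurable mu S h -> bounded_on S h -> in_L2 mu S f ->
  in_L2 mu S (fun l => h l * f l).
Proof.
move=> mh [C C0 hC] [mf f2]; split; first exact: cmeasurableM.
have h' : (L2sqnorm mu S (fun l => (h l * f l)%R) <= (C ^+ 2)%:E * L2sqnorm mu S f)%E.
  apply: le_L2sqnorm => //; first exact: cmeasurableM.
  by move=> x Sx; rewrite cmodM ler_wpM2r ?cmod_ge0// hC.
apply: le_lt_trans h' _; rewrite -ge0_fin_numE ?mule_ge0 ?lee_fin ?sqr_ge0 ?L2sqnorm_ge0//.
by rewrite fin_numM// ge0_fin_numE// L2sqnorm_ge0.
Qed.

Lemma in_L2_bounded f : cmeasurable mu S f -> bounded_on S f -> in_L2 mu S f.
Proof.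
move=> mf bf; have := in_L2_mul mf bf (in_L2_indic (@measurableT _ T)).
rewrite (_ : (fun l => _) = f)//; apply/funext => l.
by rewrite indicE in_setT mulr1.
Qed.

Lemma in_L2_comb a f g : in_L2 mu S f -> in_L2 mu S g ->
  in_L2 mu S (fun x => a * f x + g x).
Proof.
move=> f2 [mg g2].
have [maf af2] : in_L2 mu S (fun x => a * f x).
  have ba : bounded_on S (fun=> a) by exists (cmod a); rewrite ?cmod_ge0.
  exact: in_L2_mul (cmeasurable_cst S a) ba f2.
split; first exact: cmeasurableD.
apply: (@le_lt_trans _ _ (2%:E * (L2sqnorm mu S (fun x => (a * f x)%R) + L2sqnorm mu S g))%E).
  rewrite -ge0_integralD//; last 4 first.
  - by move=> x _; rewrite lee_fin sqr_ge0.
  - exact: measurable_cmod_sqr.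
  - by move=> x _; rewrite lee_fin sqr_ge0.
  - exact: measurable_cmod_sqr.
  rewrite -ge0_integralZl_EFin//; last 2 first.
  - by move=> x _; rewrite adde_ge0// lee_fin sqr_ge0.
  - by apply: emeasurable_funD; exact: measurable_cmod_sqr.
  apply: ge0_le_integral => //.
  - by move=> x _; rewrite lee_fin sqr_ge0.
  - by apply: measurable_cmod_sqr; exact: cmeasurableD.
  - apply: measurable_funeM; apply: emeasurable_funD; exact: measurable_cmod_sqr.
  move=> x _; rewrite -EFinD -EFinM lee_fin.
  have h := le_cmodD (a * f x) (g x).
  apply: (@le_trans _ _ ((cmod (a * f x) + cmod (g x)) ^+ 2)).
    by rewrite ler_pXn2r// nnegrE ?addr_ge0 ?cmod_ge0.
  have := sqr_ge0 (cmod (a * f x) - cmod (g x)).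
  by set p := cmod _; set r := cmod _; nra.
by rewrite lte_mul_pinfty ?lee_fin// lte_add_pinfty.
Qed.

Lemma in_L2B f g : in_L2 mu S f -> in_L2 mu S g -> in_L2 mu S (fun x => f x - g x).
Proof.
move=> f2 g2; have := in_L2_comb (-1) g2 f2.
by under eq_fun do rewrite mulN1r addrC.
Qed.

End square_integrable.
(** * The functional model and the spectrum *)

Section functional_model.
Context (R : realType) (mu : {outer_measure set R[i] -> \bar R}).
Local Notation T := (caratheodory_type mu).
Local Notation m := (cara_measure mu).
Hypothesis open_meas : forall X : set R[i], open X -> measurable (X : set T).
Hypothesis mu_le1 : forall X, (mu X <= 1)%E.
Context (S : set R[i]).
Hypothesis S_closed : closed S.
Hypothesis S_bounded : bounded_on S id.
Hypothesis mu_out : mu (~` S) = 0%E.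
Context (H : hilbertType R) (A As : {linear H -> H}) (phi : H).
Hypothesis phi_cyclic : cyclic_vec A As phi.
Hypothesis A_bounded : bounded_op A.
Context (G : (R[i] -> R[i]) -> H).
Hypothesis G_iso : L2_iso mu A As phi S G.
Implicit Types (f g h : R[i] -> R[i]) (X : set R[i]).

Let mS : measurable (S : set T). Proof. exact: closed_meas. Qed.

Lemma bounded_op_cmod (B : H -> H) : bounded_op B ->
  exists2 k : R, 0 <= k & forall x, cmod (B x) <= k * cmod x.
Proof.
move=> [k hk]; exists `|k| => // x; have := hk x.
rewrite !norm_cmod -rmorphM lecR => /le_trans; apply.
by rewrite ler_wpM2r ?cmod_ge0// ler_norm.
Qed.

Lemma le_of_sqr_ereal (a b c : R) (x y : \bar R) : x = (a ^+ 2)%:E -> y = (b ^+ 2)%:E ->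
  0 <= a -> 0 <= b -> 0 <= c -> (x <= (c ^+ 2)%:E * y)%E -> a <= c * b.
Proof.
move=> -> -> a0 b0 c0; rewrite -EFinM lee_fin -exprMn.
by rewrite ler_pXn2r// nnegrE// mulr_ge0.
Qed.

Lemma mu_restrict X : mu (X `&` S) = mu X.
Proof.
apply/eqP; rewrite eq_le le_outer_measure ?subIsetl//=.
have : (mu X <= mu ((X `&` S) `|` ~` S))%E.
  apply: le_outer_measure => l Xl.
  by have [Sl|Sl] := pselect (S l); [left|right].
move/le_trans; apply; apply: le_trans (outer_measureU2 _ _ _) _.
by rewrite mu_out adde0.
Qed.

Lemma in_L2_f_poly P : in_L2 mu S (f_poly P).
Proof.
apply: in_L2_bounded => //; first exact: cmeasurable_f_poly.
by have [] := f_poly_bounded_lipschitz P S_bounded.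
Qed.

Lemma G_sub f g : in_L2 mu S f -> in_L2 mu S g -> G f - G g = G (fun x => f x - g x).
Proof.
move=> f2 g2; have := L2_iso_linear G_iso (-1) g2 f2; rewrite scaleN1r addrC => <-.
by congr G; apply/funext => x; rewrite mulN1r addrC.
Qed.

Lemma G_scale a f : in_L2 mu S f -> G (fun x => a * f x) = a *: G f.
Proof.
move=> f2; have z2 : in_L2 mu S (fun=> 0).
  have := in_L2_f_poly 0; rewrite (_ : f_poly 0 = fun=> 0)//.
  by apply/funext => l; rewrite /f_poly !hornerC.
have G0 : G (fun=> 0) = 0.
  apply/eqP; rewrite -cmod_eq0 -sqrf_eq0; apply/eqP/EFin_inj.
  rewrite -(L2_iso_isometric G_iso z2) /L2sqnorm integral0_eq// => x _.
  by rewrite cmod0 expr0n.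
have := L2_iso_linear G_iso a f2 z2; rewrite G0 addr0 => <-.
by congr G; apply/funext => x; rewrite addr0.
Qed.

Lemma ae_le_G (c : R) f g : 0 <= c -> in_L2 mu S f -> in_L2 mu S g ->
  {ae m, forall x : T, S x -> cmod (f x) <= c * cmod (g x)} ->
  cmod (G f) <= c * cmod (G g).
Proof.
move=> c0 f2 g2 fg.
apply: (le_of_sqr_ereal (L2_iso_isometric G_iso f2) (L2_iso_isometric G_iso g2)).
all: rewrite ?cmod_ge0//.
by apply: ae_le_L2sqnorm => //; [case: f2|case: g2].
Qed.

Lemma le_G (c : R) f g : 0 <= c -> in_L2 mu S f -> in_L2 mu S g ->
  (forall x, S x -> cmod (f x) <= c * cmod (g x)) ->
  cmod (G f) <= c * cmod (G g).
Proof. by move=> c0 f2 g2 fg; apply: ae_le_G => //; exact: aeW. Qed.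

Lemma le_G_sub (c : R) f g f' g' : 0 <= c ->
  in_L2 mu S f -> in_L2 mu S g -> in_L2 mu S f' -> in_L2 mu S g' ->
  (forall x, S x -> cmod (f x - g x) <= c * cmod (f' x - g' x)) ->
  cmod (G f - G g) <= c * cmod (G f' - G g').
Proof.
move=> c0 f2 g2 f'2 g'2 fg; rewrite (G_sub f2 g2) (G_sub f'2 g'2).
exact: (le_G c0 (in_L2B mS f2 g2) (in_L2B mS f'2 g'2) fg).
Qed.

Lemma ae_eq_G f g : in_L2 mu S f -> in_L2 mu S g ->
  {ae m, forall x : T, S x -> f x = g x} -> G f = G g.
Proof.
move=> f2 g2 fg; apply/eqP; rewrite -subr_eq0 -cmod_eq0 eq_le cmod_ge0 andbT.
rewrite (G_sub f2 g2) -(mul0r (cmod (G f))).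
apply: (ae_le_G (lexx _) (in_L2B mS f2 g2) f2).
by apply: filterS fg => x /[apply] ->; rewrite subrr cmod0 mul0r.
Qed.

Lemma G_indic_sqnorm X : measurable (X : set T) ->
  mu X = (cmod (G (\1_X : R[i] -> R[i])) ^+ 2)%:E.
Proof.
move=> mX; rewrite -(L2_iso_isometric G_iso); last exact: in_L2_indic.
by rewrite L2sqnorm_indic// mu_restrict.
Qed.

Lemma dense_cmod (V : normedModType R[i]) (E : set V) : dense E ->
  forall v (e : R), 0 < e -> exists2 x, E x & cmod (x - v) < e.
Proof.
move=> dE v e e0; have ve : nbhs v (interior [set x | cmod (x - v) < e]).
  apply: nbhs_interior; apply/nbhs_cmodP; by exists e.
have [|x [/interior_subset xv Ex]] := dE _ _ (@open_interior _ [set x | cmod (x - v) < e]).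
  by exists v; exact: nbhs_singleton ve.
by exists x.
Qed.

Lemma poly_approx v (e : R) : 0 < e -> exists P, cmod (op_eval P A As phi - v) < e.
Proof.
by move=> e0; have [_ [P _ <-] h] := dense_cmod phi_cyclic v e0; exists P.
Qed.

Lemma in_L2_mul_id f : in_L2 mu S f -> in_L2 mu S (fun l => l * f l).
Proof. by move=> f2; apply: (@in_L2_mul _ _ _ mS id) => //; exact: cmeasurable_id. Qed.

(** The identity [A (G f) = G (l f)] holds for polynomials by construction of
    [G], and both sides are continuous in [f]. *)
Lemma G_mul_id f : in_L2 mu S f -> A (G f) = G (fun l => l * f l).
Proof.
move=> f2; apply/eqP; rewrite -subr_eq0 -cmod_eq0 eq_le cmod_ge0 andbT.
apply/ler_addgt0Pr => e e0; rewrite add0r.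
have [k k0 Ak] := bounded_op_cmod A_bounded; have [C C0 SC] := S_bounded.
have d0 : 0 < k + C + 1 by rewrite ltr_wpDl// addr_ge0.
have [P hP] := poly_approx (G f) (divr_gt0 e0 d0).
have eP : op_eval P A As phi = G (f_poly P) by rewrite (L2_iso_poly G_iso).
have e1 : A (G (f_poly P)) = G (fun l => l * f_poly P l).
  rewrite -eP -op_eval_mulX -(L2_iso_poly G_iso); congr G; apply/funext => l.
  by rewrite f_polyM f_polyX mulrC.
rewrite -(subrK (A (G (f_poly P))) (A (G f))) -addrA -linB [in X in _ + X]e1.
apply: le_trans (le_cmodD _ _) _.
have h1 : cmod (A (G f - G (f_poly P))) <= k * cmod (G f - G (f_poly P)) by exact: Ak.
have h2 : cmod (G (fun l => l * f_poly P l) - G (fun l => l * f l)) <=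
    C * cmod (G f - G (f_poly P)).
  have P2 := in_L2_f_poly P.
  apply: (le_G_sub C0 (in_L2_mul_id P2) (in_L2_mul_id f2) f2 P2) => x Sx.
  by rewrite -mulrBr cmodM cmodBC ler_wpM2r ?cmod_ge0//; exact: SC.
apply: le_trans (lerD h1 h2) _; rewrite -mulrDl cmodBC -eP.
apply: (@le_trans _ _ ((k + C + 1) * cmod (op_eval P A As phi - G f))).
  by rewrite ler_wpM2r ?cmod_ge0// lerDl.
by rewrite mulrC -ler_pdivlMr// ltW.
Qed.

Lemma in_L2_mul_sub f z : in_L2 mu S f -> in_L2 mu S (fun l => (l - z) * f l).
Proof.
move=> f2; have [C C0 SC] := S_bounded.
apply: (@in_L2_mul _ _ _ mS (fun l => l - z)) => //.
  apply: (@cmeasurableD _ _ _ id (fun=> - z)); first exact: cmeasurable_id.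
  exact: cmeasurable_cst.
exists (C + cmod z); first by rewrite addr_ge0// cmod_ge0.
by move=> l /SC h; apply: le_trans (le_cmodB _ _) _; rewrite lerD2r.
Qed.

Lemma G_mul_sub f z : in_L2 mu S f ->
  A (G f) - z *: G f = G (fun l => (l - z) * f l).
Proof.
move=> f2; have bz : bounded_on S (fun=> z) by exists (cmod z); rewrite ?cmod_ge0.
have z2 := in_L2_mul mS (cmeasurable_cst mu S z) bz f2.
rewrite (G_mul_id f2) -(G_scale z f2) (G_sub (in_L2_mul_id f2) z2).
by congr G; apply/funext => l; rewrite mulrBl.
Qed.

Lemma open_cball z (e : R) : open [set l : R[i] | cmod (l - z) < e].
Proof.
rewrite openE => l /= le; apply/nbhs_cmodP; exists (e - cmod (l - z)).
  by rewrite subr_gt0.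
move=> y yl /=; rewrite -(subrK l y) -addrA.
by apply: le_lt_trans (le_cmodD _ _) _; rewrite -ltrBrDr.
Qed.

(** If [A - z] has an inverse of norm at most [k], the indicator of a ball of
    radius less than [1 / k] around [z] is a vector that [A - z] shrinks too
    much, unless it vanishes. *)
Lemma resolvent_null z : ~ spectrum A z ->
  exists2 e : R, 0 < e & mu [set l : R[i] | cmod (l - z) < e] = 0%E.
Proof.
move=> /contrapT[K [Kb KA]]; have [k k0 Kk] := bounded_op_cmod Kb.
have k1 : 0 < k + 1 by rewrite ltr_wpDl.
exists (k + 1)^-1; first by rewrite invr_gt0.
set X := mkset _.
have mX : measurable (X : set T) by apply: open_meas; exact: open_cball.
have X2 := in_L2_indic mu_le1 mS mX.
rewrite G_indic_sqnorm//; congr _%:E; apply/eqP; rewrite sqrf_eq0.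
set v := G _.
have h1 : cmod (A v - z *: v) <= (k + 1)^-1 * cmod v.
  have k1' : 0 <= (k + 1)^-1 by rewrite invr_ge0 ltW.
  rewrite (G_mul_sub z X2); apply: (le_G k1' (in_L2_mul_sub z X2) X2) => x _.
  rewrite cmodM indicE; have [xX|xX] := boolP (x \in X).
    by rewrite ler_wpM2r ?cmod_ge0//; apply: ltW; rewrite inE in xX.
  by rewrite cmod0 !mulr0.
have h2 : cmod v <= k * cmod (A v - z *: v).
  by have [e _] := KA v; rewrite -{1}e.
rewrite eq_le cmod_ge0 andbT leNgt; apply/negP => v0.
have : cmod v <= k * ((k + 1)^-1 * cmod v).
  by apply: le_trans h2 _; exact: ler_wpM2l.
rewrite mulrA -{1}(mul1r (cmod v)) ler_pM2r// ler_pdivlMr// mul1r.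
by rewrite gerDl ler10.
Qed.

(** Multiplication by a bounded function that equals [1 / (l - z)] away from
    [z] inverts [A - z]. *)
Lemma null_resolvent z (e : R) : 0 < e -> mu [set l : R[i] | cmod (l - z) < e] = 0%E ->
  ~ spectrum A z.
Proof.
move=> e0; set X := mkset _ => X0; apply.
have mX : measurable (X : set T) by apply: open_meas; exact: open_cball.
pose t (l : R[i]) : R := Num.max (cmod (l - z) ^+ 2) (e ^+ 2).
pose h (l : R[i]) : R[i] := (t l)^-1%:C * (l - z)^*.
have t0 l : 0 < t l by rewrite lt_max [X in _ || X]exprn_gt0 ?orbT.
have hE l : cmod (h l) <= e^-1.
  rewrite cmodM cmod_conj cmod_real ger0_norm ?invr_ge0 ?(ltW (t0 l))//.
  rewrite mulrC ler_pdivrMr// mulrC ler_pdivlMr// le_max.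
  have [le|le] := leP e (cmod (l - z)); apply/orP; [left|right].
    by rewrite expr2 ler_wpM2l// cmod_ge0.
  by rewrite expr2 ler_wpM2r// ltW.
have hV l : l \in X \/ h l * (l - z) = 1.
  have [lX|lX] := boolP (l \in X); [by left|right].
  have le : e <= cmod (l - z) by rewrite leNgt; apply: contra lX => ?; rewrite inE.
  have tE : t l = cmod (l - z) ^+ 2.
    by apply/max_idPl; rewrite ler_pXn2r// nnegrE ?cmod_ge0// ltW.
  rewrite /h -mulrA conjM_cmod tE -rmorphM mulVf//= expf_neq0// gt_eqF//.
  exact: lt_le_trans le.
have hb : bounded_on S h by exists e^-1; rewrite ?invr_ge0 ?ltW.
have msub : cmeasurable mu S (fun l => l - z).
  apply: (@cmeasurableD _ _ _ id (fun=> - z)); first exact: cmeasurable_id.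
  exact: cmeasurable_cst.
have mh : cmeasurable mu S h.
  apply: cmeasurableM; last first.
    case: msub => h1 h2; split; first by under eq_fun do rewrite Re_cconj.
    under eq_fun do rewrite Im_cconj.
    exact: measurable_funN.
  split; last exact: measurable_cst.
  rewrite (_ : (fun x => _) = (fun x => x `^ (-1)) \o t); last first.
    by apply/funext => l /=; rewrite powR_inv1// ltW.
  apply: measurableT_comp; first exact: measurable_powR.
  apply: measurable_maxr; last exact: measurable_cst.
  exact/measurable_EFinP/measurable_cmod_sqr.
have hL f (f2 : in_L2 mu S f) : in_L2 mu S (fun l => h l * f l) := in_L2_mul mS mh hb f2.
have e1 : 0 <= e^-1 by rewrite invr_ge0 ltW.
have hG f g (f2 : in_L2 mu S f) (g2 : in_L2 mu S g) :
    cmod (G (fun l => h l * f l) - G (fun l => h l * g l)) <= e^-1 * cmod (G f - G g).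
  apply: (le_G_sub e1 (hL _ f2) (hL _ g2) f2 g2) => x _.
  by rewrite -mulrBr cmodM ler_wpM2r ?cmod_ge0.
pose F v := s2val (cid2 (L2_iso_surjective G_iso v)).
have F2 v : in_L2 mu S (F v) by exact: (s2valP (cid2 (L2_iso_surjective G_iso v))).
have GF v : G (F v) = v by exact: (s2valP' (cid2 (L2_iso_surjective G_iso v))).
pose K v := G (fun l => h l * F v l).
have KG f : in_L2 mu S f -> K (G f) = G (fun l => h l * f l).
  move=> f2; apply/eqP; rewrite -subr_eq0 -cmod_eq0 eq_le cmod_ge0 andbT.
  by apply: le_trans (hG _ _ (F2 _) f2) _; rewrite GF subrr cmod0 mulr0.
have Klin : linear K.
  move=> a x y; rewrite -{1}(GF x) -{1}(GF y) -(L2_iso_linear G_iso a (F2 x) (F2 y)).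
  rewrite (KG _ (in_L2_comb mS a (F2 x) (F2 y))).
  rewrite -(L2_iso_linear G_iso a (hL _ (F2 x)) (hL _ (F2 y))).
  by congr G; apply/funext => l; rewrite mulrDr mulrCA.
pose Kl : {linear H -> H} := HB.pack K (GRing.isLinear.Build _ _ _ _ K Klin).
have hX (f : R[i] -> R[i]) : in_L2 mu S f ->
    G (fun l => h l * ((l - z) * f l)) = G f.
  move=> f2; apply: (ae_eq_G (hL _ (in_L2_mul_sub z f2)) f2).
  exists X; split => // l /= lf; apply: contrapT => lX; apply: lf => Sl.
  have [|hl] := hV l; first by rewrite inE.
  by rewrite mulrA hl mul1r.
exists Kl; split.
  exists e^-1 => x /=; rewrite !norm_cmod -rmorphM lecR /K -{2}(GF x).
  apply: (le_G e1 (hL _ (F2 x)) (F2 x)) => y _.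
  by rewrite cmodM ler_wpM2r ?cmod_ge0.
move=> x /=; split.
  rewrite -{1 2}(GF x) (G_mul_sub z (F2 x)) (KG _ (in_L2_mul_sub z (F2 x))).
  by rewrite (hX _ (F2 x)).
rewrite /K (G_mul_sub z (hL _ (F2 x))) -{2}(GF x) -(hX _ (F2 x)).
by congr G; apply/funext => l; rewrite mulrCA.
Qed.

Lemma spectrum_sub : spectrum A `<=` S.
Proof.
move=> z zA; apply: contrapT => zS.
have /nbhs_cmodP[e e0 eS] : nbhs z (~` S).
  by have := closed_openC S_closed; rewrite openE; exact.
apply: (null_resolvent e0 _ zA); apply/eqP; rewrite eq_le outer_measure_ge0 andbT.
by rewrite -mu_out le_outer_measure// => l; exact: eS.
Qed.

Lemma spectrum_nbhs z X : spectrum A z -> nbhs z X -> mu X != 0%E.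
Proof.
move=> zA /nbhs_cmodP[e e0 eX]; apply/eqP => X0.
apply: (null_resolvent e0 _ zA); apply/eqP; rewrite eq_le outer_measure_ge0 andbT.
by rewrite -X0 le_outer_measure// => l; exact: eX.
Qed.

(** By [resolvent_null] and [null_resolvent] the points outside the spectrum are
    those with a null neighbourhood. *)
Lemma spectrum_support : spectrum A = [set z | forall n, rbox n z -> mu (@rbox R n) != 0%E].
Proof.
apply/seteqP; split => z /= hz.
  move=> n zn; apply: (spectrum_nbhs hz).
  by have := @open_rbox R n; rewrite openE; exact.
apply: contrapT => /resolvent_null[e e0 X0].
have /rbox_base[n [zn nX]] : nbhs z [set l : R[i] | cmod (l - z) < e].
  by apply/nbhs_cmodP; exists e.
have /eqP := hz n zn; apply; apply/eqP; rewrite eq_le outer_measure_ge0 andbT.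
by rewrite -X0 le_outer_measure.
Qed.

Lemma closed_spectrum : closed (spectrum A).
Proof.
rewrite -[spectrum A]setCK; apply: open_closedC; rewrite openE => z.
rewrite spectrum_support => /existsNP[n /not_implyP[zn /negP/negPn/eqP n0]].
have := @open_rbox R n; rewrite openE => /(_ _ zn).
by apply: filterS => y yn; apply/existsNP; exists n; apply/not_implyP; split => //; rewrite n0 eqxx.
Qed.

Lemma mu_spectrumC : mu (~` spectrum A) = 0%E.
Proof.
pose F n := if mu (@rbox R n) == 0%E then @rbox R n else set0.
apply/eqP; rewrite eq_le outer_measure_ge0 andbT.
apply: (@le_trans _ _ (mu (\bigcup_n F n))).
  apply: le_outer_measure => l; rewrite spectrum_support.
  move=> /existsNP[n /not_implyP[ln /negP/negPn n0]].
  by exists n => //; rewrite /F n0.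
apply: le_trans (outer_measure_sigma_subadditive mu F) _.
rewrite eseries0// => n _ _; rewrite /F; case: ifPn => [/eqP//|_].
exact: outer_measure0.
Qed.

(** * Operators with a continuous kernel *)

Lemma orth_of_sqnorm (x y : H) :
  (forall c : R[i], cmod (x + c *: y) ^+ 2 = cmod x ^+ 2 + cmod (c *: y) ^+ 2) ->
  hdot x y = 0.
Proof.
move=> h; have h' (c : R[i]) : Re (c * hdot x y) = 0.
  have : hdot (x + c *: y) (x + c *: y) = hdot x x + hdot (c *: y) (c *: y).
    by rewrite !hdotxx -rmorphD /= h.
  rewrite hdotDl !hdotDr hdotZr [hdot (c *: y) x]hdotC hdotZr => /(congr1 (@complex.Re R)).
  by rewrite !Re_add Re_cconj; set p := Re (c * _); lra.
(* The choice [c = <x|y>^*] makes the cross term [|<x|y>|^2]. *)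
have := h' (hdot x y)^*; rewrite conjM_cmod /= => /eqP; rewrite sqrf_eq0 cmod_eq0.
by move/eqP.
Qed.

Lemma G_disjoint_orth f g : in_L2 mu S f -> in_L2 mu S g ->
  (forall l, f l = 0 \/ g l = 0) -> hdot (G f) (G g) = 0.
Proof.
move=> f2 g2 fg; apply: orth_of_sqnorm => c.
rewrite addrC -(L2_iso_linear G_iso c g2 f2) -(G_scale c g2).
have cg2 : in_L2 mu S (fun x => c * g x).
  have bc : bounded_on S (fun=> c) by exists (cmod c); rewrite ?cmod_ge0.
  exact: in_L2_mul (cmeasurable_cst mu S c) bc g2.
apply: EFin_inj; rewrite EFinD -(L2_iso_isometric G_iso (in_L2_comb mS c g2 f2)).
rewrite -(L2_iso_isometric G_iso f2) -(L2_iso_isometric G_iso cg2).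
have [mf _] := f2; have [mg _] := cg2.
rewrite /L2sqnorm -ge0_integralD//; first last.
- exact: measurable_cmod_sqr.
- by move=> x _; rewrite lee_fin sqr_ge0.
- exact: measurable_cmod_sqr.
- by move=> x _; rewrite lee_fin sqr_ge0.
apply: eq_integral => x _; rewrite -EFinD; congr _%:E.
by have [->|->] := fg x; rewrite ?mulr0 ?addr0 ?add0r ?cmod0 ?expr0n ?add0r ?addr0.
Qed.

Local Notation sigma := (spectrum A).

Let msigma : measurable (sigma : set T).
Proof. by apply: closed_meas => //; exact: closed_spectrum. Qed.

Lemma mu_sigma X : mu (X `&` sigma) = mu X.
Proof.
apply/eqP; rewrite eq_le le_outer_measure ?subIsetl//=.
have : (mu X <= mu ((X `&` sigma) `|` ~` sigma))%E.
  apply: le_outer_measure => l Xl.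
  by have [Sl|Sl] := pselect (sigma l); [left|right].
move/le_trans; apply; apply: le_trans (outer_measureU2 _ _ _) _.
by rewrite mu_spectrumC adde0.
Qed.

Lemma compact_closed_bounded (E : set R[i]) : closed E -> bounded_on E id -> compact E.
Proof.
move=> cE [C C0 EC].
pose g (p : R * R) : R[i] := p.1 +i* p.2.
have cg : continuous g.
  move=> [a b]; apply/cvg_cmodP => e e0.
  have e2 : 0 < e / 2 by rewrite divr_gt0.
  exists (ball a (e / 2), ball b (e / 2)) => /=.
    by split; apply: nbhsx_ballx.
  move=> [a' b'] [/= ha hb]; apply: le_lt_trans (cmod_le_ReIm _) _.
  rewrite [e]splitr /g Re_add Im_add Re_opp Im_opp /= ltrD//.
    by rewrite distrC.
  by rewrite distrC.
have cp : compact (`[- C, C]%classic `*` `[- C, C]%classic : set (R * R)).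
  by apply: compact_setX; exact: segment_compact.
have ci := continuous_compact (continuous_subspaceT cg) cp.
apply: (subclosed_compact cE ci) => -[a b] /EC h.
exists (a, b) => //; split; rewrite /= in_itv /= -ler_norml.
  exact: le_trans (le_Re_cmod (a +i* b)) h.
exact: le_trans (le_Im_cmod (a +i* b)) h.
Qed.

Context (B : {linear H -> H}) (B_bounded : bounded_op B).
Context (K : R[i] -> R[i] -> R[i]).
Hypothesis B_kernel : has_kernel mu S sigma G B K.

Let sigma_bounded : bounded_on sigma id.
Proof. by have [C C0 h] := S_bounded; exists C => // l /spectrum_sub /h. Qed.

Lemma kernel_bounded : exists2 C : R, 0 <= C &
  forall x y, sigma x -> sigma y -> cmod (K x y) <= C.
Proof.
have cs : compact sigma.
  by apply: compact_closed_bounded => //; exact: closed_spectrum.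
have [Kc _] := B_kernel.
have ci := continuous_compact Kc (compact_setX cs cs).
have cc : continuous (fun z : R[i] => cmod z).
  move=> z; apply: (proj2 (@cvgrPdistC_lt _ _ _ (nbhs z) _ _ _)) => e e0.
  have : nbhs z [set y | cmod (y - z) < e] by apply/nbhs_cmodP; exists e.
  apply: filterS => y /=; apply: le_lt_trans; rewrite ler_norml.
  have h1 := le_cmodD (y - z) z; have h2 := le_cmodD (z - y) y.
  rewrite subrK in h1; rewrite subrK cmodBC in h2.
  by apply/andP; split; lra.
have /compact_bounded[C [_ hC]] := continuous_compact (continuous_subspaceT cc) ci.
exists (`|C| + 1); first by rewrite addr_ge0.
move=> x y sx sy.
have C1 : C < `|C| + 1 by rewrite ltr_pwDr// ler_norm.
have /= h := hC _ C1 (cmod (K x y)).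
rewrite -(ger0_norm (cmod_ge0 (K x y))); apply: h.
by exists (K x y) => //; exists (x, y).
Qed.

Lemma kernel_continuous x y : sigma x -> sigma y -> forall e : R, 0 < e ->
  exists2 d : R, 0 < d & forall x' y', sigma x' -> sigma y' ->
    cmod (x' - x) < d -> cmod (y' - y) < d -> cmod (K x' y' - K x y) < e.
Proof.
move=> sx sy e e0; have [/subspace_continuousP Kc _] := B_kernel.
have /cvg_cmodP/(_ e e0) := Kc (x, y) (conj sx sy).
move=> [[P1 P2] /= [/nbhs_cmodP[d1 d10 h1] /nbhs_cmodP[d2 d20 h2]] h].
exists (Num.min d1 d2); first by rewrite lt_min d10.
move=> x' y' sx' sy'; rewrite !lt_min => /andP[a1 _] /andP[_ a2].
by apply: (h (x', y')) => //=; split; [exact: h1|exact: h2].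
Qed.

Lemma kernel_measurable y : sigma y -> cmeasurable mu sigma (fun x => K x y).
Proof.
move=> sy; apply: cmeasurable_within => //; apply/subspace_continuousP => x sx.
apply/cvg_cmodP => e e0; have [d d0 h] := kernel_continuous sx sy e0.
apply/nbhs_cmodP; exists d => // x' x'd sx'; apply: h => //.
by rewrite subrr cmod0.
Qed.

Lemma cintegral_co b D f :
  co b (cintegral mu D f) = (\int[m]_(x in (D : set T)) co b (f x))%R.
Proof. by case: b. Qed.

(** The bound [s <= (e + s^2 / e) / 2] for [s = |p|] does the work of the
    Cauchy-Schwarz inequality. *)
Lemma cintegral_close (F F' p : R[i] -> R[i]) X (C d e : R) :
  0 <= C -> 0 <= d -> 0 < e ->
  cmeasurable mu sigma F -> bounded_on sigma F ->
  cmeasurable mu sigma F' -> bounded_on sigma F' ->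
  cmeasurable mu S p -> (L2sqnorm mu S p <= (e ^+ 2)%:E)%E ->
  measurable (X : set T) ->
  (forall x, sigma x ->
     cmod (F x - F' x) <= C * cmod (p x) + d * (x \in X)%:R) ->
  cmod (cintegral mu sigma F - cintegral mu sigma F') <=
    2 * (C * e + d * fine (mu X)).
Proof.
move=> C0 d0 e0 mF bF mF' bF' mp pe mX FF'.
have mb b (f : R[i] -> R[i]) : cmeasurable mu sigma f ->
    measurable_fun (sigma : set T) (fun x : T => co b (f x)).
  by case: b => -[].
have intb b (f : R[i] -> R[i]) : cmeasurable mu sigma f -> bounded_on sigma f ->
    m.-integrable (sigma : set T) (EFin \o (fun x : T => co b (f x))).
  move=> mf [c c0 fc]; apply: measurable_bounded_integrable => //; last 2 first.
  - exact: mb.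
  - exists c; split; first exact: num_real.
    move=> c' cc' x sx /=; apply: le_trans (ltW cc').
    exact: le_trans (le_co_cmod b _) (fc _ sx).
  by rewrite (le_lt_trans (mu_le1 _))// ltry.
have pS : (L2sqnorm mu sigma p <= (e ^+ 2)%:E)%E.
  apply: le_trans pe; apply: ge0_subset_integral => //.
  - exact: measurable_cmod_sqr.
  - by move=> x _; rewrite lee_fin sqr_ge0.
  - exact: spectrum_sub.
have mp' : cmeasurable mu sigma p by apply: cmeasurableS mp => //; exact: spectrum_sub.
suff hb b : `|co b (cintegral mu sigma F - cintegral mu sigma F')| <=
    C * e + d * fine (mu X).
  by rewrite mulr2n mulrDl mul1r; exact: cmod_le_co.
rewrite coB !cintegral_co -RintegralB//; try exact: intb.
rewrite -lee_fin; apply: (@le_trans _ _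
    `|\int[m]_(x in (sigma : set T)) (co b (F x) - co b (F' x))%:E|%E).
  have : m.-integrable (sigma : set T) (EFin \o (fun x : T => co b (F x) - co b (F' x))).
    rewrite (_ : _ \o _ = (fun x : T => (co b (F x))%:E - (co b (F' x))%:E)%E)//.
    by apply: integrableB => //; exact: intb.
  move=> /integrable_fin_num => h; rewrite /Rintegral -fine_abse; last exact: h.
  by rewrite fineK// abse_fin_num; exact: h.
apply: le_trans (le_abse_integral _ _ _) _ => //.
  by apply/measurable_EFinP; apply: measurable_funB; exact: mb.
pose c1 := C * e / 2; pose c2 := C / (2 * e).
have c10 : 0 <= c1 by rewrite /c1 divr_ge0// mulr_ge0// ltW.
have c20 : 0 <= c2 by rewrite /c2 divr_ge0// mulr_ge0// ltW.
have mind : measurable_fun (sigma : set T) (fun x : T => (\1_(X : set T) x)%:E : \bar R).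
  by apply/measurable_EFinP; exact: measurable_indic.
apply: (@le_trans _ _ (\int[m]_(x in (sigma : set T))
    (c1%:E + (c2%:E * (cmod (p x) ^+ 2)%:E + d%:E * (\1_(X : set T) x)%:E)))%E).
  apply: ge0_le_integral => //.
  - apply: measurableT_comp => //; apply/measurable_EFinP.
    by apply: measurable_funB; exact: mb.
  - apply: emeasurable_funD => //; apply: emeasurable_funD.
      by apply: measurable_funeM; exact: measurable_cmod_sqr.
    by apply: measurable_funeM.
  move=> x sx; rewrite -!EFinM -!EFinD lee_fin -coB.
  apply: le_trans (le_co_cmod b _) _; apply: le_trans (FF' x sx) _.
  rewrite addrA indicE; apply: lerD => //.
  have -> : c1 + c2 * cmod (p x) ^+ 2 = C * ((e ^+ 2 + cmod (p x) ^+ 2) / (2 * e)).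
    by rewrite /c1 /c2; field; rewrite gt_eqF.
  rewrite ler_wpM2l// ler_pdivlMr ?mulr_gt0//.
  by have := sqr_ge0 (cmod (p x) - e); set s := cmod _; nra.
have ind0 (x : T) : (0 <= (\1_(X : set T) x)%:E :> \bar R)%E by rewrite lee_fin.
have sq0 (x : T) : (0 <= (cmod (p x) ^+ 2)%:E)%E by rewrite lee_fin sqr_ge0.
rewrite ge0_integralD//; last 2 first.
- by move=> x _; rewrite adde_ge0// mule_ge0// lee_fin.
- apply: emeasurable_funD; last exact: measurable_funeM.
  by apply: measurable_funeM; exact: measurable_cmod_sqr.
rewrite ge0_integralD//; last 4 first.
- by move=> x _; rewrite mule_ge0// lee_fin.
- by apply: measurable_funeM; exact: measurable_cmod_sqr.
- by move=> x _; rewrite mule_ge0// lee_fin.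
- exact: measurable_funeM.
rewrite ge0_integralZl_EFin//; last exact: measurable_cmod_sqr.
rewrite ge0_integralZl_EFin//.
rewrite integral_indic// integral_cst//.
rewrite [X in (_ + (_ + _ * X))%E](_ : _ = mu X); last exact: mu_sigma.
have -> : (C * e + d * fine (mu X))%:E = (c1%:E * 1 + (c2%:E * (e ^+ 2)%:E + d%:E * mu X))%E.
  rewrite -{2}(@fineK _ (mu X)); last first.
    by rewrite ge0_fin_numE// (le_lt_trans (mu_le1 _))// ltry.
  rewrite -!EFinM -!EFinD; congr _%:E; rewrite /c1 /c2.
  by field; rewrite gt_eqF.
apply: leeD; first by apply: lee_wpmul2l; rewrite ?lee_fin//; exact: mu_le1.
by apply: leeD => //; apply: lee_wpmul2l; rewrite ?lee_fin.
Qed.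

Lemma cintegral_indic (c : R[i]) X : measurable (X : set T) ->
  cintegral mu sigma (fun x => c * \1_X x) = c * (fine (mu X))%:C.
Proof.
move=> mX; have e b : co b (cintegral mu sigma (fun x => c * \1_X x)) =
    co b (c * (fine (mu X))%:C).
  rewrite cintegral_co.
  rewrite (_ : (fun x : T => co b (c * \1_X (x : R[i]))) =
      (fun x : T => co b c * \1_(X : set T) x)); last first.
    apply/funext => x; rewrite !indicE; case: (_ \in _); rewrite ?mulr1 ?mulr0//.
    by case: (b).
  rewrite RintegralZl//; last first.
    apply: measurable_bounded_integrable => //.
    - by rewrite (le_lt_trans (mu_le1 _))// ltry.
    - exists 1; split; first exact: num_real.
      by move=> c' c'1 x _ /=; rewrite indicE; case: (_ \in _); rewrite ?normr1 ?normr0 ltW// (lt_trans _ c'1).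
  rewrite /Rintegral integral_indic// [X in fine X](_ : _ = mu X); last exact: mu_sigma.
  by case: (b) => /=; rewrite ?Re_mul ?Im_mul /= mulr0 ?subr0 ?add0r.
by apply/eqP; rewrite eq_complex; apply/andP; split; apply/eqP;
  [exact: (e true)|exact: (e false)].
Qed.

(** For a polynomial vector close to [G 1_X], the kernel formula says that [B]
    sends it to a function that is on [Y] uniformly close to
    [k * mu X].  The part of that function outside [Y] is orthogonal to
    [G 1_Y]. *)
Lemma kernel_average (X Y : set R[i]) (k : R[i]) (d : R) :
  measurable (X : set T) -> measurable (Y : set T) -> 0 <= d ->
  (forall x y, X x -> sigma x -> Y y -> sigma y -> cmod (K x y - k) <= d) ->
  cmod (hdot (G (\1_Y : R[i] -> R[i])) (B (G (\1_X : R[i] -> R[i]))) -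
        k * (fine (mu X) * fine (mu Y))%:C) <= 2 * d * fine (mu X) * fine (mu Y).
Proof.
move=> mX mY d0 Kd; set a := G (\1_X : R[i] -> R[i]); set b := G (\1_Y : R[i] -> R[i]).
have X2 := in_L2_indic mu_le1 mS mX; have Y2 := in_L2_indic mu_le1 mS mY.
have [kB kB0 hB] := bounded_op_cmod B_bounded; have [C C0 KC] := kernel_bounded.
set x0 := fine (mu X); set y0 := fine (mu Y).
have x00 : 0 <= x0 by exact: fine_ge0.
have y00 : 0 <= y0 by exact: fine_ge0.
have by0 : cmod b ^+ 2 = y0 by rewrite /y0 G_indic_sqnorm.
have bb : hdot b b = y0%:C by rewrite hdotxx by0.
apply/ler_addgt0Pr => e e0.
(* [Z] collects the constants in front of [n] in the two error terms. *)
pose Z := cmod b * kB + 2 * C * y0 + 1.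
have Z0 : 0 < Z by rewrite ltr_wpDl// addr_ge0 ?mulr_ge0 ?cmod_ge0.
pose n := e / Z; have n0 : 0 < n by rewrite divr_gt0.
have [P hP] := poly_approx a n0.
have eP : op_eval P A As phi = G (f_poly P) by rewrite (L2_iso_poly G_iso).
have [_ /(_ P)[g [g2 Gg gK]]] := B_kernel.
pose dl := 2 * (C * n + d * x0).
have dl0 : 0 <= dl by rewrite mulr_ge0// addr_ge0// mulr_ge0// ltW.
have P2 := in_L2_f_poly P.
have pn : (L2sqnorm mu S (fun l => (f_poly P l - \1_X l)%R) <= (n ^+ 2)%:E)%E.
  rewrite (L2_iso_isometric G_iso (in_L2B mS P2 X2)) -(G_sub P2 X2) -eP lee_fin.
  by rewrite ler_pXn2r ?nnegrE ?cmod_ge0 ?ltW.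
have near_k y : Y y -> sigma y ->
    cmod (cintegral mu sigma (fun x => K x y * f_poly P x) - k * x0%:C) <= dl.
  move=> Yy sy; rewrite -cintegral_indic//.
  have [[CP CP0 hCP] _] := f_poly_bounded_lipschitz P sigma_bounded.
  have mK : cmeasurable mu sigma (fun x => K x y * f_poly P x).
    by apply: cmeasurableM; [exact: kernel_measurable|exact: cmeasurable_f_poly].
  have bK : bounded_on sigma (fun x => K x y * f_poly P x).
    exists (C * CP); first exact: mulr_ge0.
    by move=> x sx; rewrite cmodM ler_pM ?cmod_ge0 ?KC ?hCP.
  have mk : cmeasurable mu sigma (fun x => k * \1_X x).
    by apply: cmeasurableM; [exact: cmeasurable_cst|exact: cmeasurable_indic].
  have bk : bounded_on sigma (fun x => k * \1_X x).
    exists (cmod k); rewrite ?cmod_ge0// => x _; rewrite cmodM ler_piMr ?cmod_ge0//.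
    by rewrite indicE; case: (_ \in _); rewrite ?cmod1 ?cmod0.
  apply: (cintegral_close C0 d0 n0 mK bK mk bk (in_L2B mS P2 X2).1 pn mX).
  move=> x sx.
  have -> : K x y * f_poly P x - k * \1_X x =
      K x y * (f_poly P x - \1_X x) + (K x y - k) * \1_X x by ring.
  apply: le_trans (le_cmodD _ _) _; rewrite !cmodM; apply: lerD.
    by rewrite ler_wpM2r ?cmod_ge0// KC.
  rewrite indicE; have [xX|_] := boolP (x \in X); last by rewrite cmod0 !mulr0.
  by rewrite cmod1 !mulr1 Kd// -inE.
have bg : cmod (hdot b (G g) - k * (x0 * y0)%:C) <= dl * y0.
  pose g1 l := \1_Y l * (g l - k * x0%:C); pose g2' l := \1_(~` Y) l * g l.
  have mYc : measurable (~` Y : set T) by exact: measurableC.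
  have ind_bounded (E : set R[i]) : bounded_on S (\1_E : R[i] -> R[i]).
    by exists 1 => // l _; rewrite indicE; case: (_ \in _); rewrite ?cmod1 ?cmod0.
  have bc : bounded_on S (fun=> k * x0%:C).
    by exists (cmod (k * x0%:C)); rewrite ?cmod_ge0.
  have c2 := in_L2_bounded mu_le1 mS (cmeasurable_cst mu S (k * x0%:C)) bc.
  have g12 : in_L2 mu S g1.
    exact: (in_L2_mul mS (cmeasurable_indic S mY) (ind_bounded Y) (in_L2B mS g2 c2)).
  have g22 : in_L2 mu S g2'.
    exact: (in_L2_mul mS (cmeasurable_indic S mYc) (ind_bounded (~` Y)) g2).
  have Gsplit : G g = (k * x0%:C) *: b + G g1 + G g2'.
    rewrite -(L2_iso_linear G_iso (k * x0%:C) Y2 g12) -[X in X + _]scale1r.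
    rewrite -(L2_iso_linear G_iso 1 (in_L2_comb mS _ Y2 g12) g22).
    congr G; apply/funext => l; rewrite /g1 /g2' !indicE in_setC.
    by case: (_ \in _) => /=; ring.
  have o2 : hdot b (G g2') = 0.
    apply: (G_disjoint_orth Y2 g22) => l; rewrite /g2' !indicE in_setC.
    by case: (_ \in _) => /=; [right; rewrite mul0r|left].
  have n1 : cmod (G g1) <= dl * cmod b.
    apply: (ae_le_G dl0 g12 Y2).
    have sC : {ae m, forall y : T, sigma y}.
      by exists (~` sigma); split; [exact: measurableC|exact: mu_spectrumC|].
    apply: filterS2 gK sC => y hy sy _; rewrite /g1 indicE cmodM mulrC.
    have [yY|_] := boolP (y \in Y); last by rewrite cmod0 !mulr0.
    by rewrite cmod1 !mulr1 hy//; apply: near_k => //; rewrite inE in yY.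
  rewrite Gsplit !hdotDr o2 addr0 hdotZr bb.
  have -> : k * x0%:C * y0%:C + hdot b (G g1) - k * (x0 * y0)%:C = hdot b (G g1).
    by rewrite rmorphM /=; ring.
  apply: le_trans (cauchy_schwarz _ _) _.
  rewrite -by0 expr2 mulrCA; apply: ler_wpM2l n1; exact: cmod_ge0.
have split_b : hdot b (B a) - k * (x0 * y0)%:C =
    hdot b (B (a - G (f_poly P))) + (hdot b (G g) - k * (x0 * y0)%:C).
  by rewrite linB hdotBr Gg; ring.
rewrite split_b; apply: le_trans (le_cmodD _ _) _.
have h1 : cmod (hdot b (B (a - G (f_poly P)))) <= cmod b * kB * n.
  apply: le_trans (cauchy_schwarz _ _) _; rewrite -mulrA.
  apply: ler_wpM2l; first exact: cmod_ge0.
  apply: le_trans (hB _) _; apply: ler_wpM2l => //.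
  by rewrite cmodBC -eP ltW.
apply: le_trans (lerD h1 bg) _.
have nZ : n * Z = e by rewrite /n divfK// gt_eqF.
rewrite /dl -nZ /Z; have := ltW n0; set t := cmod b * kB.
have : 0 <= t by rewrite /t mulr_ge0// cmod_ge0.
nra.
Qed.

End functional_model.
(** * Weak convergence along grids *)

Lemma le_integral_step d (T : measurableType d) (R : realType)
    (m : {measure set T -> \bar R}) (S : set T) (I : finType) (X : I -> set T)
    (c : I -> R) (F : T -> R) (w : R) :
  measurable S -> (m S <= 1)%E -> (forall i, measurable (X i)) ->
  (forall i, 0 <= c i) -> 0 <= w -> (forall x, 0 <= F x) ->
  measurable_fun S (EFin \o F) ->
  (forall x, S x -> \sum_i c i * \1_(X i) x <= F x + w) ->
  (\sum_i (c i)%:E * m (X i `&` S) <= \int[m]_(x in S) (F x)%:E + w%:E)%E.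
Proof.
move=> mS mS1 mX c0 w0 F0 mF cF.
have mI i : measurable_fun S (fun x => (c i)%:E * (\1_(X i) x)%:E)%E.
  by apply: measurable_funeM; apply/measurable_EFinP; exact: measurable_indic.
have I0 i x : (0 <= (c i)%:E * (\1_(X i) x)%:E)%E by rewrite mule_ge0// lee_fin.
have -> : (\sum_i (c i)%:E * m (X i `&` S) =
    \int[m]_(x in S) \sum_i (c i)%:E * (\1_(X i) x)%:E)%E.
  rewrite ge0_integral_sum//; apply: eq_bigr => i _.
  rewrite ge0_integralZl_EFin//; first by rewrite integral_indic.
  by apply/measurable_EFinP; exact: measurable_indic.
apply: (@le_trans _ _ (\int[m]_(x in S) ((F x)%:E + w%:E))%E).
  apply: ge0_le_integral => //.
  - by move=> x _; apply: sume_ge0 => i _; exact: I0.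
  - by apply: emeasurable_sum => i; exact: mI.
  - exact: emeasurable_funD.
  move=> x Sx; under eq_bigr => i _ do rewrite -EFinM.
  by rewrite sumEFin -EFinD lee_fin cF.
rewrite ge0_integralD//; last by move=> x _; rewrite lee_fin.
rewrite integral_cst//; apply: leeD => //.
by rewrite -[leRHS]mule1; apply: lee_wpmul2l; rewrite ?lee_fin.
Qed.

Section weak_convergence.
Context (R : realType) (U : div_ultrafilter).
Context (D : nat -> nat) (lam : forall N, 'I_(D N) -> R[i]).
Context (xi : forall N, 'I_(D N) -> R).
Hypothesis xi_unit : forall N, \sum_(n < D N) xi n ^+ 2 = 1.
Context (M : nat) (NI : nice_set U lam xi M).
Local Notation muN := (muN lam xi).
Local Notation mun := (mun U lam xi).
Local Notation nu := (mu_star NI).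
Local Notation T := (caratheodory_type nu).
Local Notation m := (cara_measure nu).
Local Notation Mr := (M%:R : R).
Hypothesis nu_total : nu [set: R[i]] = 1%E.
Hypothesis lam_Sq : forall N n, Sq M (lam (N := N) n).

Section partition.
Context (I : finType) (X : I -> set R[i]).
Hypothesis X_le : forall i, (nu (X i) <= (mun (X i))%:E)%E.
Hypothesis X_disj : forall i j l, X i l -> X j l -> i = j.
Hypothesis X_full : nu (~` [set l | exists i, X i l]) = 0%E.

Lemma outer_measure_finite_cover (s : seq I) :
  (nu [set l | exists2 i, i \in s & X i l] <= \sum_(i <- s) nu (X i))%E.
Proof.
elim: s => [|i s IH].
  rewrite big_nil (_ : mkset _ = set0) ?mu_star0//.
  by apply/seteqP; split => // l [].
rewrite big_cons; apply: le_trans (leeD (lexx _) IH).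
apply: le_trans (nu_U2 _ _ _); apply: le_mu_star => l [j].
by rewrite inE => /orP[/eqP->|js] Xl; [left|right; exists j].
Qed.

Lemma nu_partition_sum_ge1 : (1 <= \sum_i nu (X i))%E.
Proof.
rewrite -nu_total.
apply: (@le_trans _ _ (nu ([set l | exists2 i, i \in index_enum I & X i l] `|`
    ~` [set l | exists i, X i l]))%E).
  apply: le_mu_star => l _.
  have [[i Xi]|h] := pselect (exists i, X i l); last by right.
  by left; exists i => //; rewrite mem_index_enum.
apply: le_trans (nu_U2 _ _ _) _; rewrite X_full adde0.
exact: outer_measure_finite_cover.
Qed.

Lemma mun_partition_sum : \sum_i mun (X i) = 1.
Proof.
apply/eqP; rewrite eq_le; apply/andP; split.
  apply: (@le_trans _ _ (mun [set: R[i]])); last exact: mun_le1.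
  by apply: mun_disjoint.
rewrite -lee_fin -sumEFin; apply: le_trans nu_partition_sum_ge1 _.
by apply: lee_sum => i _; exact: X_le.
Qed.

(** The two families of numbers are termwise ordered and have the same sum. *)
Lemma nu_partition i : nu (X i) = (mun (X i))%:E.
Proof.
have fin j : nu (X j) \is a fin_num by exact: nu_fin.
have h : 1 <= \sum_j fine (nu (X j)).
  rewrite -lee_fin -sumEFin; under eq_bigr => j _ do rewrite fineK//.
  exact: nu_partition_sum_ge1.
have le j : fine (nu (X j)) <= mun (X j) by rewrite -lee_fin fineK.
apply/eqP; rewrite eq_le X_le /= -(fineK (fin i)) lee_fin leNgt; apply/negP => lt.
suff : \sum_j fine (nu (X j)) < \sum_j mun (X j) by rewrite mun_partition_sum ltNge h.
rewrite (bigD1 i)//= [ltRHS](bigD1 i)//=; apply: ltr_leD => //.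
by apply: ler_sum => j _; exact: le.
Qed.

Hypothesis X_meas : forall i, measurable (X i : set T).

(** Riemann sums: on each set of the partition [F] is constant up to [w], the
    sets have the same mass for both measures, and nothing is left outside. *)
Lemma limsup_integral (F : R[i] -> R) (C w : R) :
  (forall l, Sq M l -> F l <= C) -> (forall l, 0 <= F l) ->
  (forall i l l', Sq M l -> Sq M l' -> X i l -> X i l' -> F l <= F l' + w) ->
  0 <= w -> measurable (Sq M : set T) ->
  measurable_fun (Sq M : set T) (fun x : T => (F x)%:E) ->
  forall d : R, 0 < d ->
  \forall N \near ufilter U,
    ((\sum_(n < D N) F (lam n) * xi n ^+ 2 - d)%:E <=
      \int[m]_(x in (Sq M : set T)) (F x)%:E + (2 * w)%:E)%E.
Proof.
move=> FC F0 Fw w0 mS mF d d0.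
have pt i : {c : R | 0 <= c /\ (forall l, Sq M l -> X i l -> c <= F l + w /\ F l <= c + w)}.
  have [h|h] := pselect (exists l, Sq M l /\ X i l).
    have [l [Sl Xl]] := cid h; exists (F l); split => // l' Sl' Xl'.
    by split; exact: (Fw i).
  by exists 0; split => // l Sl Xl; exfalso; apply: h; exists l.
pose c i := sval (pt i).
have c0 i : 0 <= c i by have [] := svalP (pt i).
have cP i l : Sq M l -> X i l -> c i <= F l + w /\ F l <= c i + w.
  by have [_] := svalP (pt i); exact.
have int_ge : ((\sum_i c i * mun (X i))%:E <=
    \int[m]_(x in (Sq M : set T)) (F x)%:E + w%:E)%E.
  rewrite -sumEFin; under eq_bigr => i _.
    have e : nu (X i `&` Sq M) = (mun (X i))%:E.
      rewrite -nu_partition; apply/eqP; rewrite eq_le le_mu_star ?subIsetl//=.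
      have : (nu (X i) <= nu ((X i `&` Sq M) `|` ~` Sq M))%E.
        by apply: le_mu_star => l Xl; have [?|?] := pselect (Sq M l); [left|right].
      move/le_trans; apply; apply: le_trans (nu_U2 _ _ _) _.
      by rewrite (@nu_out _ _ _ _ _ _ NI (~` Sq M)) ?adde0// => l [Sl /interior_subset].
    rewrite EFinM -e; over.
  have cF x : Sq M x -> \sum_i c i * \1_(X i) x <= F x + w.
    move=> Sx.
    have [[i Xi]|h] := pselect (exists i, X i x); last first.
      rewrite big1 ?addr_ge0// => i _; rewrite indicE memNset ?mulr0//.
      by move=> Xi; apply: h; exists i.
    rewrite (bigD1 i)//= big1 => [|j ji].
      by rewrite indicE mem_set// mulr1 addr0; have [] := cP i x Sx Xi.
    rewrite indicE memNset ?mulr0// => Xj.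
    by rewrite (X_disj Xi Xj) eqxx in ji.
  exact: (@le_integral_step _ T R m (Sq M) I X c F w mS (nu_le1 xi_unit NI _)
    X_meas c0 w0 F0 mF cF).
(* The mass that the partition misses is [1 - \sum_i muN N (X i)]; it tends to
   zero. *)
pose g N := \sum_i (c i + w) * muN N (X i) + C * (1 - \sum_i muN N (X i)).
have cg : g @ ufilter U --> \sum_i (c i + w) * mun (X i) + C * (1 - \sum_i mun (X i)).
  apply: cvgD.
    apply: cvg_big => [|i _]; first exact: add_continuous.
    by apply: cvgMr; exact: cvg_mun.
  apply: cvgMr; apply: cvgB; first exact: cvg_cst.
  exact: cvg_sum_mun.
rewrite mun_partition_sum subrr mulr0 addr0 in cg.
have fg N : \sum_(n < D N) F (lam n) * xi n ^+ 2 <= g N.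
  rewrite /g -(xi_unit N).
  pose p i (n : 'I_(D N)) := if `[< X i (lam n) >] then xi n ^+ 2 else 0.
  have mE i : muN N (X i) = \sum_(n < D N) p i n by rewrite /Defs.muN big_mkcond.
  have e1 : \sum_i (c i + w) * muN N (X i) = \sum_(n < D N) \sum_i (c i + w) * p i n.
    by rewrite exchange_big; apply: eq_bigr => i _; rewrite mE mulr_sumr.
  have e2 : \sum_i muN N (X i) = \sum_(n < D N) \sum_i p i n.
    by rewrite exchange_big; apply: eq_bigr => i _; rewrite mE.
  rewrite e1 e2 -sumrB mulr_sumr -big_split /= /p.
  apply: ler_sum => n _.
  have [[i Xi]|h] := pselect (exists i, X i (lam n)).
    rewrite (bigD1 i)//= big1 => [|j ji]; last first.
      by case: asboolP => [Xj|_]; [rewrite (X_disj Xi Xj) eqxx in ji|rewrite mulr0].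
    rewrite (bigD1 i)//= big1 => [|j ji]; last first.
      by case: asboolP => // Xj; rewrite (X_disj Xi Xj) eqxx in ji.
    rewrite asboolT// !addr0 subrr mulr0 addr0 ler_wpM2r ?sqr_ge0//.
    by have [] := cP i _ (lam_Sq n) Xi.
  rewrite big1 => [|i _]; last first.
    by case: asboolP => [Xi|_]; [exfalso; apply: h; exists i|rewrite mulr0].
  rewrite big1 => [|i _]; last by case: asboolP => // Xi; exfalso; apply: h; exists i.
  by rewrite add0r subr0 ler_wpM2r ?sqr_ge0// FC.
have lim_le : ((\sum_i (c i + w) * mun (X i))%:E <=
    \int[m]_(x in (Sq M : set T)) (F x)%:E + (2 * w)%:E)%E.
  have -> : \sum_i (c i + w) * mun (X i) = \sum_i c i * mun (X i) + w.
    under eq_bigr do rewrite mulrDl.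
    by rewrite big_split /= -mulr_sumr mun_partition_sum mulr1.
  by rewrite EFinD mulr2n mulrDl mul1r EFinD addeA leeD2r.
have lt : \sum_i (c i + w) * mun (X i) < \sum_i (c i + w) * mun (X i) + d.
  by rewrite ltrDl.
have /cvgr_lt/(_ _ lt) := cg; apply: filterS => N gN.
apply: le_trans lim_le; rewrite lee_fin lerBlDr.
exact: le_trans (fg N) (ltW gN).
Qed.

End partition.

Context (alpha beta : R[i]) (r : nat -> nat -> R).
Hypothesis r_grid : grid U lam xi M alpha beta r.

Local Notation sz p := (2 ^ p.+2)%N.

Lemma grid_inside p i : (i <= sz p)%N -> - Mr <= r p i <= Mr.
Proof. by move=> h; apply: (grid_in r_grid); rewrite /idx ltnS. Qed.

Lemma grid_lt p i j : (i < j)%N -> (j <= sz p)%N -> r p i < r p j.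
Proof.
elim: j => // j IH; rewrite ltnS leq_eqVlt => /orP[/eqP->|ij] jn.
  by apply: (grid_incr r_grid); rewrite /idx ltnS.
apply: lt_trans (IH ij (ltnW jn)) _.
by apply: (grid_incr r_grid); rewrite /idx ltnS.
Qed.

Lemma grid_le p i j : (i <= j)%N -> (j <= sz p)%N -> r p i <= r p j.
Proof.
rewrite leq_eqVlt => /orP[/eqP->//|ij] jn; exact: ltW (grid_lt ij jn).
Qed.

Lemma grid_refine_le p p' i : (p <= p')%N -> (i <= sz p)%N ->
  exists2 j, (j <= sz p')%N & r p i = r p' j.
Proof.
move=> pp' ip; elim: p' pp' => [|p' IH].
  by rewrite leqn0 => /eqP p0; rewrite p0 in ip *; exists i.
rewrite leq_eqVlt => /orP[/eqP pe|]; first by rewrite pe in ip *; exists i.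
rewrite ltnS => /IH[j jp ->].
by have [|k kp ->] := @grid_refine _ _ _ _ _ _ _ _ _ r_grid p' j; [rewrite /idx ltnS|exists k].
Qed.

Lemma grid_ends p : r p 0 = - Mr /\ r p (sz p) = Mr.
Proof.
have [j jp e0] := @grid_refine_le 0 p 0 isT isT.
have [k kp e4] := @grid_refine_le 0 p 4 isT isT.
rewrite (grid_left r_grid) in e0; rewrite (grid_right r_grid) in e4.
split; apply/eqP; rewrite eq_le.
  by rewrite {1}e0 grid_le//=; have /andP[] := @grid_inside p 0 isT.
by rewrite {2}e4 grid_le// andbT; have /andP[_] := @grid_inside p (sz p) (leqnn _).
Qed.

Lemma grid_nice_line b p i : (i <= sz p)%N -> nice_line U lam xi M b (r p i).
Proof.
move=> ip d d0; have [e e0 he] := grid_nice r_grid p d0.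
exists e => //; apply: le_lt_trans he; apply: le_mun => // l [Sl lc].
exists i; first by rewrite /= /idx ltnS.
by case: b lc => lc; [left|right].
Qed.

Definition cell p (ij : 'I_(sz p) * 'I_(sz p)) : set R[i] :=
  box (fun b => r p (if b then ij.1 else ij.2))
      (fun b => r p (if b then ij.1 else ij.2).+1).

Lemma grid_cellE p (i j : 'I_(sz p)) : grid_cell M r p i j = cell (i, j).
Proof.
apply/seteqP; split => [l [_ h1 h2] []//|l h].
split; [|exact: (h true)|exact: (h false)]; apply/SqE => b.
have /andP[h1 h2] := h b.
have /andP[h3 _] := @grid_inside p (if b then i else j) (ltac:(by case: b {h h1 h2}; exact: ltnW)).
have /andP[_ h4] := @grid_inside p (if b then i else j).+1 (ltac:(by case: b {h h1 h2 h3})).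
by rewrite (le_trans h3 (ltW h1)) (le_trans (ltW h2) h4).
Qed.

Lemma cell_index_uniq p (i j : nat) (x : R) : (i < sz p)%N -> (j < sz p)%N ->
  r p i < x < r p i.+1 -> r p j < x < r p j.+1 -> i = j.
Proof.
move=> ip jp /andP[h1 h2] /andP[h3 h4].
apply/eqP; rewrite eqn_leq; apply/andP; split; rewrite leqNgt; apply/negP => lt.
  have := grid_le lt (ltnW ip); rewrite leNgt => /negP; apply.
  exact: lt_trans h1 h4.
have := grid_le lt (ltnW jp); rewrite leNgt => /negP; apply.
exact: lt_trans h3 h2.
Qed.

Lemma cell_disj p (s t : 'I_(sz p) * 'I_(sz p)) l : cell s l -> cell t l -> s = t.
Proof.
case: s t => [i j] [i' j'] hs ht; congr pair; apply: val_inj => /=.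
  exact: cell_index_uniq (hs true) (ht true).
exact: cell_index_uniq (hs false) (ht false).
Qed.

Lemma cell_index_ex p (x : R) : - Mr < x < Mr -> (forall i, (i <= sz p)%N -> r p i <> x) ->
  exists2 i, (i < sz p)%N & r p i < x < r p i.+1.
Proof.
have [e0 en] := grid_ends p; rewrite -e0 -{1}en => /andP[h0 hn] off.
suff H k : (k <= sz p)%N -> x < r p k -> exists2 i, (i < k)%N & r p i < x < r p i.+1.
  by have [i ik hi] := H _ (leqnn _) hn; exists i.
elim: k => [_ /(lt_trans h0)|k IH kp xk]; first by rewrite ltxx.
have [lt|ge] := ltP x (r p k).
  by have [i ik hi] := IH (ltnW kp) lt; exists i => //; exact: ltnW.
exists k => //; rewrite xk andbT lt_neqAle ge andbT; apply/eqP; apply: off.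
exact: ltnW.
Qed.

Lemma cell_ex p l : (forall b, - Mr < co b l < Mr) ->
  (forall b i, (i <= sz p)%N -> r p i <> co b l) -> exists s, cell (p := p) s l.
Proof.
move=> lI off.
have [i ip hi] := cell_index_ex (lI true) (off true).
have [j jp hj] := cell_index_ex (lI false) (off false).
by exists (Ordinal ip, Ordinal jp) => -[].
Qed.

Lemma nu_cells_full p : nu (~` [set l | exists s, cell (p := p) s l]) = 0%E.
Proof.
pose F (i : nat) : set R[i] := if (i <= sz p)%N then
   [set l | co true l = r p i] `|` [set l | co false l = r p i] else set0.
pose F' (i : nat) : set R[i] := if i is j.+1 then F j else ~` interior (Sq M).
apply/eqP; rewrite eq_le mu_star_ge0 andbT.
apply: (@le_trans _ _ (nu (\bigcup_i F' i))).
  apply: le_mu_star => l /= nl; apply: contrapT => nF; apply: nl.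
  have lI : interior (Sq M) l.
    by apply: contrapT => nI; apply: nF; exists 0%N.
  rewrite interior_Sq in lI; apply: cell_ex => // b i ip e.
  apply: nF; exists i.+1 => //=; rewrite /F ip.
  by case: b e => e; [left|right].
apply: le_trans (@mu_star_sigma_subadditive _ _ _ _ _ _ NI F') _.
rewrite eseries0// => i _ _; case: i => [|i] /=.
  by apply: nu_out => l [].
rewrite /F; case: ifP => [ip|_]; last exact: mu_star0.
apply/eqP; rewrite eq_le mu_star_ge0 andbT.
apply: le_trans (nu_U2 _ _ _) _.
by rewrite !nu_line ?adde0//; exact: grid_nice_line.
Qed.

Lemma cell_le p s : (nu (cell (p := p) s) <= (mun (cell s))%:E)%E.
Proof.
apply: nu_box => // b.
- by apply: grid_inside; case: b; exact: ltnW.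
- by apply: grid_inside; case: b.
- by apply: grid_nice_line; case: b; exact: ltnW.
- by apply: grid_nice_line; case: b.
Qed.

Lemma nu_cell p s : nu (cell (p := p) s) = (mun (cell s))%:E.
Proof.
exact: (nu_partition (@cell_le p) (@cell_disj p) (nu_cells_full p)).
Qed.

Lemma cell_diam p s l l' : cell (p := p) s l -> cell s l' ->
  cmod (l - l') <= 4 * Mr / p.+1%:R.
Proof.
move=> hl hl'.
have -> : 4 * Mr / p.+1%:R = 2 * Mr / p.+1%:R + 2 * Mr / p.+1%:R.
  by rewrite -mulrDl -mulrDl -natrD.
apply: cmod_le_co => b; rewrite coB.
have /andP[/= h1 /= h2] := hl b; have /andP[/= h3 /= h4] := hl' b.
set i := (if b then s.1 else s.2) : nat in h1 h2 h3 h4.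
have ip : (i < sz p)%N by rewrite /i; case: (b).
have := grid_mesh r_grid (n := p) (i := i); rewrite /idx ltnS => /(_ ip) hm.
move: hm; set t := 2 * _ / _ => hm.
by rewrite ler_norml; apply/andP; split; lra.
Qed.

(** No line of the coarser grid passes through a cell of the finer one. *)
Lemma cell_nested p p' s t l l' : (p <= p')%N ->
  cell (p := p') t l -> cell t l' -> cell (p := p) s l -> cell s l'.
Proof.
move=> pp' tl tl' sl b.
have /andP[/= h1 /= h2] := sl b; have /andP[/= h3 /= h4] := tl b; have /andP[/= h5 /= h6] := tl' b.
set i := (if b then s.1 else s.2) : nat in h1 h2 *.
set k := (if b then t.1 else t.2) : nat in h3 h4 h5 h6.
have ip : (i < sz p)%N by rewrite /i; case: (b).
have kp : (k < sz p')%N by rewrite /k; case: (b).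
have [j jp ej] := grid_refine_le pp' (ltnW ip).
have [j' jp' ej'] := grid_refine_le pp' ip.
apply/andP; split.
  apply: le_lt_trans h5; rewrite ej; apply: grid_le (ltnW kp).
  rewrite leqNgt; apply/negP => kj; have := grid_le kj jp; rewrite leNgt -ej.
  by rewrite (lt_trans h1 h4).
apply: (lt_le_trans h6); rewrite ej'; apply: grid_le jp'.
rewrite ltnNge; apply/negP => jk; have := grid_le jk (ltnW kp); rewrite leNgt -ej'.
by rewrite (lt_trans h3 h2).
Qed.

Lemma cell_of_cell p c : Sq M c -> c = alpha \/ c = beta ->
  exists2 s, cell_of M r p c = cell (p := p) s & cell s c.
Proof.
move=> Sc cab.
have off b i q : (i <= sz q)%N -> r q i <> co b c.
  move=> iq e; have [] := @grid_off _ _ _ _ _ _ _ _ _ r_grid q i _ c cab.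
    by rewrite /idx ltnS.
  by case: b e => e h1 h2; [apply: h1|apply: h2].
have cI b : - Mr < co b c < Mr.
  have [e0 en] := grid_ends p; have /SqE/(_ b)/andP[h1 h2] := Sc.
  rewrite !lt_neqAle h1 h2 !andbT; apply/andP; split; apply/eqP.
    by rewrite -e0; exact: off.
  by rewrite -en => /esym; exact: off.
have [s sc] := cell_ex cI (fun b i => @off b i p).
rewrite /cell_of; case: xgetP => [X _ [i [j [ip jp -> Xc]]]|h].
  exists (Ordinal ip, Ordinal jp); last by rewrite -grid_cellE.
  by rewrite -grid_cellE.
exfalso; apply: (h (cell s)); exists s.1, s.2; split => //.
by rewrite grid_cellE; case: s {sc}.
Qed.

End weak_convergence.
(** * The ultraproduct *)

Section ultraproduct.
Context (R : realType) (H : hilbertType R) (U : div_ultrafilter).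
Context (A As : {linear H -> H}) (phi : H).
Local Notation HN := (HN A As phi).
Local Notation um_seq := (um_seq U A As phi).
Local Notation hm_class := (hm_class U A As phi).

Lemma um_seqP (v : nat -> H) :
  (\forall N \near ufilter U, HN N (v N)) ->
  (exists k : R, \forall N \near ufilter U, cmod (v N) <= k) -> v \in um_seq.
Proof.
move=> hv [k hk]; rewrite unfold_in; apply/asboolP; split => //.
have [n kn] : exists n : nat, k <= n%:R.
  exists (Num.truncn `|k|).+1; apply: le_trans (ler_norm _) _.
  exact: ltW (truncnS_gt _).
exists n; apply: filterS hk => N /le_trans/(_ kn).
by rewrite norm_cmod -[n%:R in X in _ -> X](rmorph_nat (real_complex R)) lecR.
Qed.

Lemma um_seq_HN v : v \in um_seq -> \forall N \near ufilter U, HN N (v N).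
Proof. by rewrite unfold_in => /asboolP[]. Qed.

Lemma um_seq_bounded v : v \in um_seq ->
  exists2 k : R, 0 <= k & \forall N \near ufilter U, cmod (v N) <= k.
Proof.
rewrite unfold_in => /asboolP[_ [k hk]]; exists k%:R => //.
apply: filterS hk => N.
by rewrite norm_cmod -[k%:R in X in X -> _](rmorph_nat (real_complex R)) lecR.
Qed.

Lemma hm_rep_um c : @hm_rep R H U A As phi c \in um_seq.
Proof. exact: valP (repr c). Qed.

Lemma hm_rep_class v : v \in um_seq -> forall e : R, 0 < e ->
  \forall N \near ufilter U, cmod (hm_rep (hm_class v) N - v N) < e.
Proof.
move=> uv e e0.
have : um_sim (repr (hm_class v)) (insubd (exist _ (fun=> 0) (um_seq0 U A As phi)) v).
  by apply/eqmodP; rewrite reprK.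
move=> /asboolP/(_ e e0); apply: filterS => N.
by rewrite insubdK// norm_cmod ltcR.
Qed.

Lemma cvg_hdot_close (v v' z z' : nat -> H) (k : R) (l : R[i]) : 0 <= k ->
  (\forall N \near ufilter U, cmod (v N) <= k) ->
  (\forall N \near ufilter U, cmod (z' N) <= k) ->
  (forall e : R, 0 < e -> \forall N \near ufilter U, cmod (v' N - v N) < e) ->
  (forall e : R, 0 < e -> \forall N \near ufilter U, cmod (z' N - z N) < e) ->
  (fun N => hdot (v N) (z N)) @ ufilter U --> l ->
  (fun N => hdot (v' N) (z' N)) @ ufilter U --> l.
Proof.
move=> k0 vk z'k v'v z'z /cvg_cmodP vz; apply/cvg_cmodP => e e0.
have e2 : 0 < e / 2 by rewrite divr_gt0.
have d0 : 0 < e / 2 / (2 * k + 1) by rewrite divr_gt0// ltr_wpDl// mulr_ge0.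
apply: filterS2 (filterI vk z'k) (filterI (filterI (v'v _ d0) (z'z _ d0)) (vz _ e2)).
move=> N [h1 h2] [[h3 h4] h5].
have -> : hdot (v' N) (z' N) - l = hdot (v' N - v N) (z' N) +
    hdot (v N) (z' N - z N) + (hdot (v N) (z N) - l).
  by rewrite hdotBl hdotBr; ring.
rewrite [e]splitr; apply: le_lt_trans (le_cmodD _ _) _; apply: ler_ltD h5.
apply: le_trans (le_cmodD _ _) _.
have g1 : cmod (hdot (v' N - v N) (z' N)) <= e / 2 / (2 * k + 1) * k.
  apply: le_trans (cauchy_schwarz _ _) _.
  by apply: ler_pM; rewrite ?cmod_ge0// ltW.
have g2 : cmod (hdot (v N) (z' N - z N)) <= k * (e / 2 / (2 * k + 1)).
  apply: le_trans (cauchy_schwarz _ _) _.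
  by apply: ler_pM; rewrite ?cmod_ge0// ltW.
apply: le_trans (lerD g1 g2) _; rewrite [k * _]mulrC -mulrDr.
rewrite mulrAC ler_pdivrMr; last by rewrite ltr_wpDl// mulr_ge0.
by apply: ler_wpM2l; [exact: ltW|lra].
Qed.

Context (BN : nat -> H -> H)
  (BN_maps : forall N, maps_to (HN N) (HN N) (BN N))
  (BN_linear : forall N, linear_on (HN N) (BN N))
  (BN_bounded : exists KD : nat, forall N v, HN N v -> `|BN N v| <= KD%:R * `|v|).

Lemma BN_cmod : exists2 k : R, 0 <= k & forall N v, HN N v -> cmod (BN N v) <= k * cmod v.
Proof.
have [k hk] := BN_bounded; exists k%:R => // N v /hk.
by rewrite !norm_cmod -[k%:R in X in X -> _](rmorph_nat (real_complex R)) -rmorphM lecR.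
Qed.

Lemma BN_sub N v w : HN N v -> HN N w -> BN N (v - w) = BN N v - BN N w.
Proof.
move=> hv hw; rewrite addrC -scaleN1r BN_linear// scaleN1r addrC //.
Qed.

Lemma BN_scale N a v : HN N v -> BN N (a *: v) = a *: BN N v.
Proof.
move=> hv; have h0 : HN N 0 by exact: lin_span0.
have B0 : BN N 0 = 0 by have := BN_sub h0 h0; rewrite !subrr.
by rewrite -[a *: v]addr0 BN_linear// B0 addr0.
Qed.

Lemma hm_dot_Bm v w l : v \in um_seq -> w \in um_seq ->
  (fun N => hdot (v N) (BN N (w N))) @ ufilter U --> l ->
  hm_dot (hm_class v) (Bm BN (hm_class w)) = l.
Proof.
move=> uv uw vw; have [kB kB0 hB] := BN_cmod.
set w' := hm_rep (hm_class w); have uw' : w' \in um_seq by exact: hm_rep_um.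
have [kw kw0 hw] := um_seq_bounded uw; have [kw' kw'0 hw'] := um_seq_bounded uw'.
have uBw' : (fun N => BN N (w' N)) \in um_seq.
  apply: um_seqP.
    by apply: filterS (um_seq_HN uw') => N; exact: BN_maps.
  exists (kB * kw'); apply: filterS2 (um_seq_HN uw') hw' => N h1 h2.
  by apply: le_trans (hB _ _ h1) _; exact: ler_wpM2l.
set z := hm_rep (Bm BN (hm_class w)).
have uz : z \in um_seq by exact: hm_rep_um.
have [kz kz0 hz] := um_seq_bounded uz; have [kv kv0 hv] := um_seq_bounded uv.
apply: cvg_lim; first exact: norm_hausdorff.
apply: (@cvg_hdot_close v _ (fun N => BN N (w N)) z (kv + kz)) => //.
- exact: addr_ge0.
- by apply: filterS hv => N h; apply: le_trans h _; rewrite lerDl.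
- by apply: filterS hz => N h; apply: le_trans h _; rewrite lerDr.
- exact: hm_rep_class.
move=> e e0; have e2 : 0 < e / 2 by rewrite divr_gt0.
have e3 : 0 < e / 2 / (kB + 1) by rewrite divr_gt0// ltr_wpDl.
apply: filterS2 (filterI (hm_rep_class uBw' e2) (hm_rep_class uw e3))
  (filterI (um_seq_HN uw) (um_seq_HN uw')) => N [h1 h2] [h3 h4].
rewrite -(subrK (BN N (w' N)) (z N)) -addrA [e]splitr.
apply: le_lt_trans (le_cmodD _ _) _; apply: ltr_leD h1 _.
rewrite -BN_sub//; apply: le_trans (hB _ _ _) _; first exact: lin_spanB.
apply: (@le_trans _ _ ((kB + 1) * cmod (w' N - w N))).
  by rewrite ler_wpM2r ?cmod_ge0// lerDl.
by rewrite mulrC -ler_pdivlMr ?ltr_wpDl// ltW.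
Qed.

Context (Gm : H -> Hm U A As phi) (Gm_def : is_Gm Gm).
Context (B : {linear H -> H}) (BN_Gm : forall v, Bm BN (Gm v) = Gm (B v)).
Hypothesis HN_poly : forall P, \forall N \near ufilter U, HN N (op_eval P A As phi).

(** The coefficients are bounded, so they have some limit.  That limit is the
    coefficient of [B^m] between the images of the two vectors under [G^m], and
    these are intertwined with [B] by hypothesis. *)
Lemma cvg_BN_poly P Q :
  (fun N => hdot (op_eval Q A As phi) (BN N (op_eval P A As phi))) @ ufilter U -->
  hdot (op_eval Q A As phi) (B (op_eval P A As phi)).
Proof.
set p := op_eval P A As phi; set q := op_eval Q A As phi.
have [GmP Gm_iso] := Gm_def; have [kB kB0 hB] := BN_cmod.
have uc S : (fun=> op_eval S A As phi) \in um_seq.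
  apply: um_seqP; first exact: HN_poly.
  by exists (cmod (op_eval S A As phi)); exact: nearW.
have [l hl] : exists l : R[i], (fun N => hdot q (BN N p)) @ ufilter U --> l.
  apply: (@cmod_ultra_cvg_bounded _ _ _ (cmod q * (kB * cmod p))).
  apply: filterS (HN_poly P) => N hN; apply: le_trans (cauchy_schwarz _ _) _.
  by apply: ler_wpM2l; [exact: cmod_ge0|exact: hB].
suff -> : hdot q (B p) = l by [].
rewrite -Gm_iso -BN_Gm /p /q !GmP.
exact: hm_dot_Bm.
Qed.

Context (b a : H) (eb ea : nat -> H) (k : R).
Hypothesis k_ge0 : 0 <= k.
Hypothesis ea_HN : forall N, HN N (ea N).
Hypothesis ea_bounded : forall N, cmod (ea N) <= k.
Hypothesis B_bounded : bounded_op B.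
Hypothesis ea_approx : forall e : R, 0 < e -> exists2 P, cmod (op_eval P A As phi - a) < e &
  \forall N \near ufilter U, cmod (ea N - op_eval P A As phi) < e.
Hypothesis eb_approx : forall e : R, 0 < e -> exists2 P, cmod (op_eval P A As phi - b) < e &
  \forall N \near ufilter U, cmod (eb N - op_eval P A As phi) < e.

(** As the [B_N] are uniformly bounded, replacing a vector by a polynomial one
    costs at most a constant times their distance. *)
Lemma cvg_BN_approx :
  (fun N => hdot (eb N) (BN N (ea N))) @ ufilter U --> hdot b (B a).
Proof.
apply/cvg_cmodP => e e0.
have [kN kN0 hN] := BN_cmod; have [kB kB0 hB] := bounded_op_cmod B_bounded.
(* [Z] collects the constants in front of [n] in the five error terms. *)
pose Z := kN * k + (cmod b + 1) * kN + 1 + kB * (cmod a + 1) + cmod b * kB + 1.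
have Z1 : 1 <= Z.
  by rewrite /Z lerDr !addr_ge0 ?mulr_ge0 ?addr_ge0 ?mulr_ge0 ?cmod_ge0.
have Z0 : 0 < Z by exact: lt_le_trans Z1.
pose n := Num.min (e / Z) 1.
have n0 : 0 < n by rewrite lt_min divr_gt0//=.
have n1 : n <= 1 by rewrite ge_min lexx orbT.
have nZ : n * Z <= e by rewrite -ler_pdivlMr// ge_min lexx.
have [P aP eaP] := ea_approx n0; have [Q bQ ebQ] := eb_approx n0.
have /cvg_cmodP/(_ n n0) PQ := @cvg_BN_poly P Q.
set p := op_eval P A As phi in aP eaP PQ; set q := op_eval Q A As phi in bQ ebQ PQ.
apply: filterS2 (filterI eaP ebQ) (filterI PQ (HN_poly P)) => N [h1 h2] [h3 h4].
have qn : cmod q <= cmod b + 1.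
  rewrite -(subrK b q) addrC; apply: le_trans (le_cmodD _ _) _.
  by rewrite lerD2l (le_trans (ltW bQ)).
have pn : cmod p <= cmod a + 1.
  rewrite -(subrK a p) addrC; apply: le_trans (le_cmodD _ _) _.
  by rewrite lerD2l (le_trans (ltW aP)).
have -> : hdot (eb N) (BN N (ea N)) - hdot b (B a) =
    hdot (eb N - q) (BN N (ea N)) + hdot q (BN N (ea N - p)) +
    (hdot q (BN N p) - hdot q (B p)) + hdot (q - b) (B p) + hdot b (B (p - a)).
  by rewrite BN_sub// linB !hdotBl !hdotBr; ring.
apply: lt_le_trans nZ.
have g1 : cmod (hdot (eb N - q) (BN N (ea N))) <= n * (kN * k).
  apply: le_trans (cauchy_schwarz _ _) _; apply: ler_pM; [exact: cmod_ge0|exact: cmod_ge0|exact: ltW|].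
  by apply: le_trans (hN _ _ (ea_HN N)) _; exact: ler_wpM2l.
have g2 : cmod (hdot q (BN N (ea N - p))) <= (cmod b + 1) * (kN * n).
  apply: le_trans (cauchy_schwarz _ _) _; apply: ler_pM; rewrite ?cmod_ge0//.
  apply: le_trans (hN _ _ _) _; first exact: lin_spanB (ea_HN N) h4.
  by apply: ler_wpM2l => //; exact: ltW.
have g4 : cmod (hdot (q - b) (B p)) <= n * (kB * (cmod a + 1)).
  apply: le_trans (cauchy_schwarz _ _) _; apply: ler_pM; [exact: cmod_ge0|exact: cmod_ge0|exact: ltW|].
  by apply: le_trans (hB _) _; exact: ler_wpM2l.
have g5 : cmod (hdot b (B (p - a))) <= cmod b * (kB * n).
  apply: le_trans (cauchy_schwarz _ _) _; apply: ler_wpM2l; rewrite ?cmod_ge0//.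
  by apply: le_trans (hB _) _; apply: ler_wpM2l => //; exact: ltW.
apply: le_lt_trans (le_cmodD _ _) _.
apply: le_lt_trans (lerD (le_cmodD _ _) g5) _.
apply: le_lt_trans (lerD (lerD (le_cmodD _ _) g4) (lexx _)) _.
apply: le_lt_trans (lerD (lerD (lerD (le_cmodD _ _) (ltW h3)) (lexx _)) (lexx _)) _.
apply: le_lt_trans (lerD (lerD (lerD (lerD g1 g2) (lexx _)) (lexx _)) (lexx _)) _.
rewrite -subr_gt0 (_ : _ - _ = n)// /Z; ring.
Qed.

End ultraproduct.
(** * The limit formula *)

Section assembly.
Context (R : realType) (H : hilbertType R).
Context (q : R[i]) (V A As : {linear H -> H}) (phi : H).
Context (q_neq0 : q != 0)
  (V_unitary : unitary_between [set: H] [set: H] V)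
  (A_def : forall v, A v = q *: V v)
  (As_adjoint : adjoint A As)
  (phi_unit : `|phi| = 1)
  (phi_cyclic : cyclic_vec A As phi).
Context (M : nat) (M_gt_sqrt : Num.sqrt (cmod q ^+ 2) < M%:R).
Context (UN AN : nat -> H -> H)
  (UN_unitary : forall N,
     unitary_between (Wm A As phi N) (Wp A As phi N) (UN N))
  (AN_def : forall N, fin_approx A As phi (cmod q ^+ 2) N (UN N) (AN N))
  (D : nat -> nat) (u : forall N, 'I_(D N) -> H)
  (lam : forall N, 'I_(D N) -> R[i])
  (u_basis : forall N, eigen_basis (HN A As phi N) (AN N) (@u N) (@lam N))
  (u_phi_ge0 : forall N n, 0 <= hdot (u N n) phi).
Context (U : div_ultrafilter) (NI : nice_set U lam (xi_of phi u) M).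
Context (G : (R[i] -> R[i]) -> H) (G_iso : L2_iso (mu_star NI) A As phi (Sq M) G).

Local Notation xi := (xi_of phi u).
Local Notation muN := (muN lam xi).
Local Notation mun := (mun U lam xi).
Local Notation nu := (mu_star NI).
Local Notation T := (caratheodory_type nu).
Local Notation Mr := (M%:R : R).

Lemma cmod_phi : cmod phi = 1.
Proof. by rewrite /cmod phi_unit. Qed.

Lemma xi_unit N : \sum_(n < D N) xi n ^+ 2 = 1.
Proof.
have [uu uspan _] := u_basis N.
have := @orthonormal_sqnorm _ _ _ (@u N) (fun k => hdot (@u N k) phi) uu.
rewrite -orthonormal_expansion//; last by rewrite uspan; exact: (@HN_mon _ _ A As phi N 0 0).
rewrite cmod_phi expr1n => ->; apply: eq_bigr => k _.
by rewrite (xiE (@u_phi_ge0 N)) cmod_real real_normK// num_real.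
Qed.

Lemma lam_Sq N n : Sq M (@lam N n).
Proof.
have h : cmod (@lam N n) <= Mr.
  have e := eigenvalue_sqnorm V_unitary A_def (UN_unitary N) (AN_def N) (u_basis N) n.
  apply: ltW; apply: le_lt_trans M_gt_sqrt.
  by rewrite -e sqrtr_sqr ger0_norm ?cmod_ge0.
by split; apply: le_trans h; [exact: le_Re_cmod|exact: le_Im_cmod].
Qed.

Lemma closed_Sq : closed (Sq M : set R[i]).
Proof.
rewrite -[Sq M]setCK; apply: open_closedC; rewrite openE => l lS.
have [b hb] : exists b, ~~ (- Mr <= co b l <= Mr).
  apply: contrapT => h; apply: lS; apply/SqE => b; apply: contrapT => /negP hb.
  by apply: h; exists b.
rewrite negb_and -!ltNge in hb; apply/nbhs_cmodP.
case/orP: hb => hb; [exists (- Mr - co b l)|exists (co b l - Mr)]; rewrite ?subr_gt0//.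
  move=> y yl /SqE/(_ b)/andP[h _].
  have := le_lt_trans (le_trans (ler_norm _) (le_co_cmod b _)) yl.
  by rewrite coB; lra.
move=> y yl /SqE/(_ b)/andP[_ h]; rewrite cmodBC in yl.
have := le_lt_trans (le_trans (ler_norm _) (le_co_cmod b _)) yl.
by rewrite coB; lra.
Qed.

Lemma bounded_Sq : bounded_on (Sq M : set R[i]) id.
Proof.
exists (Mr + Mr); first by rewrite addr_ge0.
by move=> l /SqE h; apply: cmod_le_co => b; rewrite ler_norml.
Qed.

Lemma nu_SqC : nu (~` Sq M) = 0%E.
Proof. by apply: nu_out => l [lS /interior_subset]. Qed.

Lemma A_bounded : bounded_op A.
Proof.
exists (cmod q) => x.
by rewrite !norm_cmod -rmorphM lecR (scaled_unitary_cmod V_unitary A_def).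
Qed.

Let open_nu (X : set R[i]) : open X -> measurable (X : set T).
Proof. exact: (measurable_openT xi_unit NI). Qed.

Let nu_le (X : set R[i]) : (nu X <= 1)%E.
Proof. exact: (nu_le1 xi_unit NI X). Qed.

(** The constant function [1] corresponds to the unit vector [phi]. *)
Lemma nu_total : nu [set: R[i]] = 1%E.
Proof.
have e := G_indic_sqnorm open_nu nu_le closed_Sq nu_SqC G_iso (@measurableT _ T).
rewrite [LHS]e.
have -> : G (\1_[set: R[i]] : R[i] -> R[i]) = phi.
  rewrite -[RHS](op_eval1 A As phi) -(L2_iso_poly G_iso); congr G.
  by apply/funext => l; rewrite f_poly1 indicE in_setT.
by rewrite cmod_phi expr1n.
Qed.

Context (alpha beta : R[i]) (r : nat -> nat -> R)
  (r_grid : grid U lam xi M alpha beta r).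

Let e_ (X : set R[i]) N : H := spectral_part phi (@u N) (@lam N) X.

Lemma delta_vecE X N : delta_vec lam xi u X N = (muN N X)^-1%:C *: e_ X N.
Proof.
rewrite /delta_vec /e_ /spectral_part scaler_sumr; apply: eq_bigr => k _.
by rewrite scalerA -rmorphM mulrC.
Qed.

Lemma e_sqnorm X N : cmod (e_ X N) ^+ 2 = muN N X.
Proof. by rewrite /e_ (spectral_part_sqnorm (u_basis N)). Qed.

Lemma e_le1 X N : cmod (e_ X N) <= 1.
Proof.
rewrite -(@ler_pXn2r _ 2) ?nnegrE ?cmod_ge0// e_sqnorm expr1n.
exact: (muN_le1 _ xi_unit N X).
Qed.

Lemma le_cmod_sqrB (x y : R[i]) :
  cmod x ^+ 2 <= cmod y ^+ 2 + cmod (x - y) * (cmod x + cmod y).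
Proof.
have h : cmod x - cmod y <= cmod (x - y).
  by rewrite lerBlDr -{1}(subrK y x); exact: le_cmodD.
have := ler_wpM2r (addr_ge0 (cmod_ge0 x) (cmod_ge0 y)) h.
by rewrite -subr_sqr; lra.
Qed.

(** The distance from the spectral part of [phi] to a polynomial vector is an
    integral for the discrete measures; weak convergence compares it with the
    corresponding integral for the limit measure. *)
Lemma e_poly_limsup p (s : 'I_(2 ^ p.+2) * 'I_(2 ^ p.+2)) P (d : R) : 0 < d ->
  \forall N \near ufilter U, cmod (e_ (cell r s) N - op_eval P A As phi) ^+ 2 <=
    cmod (op_eval P A As phi - G (\1_(cell r s) : R[i] -> R[i])) ^+ 2 + d.
Proof.
move=> d0; set X := cell r s; set a := G _.
have mX : measurable (X : set T) by exact: (measurable_box xi_unit NI).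
have mS : measurable (Sq M : set T) by exact: (closed_meas open_nu closed_Sq).
have [[C C0 fC] [L L0 fL]] := f_poly_bounded_lipschitz P bounded_Sq.
pose F l : R := cmod (\1_X l - f_poly P l) ^+ 2.
have hC l : Sq M l -> cmod (\1_X l - f_poly P l) <= 1 + C.
  move=> Sl; apply: le_trans (le_cmodB _ _) _; apply: lerD (fC _ Sl).
  by rewrite indicE; case: (_ \in _); rewrite ?cmod1 ?cmod0.
pose w' : R := L * (4 * Mr) * (2 * (1 + C)).
have w'0 : 0 <= w' by rewrite !mulr_ge0// addr_ge0.
(* On a cell of level [p'] the integrand varies by at most [w' / (p' + 1)]. *)
have [p' [pp' hw]] : exists p', (p <= p')%N /\ w' / p'.+1%:R <= d / 4.
  pose k := Num.truncn (w' / (d / 4)).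
  exists (maxn p k); split; first exact: leq_maxl.
  rewrite ler_pdivrMr ?ltr0n// mulrC -ler_pdivrMr ?divr_gt0//.
  apply: ltW; apply: lt_le_trans (truncnS_gt _) _.
  by rewrite ler_nat ltnS leq_maxr.
pose w := w' / p'.+1%:R.
have w0 : 0 <= w by rewrite divr_ge0.
have Fw t l l' : Sq M l -> Sq M l' -> cell (p := p') r t l -> cell r t l' -> F l <= F l' + w.
  move=> Sl Sl' tl tl'; apply: le_trans (le_cmod_sqrB _ (\1_X l' - f_poly P l')) _.
  rewrite lerD2l.
  have -> : \1_X l - f_poly P l - (\1_X l' - f_poly P l') = - (f_poly P l - f_poly P l').
    have -> : \1_X l = \1_X l' :> R[i].
      rewrite !indicE; congr (_%:R : R[i]); congr nat_of_bool.
      by apply/idP/idP; rewrite !inE; exact: (cell_nested r_grid pp').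
    by ring.
  rewrite cmodN /w /w'.
  have h1 : cmod (f_poly P l - f_poly P l') <= L * (4 * Mr / p'.+1%:R).
    apply: le_trans (fL _ _ Sl Sl') _; apply: ler_wpM2l => //.
    exact: (cell_diam r_grid tl tl').
  have h2 : cmod (\1_X l - f_poly P l) + cmod (\1_X l' - f_poly P l') <= 2 * (1 + C).
    by rewrite [leRHS]mulr_natl mulr2n lerD// hC.
  rewrite (_ : _ / _ = L * (4 * Mr / p'.+1%:R) * (2 * (1 + C))); last by ring.
  by apply: ler_pM; rewrite ?addr_ge0 ?cmod_ge0.
have X2 := in_L2_indic nu_le mS mX.
have P2 := in_L2_f_poly open_nu nu_le closed_Sq bounded_Sq P.
have D2 := in_L2B mS X2 P2.
have mF : measurable_fun (Sq M : set T) (fun x : T => (F x)%:E).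
  by apply: measurable_cmod_sqr; case: D2.
have d2 : 0 < d / 2 by rewrite divr_gt0.
have := @limsup_integral _ _ _ _ _ xi_unit _ NI nu_total lam_Sq _ (@cell _ r p')
  (fun t => cell_le xi_unit NI r_grid t)
  (fun t t' l h h' => cell_disj r_grid h h') (nu_cells_full xi_unit NI r_grid p')
  (fun t => measurable_box xi_unit NI _ _) F ((1 + C) ^+ 2) w
  _ (fun l => sqr_ge0 _) Fw w0 mS mF _ d2.
have FC l : Sq M l -> F l <= (1 + C) ^+ 2.
  by move=> Sl; rewrite ler_pXn2r ?nnegrE ?cmod_ge0 ?addr_ge0 ?hC.
move=> /(_ FC) h.
apply: filterS2 h (near_ultra_ge U (poly_level P)) => N hN PN.
rewrite (spectral_part_sub_poly q_neq0 V_unitary A_def As_adjoint (UN_unitary N) (AN_def N)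
  (u_basis N) (@u_phi_ge0 N))//.
have e2 : (\int[cara_measure nu]_(x in (Sq M : set T)) (F x)%:E)%E =
    (cmod (op_eval P A As phi - a) ^+ 2)%:E.
  rewrite cmodBC -(L2_iso_poly G_iso) (G_sub G_iso)// -(L2_iso_isometric G_iso)//.
rewrite e2 -EFinD lee_fin in hN.
have w2 : 2 * w <= d / 2.
  by rewrite (_ : d / 2 = 2 * (d / 4)); [exact: ler_wpM2l|lra].
rewrite lerBlDr in hN; apply: le_trans hN _.
by rewrite -addrA lerD2l [leRHS]splitr lerD2r.
Qed.

Lemma e_approx p (s : 'I_(2 ^ p.+2) * 'I_(2 ^ p.+2)) (d : R) : 0 < d ->
  exists2 P, cmod (op_eval P A As phi - G (\1_(cell r s) : R[i] -> R[i])) < d &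
    \forall N \near ufilter U, cmod (e_ (cell r s) N - op_eval P A As phi) < d.
Proof.
move=> d0; have d2 : 0 < d / 2 by rewrite divr_gt0.
have [P hP] := poly_approx phi_cyclic (G (\1_(cell r s) : R[i] -> R[i])) d2.
exists P; first by apply: lt_trans hP _; lra.
have d4 : 0 < (d / 2) ^+ 2 by exact: exprn_gt0.
apply: filterS (e_poly_limsup s P d4) => N h.
rewrite -(@ltr_pXn2r _ 2) ?nnegrE ?cmod_ge0 ?ltW//; apply: le_lt_trans h _.
have : cmod (op_eval P A As phi - G (\1_(cell r s) : R[i] -> R[i])) ^+ 2 < (d / 2) ^+ 2.
  by rewrite ltr_pXn2r ?nnegrE ?cmod_ge0 ?ltW.
nra.
Qed.

Context (Gm : H -> Hm U A As phi) (Gm_def : is_Gm Gm).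
Context (B : {linear H -> H}) (B_bounded : bounded_op B).
Context (BN : nat -> H -> H)
  (BN_maps : forall N, maps_to (HN A As phi N) (HN A As phi N) (BN N))
  (BN_linear : forall N, linear_on (HN A As phi N) (BN N))
  (BN_bounded : exists KD : nat, forall N v, HN A As phi N v ->
     `|BN N v| <= KD%:R * `|v|)
  (BN_Gm : forall v, Bm BN (Gm v) = Gm (B v)).

Lemma near_HN_poly P : \forall N \near ufilter U, HN A As phi N (op_eval P A As phi).
Proof. by apply: filterS (near_ultra_ge U (poly_level P)) => N; exact: HN_op_eval. Qed.

Lemma HN_e X N : HN A As phi N (e_ X N).
Proof. exact: (HN_spectral_part (u_basis N)). Qed.

Lemma delta_um X : mun X != 0 -> delta_vec lam xi u X \in um_seq U A As phi.
Proof.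
move=> X0; apply: um_seqP.
  by apply: nearW => N; rewrite delta_vecE; apply: lin_spanZ; exact: HN_e.
have mX0 : 0 < mun X by rewrite lt_neqAle eq_sym X0 mun_ge0.
have X2 : mun X / 2 < mun X by lra.
exists (2 / mun X).
have /cvgr_gt/(_ _ X2) := @cvg_mun _ U _ lam _ xi_unit X.
apply: filterS => N h; rewrite delta_vecE cmodZ cmod_real.
have m0 : 0 < muN N X by apply: lt_trans h; rewrite divr_gt0.
rewrite ger0_norm ?invr_ge0 ?(ltW m0)//.
apply: (@le_trans _ _ ((muN N X)^-1 * 1)).
  by apply: ler_wpM2l; rewrite ?invr_ge0 ?(ltW m0)// e_le1.
rewrite mulr1 -[2 / _]invf_div lef_pV2 ?posrE ?divr_gt0//; exact: ltW.
Qed.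

Lemma cvg_real_complex (f : nat -> R) (l : R) : f @ ufilter U --> l ->
  (fun N => (f N)%:C) @ ufilter U --> (l%:C : R[i]).
Proof.
move=> fl; apply/cvg_cmodP => e e0; have /cvgrPdistC_lt/(_ _ e0) := fl.
by apply: filterS => N; rewrite -rmorphB cmod_real.
Qed.

(** Approximate delta functions are multiples of spectral parts, and by
    [e_approx] the spectral part for a cell represents [G 1_X] in the limit. *)
Lemma hm_dot_delta p (s t : 'I_(2 ^ p.+2) * 'I_(2 ^ p.+2)) :
  mun (cell r s) != 0 -> mun (cell r t) != 0 ->
  hm_dot (hm_class U A As phi (delta_vec lam xi u (cell r t)))
    (Bm BN (hm_class U A As phi (delta_vec lam xi u (cell r s)))) =
  ((mun (cell r t))^-1 * (mun (cell r s))^-1)%:C *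
    hdot (G (\1_(cell r t) : R[i] -> R[i])) (B (G (\1_(cell r s) : R[i] -> R[i]))).
Proof.
move=> s0 t0; apply: (hm_dot_Bm BN_maps BN_linear BN_bounded); try exact: delta_um.
rewrite (_ : (fun N => _) = fun N => ((muN N (cell r t))^-1 * (muN N (cell r s))^-1)%:C *
    hdot (e_ (cell r t) N) (BN N (e_ (cell r s) N))); last first.
  apply/funext => N; rewrite !delta_vecE (BN_scale BN_linear); last exact: HN_e.
  by rewrite hdotZl hdotZr conj_real rmorphM /= mulrA.
apply: cvgM.
  by apply: cvg_real_complex; apply: cvgM; apply: cvgV => //; exact: (cvg_mun xi_unit).
apply: (cvg_BN_approx BN_maps BN_linear BN_bounded Gm_def BN_Gm near_HN_poly (@ler01 R)) => //.
- by move=> N; exact: HN_e.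
- by move=> N; exact: e_le1.
- by move=> d d0; exact: e_approx.
- by move=> d d0; exact: e_approx.
Qed.

End assembly.
Theorem theorem5p2 (R : realType) (H : hilbertType R)
  (H_separable : separable_space H) (H_nonzero : exists v : H, v != 0)
  (q : R[i]) (V A As : {linear H -> H}) (phi : H)
  (q_neq0 : q != 0)
  (V_unitary : unitary_between [set: H] [set: H] V)
  (A_def : forall v, A v = q *: V v)
  (As_adjoint : adjoint A As)
  (phi_unit : `|phi| = 1)
  (phi_cyclic : cyclic_vec A As phi)
  (M : nat) (M_gt_opnorm : opnorm A < M%:R)
  (M_gt_sqrt : Num.sqrt (cmod q ^+ 2) < M%:R)
  (UN AN : nat -> H -> H)
  (UN_unitary : forall N,
     unitary_between (Wm A As phi N) (Wp A As phi N) (UN N))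
  (AN_def : forall N, fin_approx A As phi (cmod q ^+ 2) N (UN N) (AN N))
  (D : nat -> nat) (u : forall N, 'I_(D N) -> H)
  (lam : forall N, 'I_(D N) -> R[i])
  (u_basis : forall N, eigen_basis (HN A As phi N) (AN N) (@u N) (@lam N))
  (u_phi_ge0 : forall N n, 0 <= hdot (u N n) phi)
  (U : div_ultrafilter)
  (Gm : H -> Hm U A As phi) (Gm_def : is_Gm Gm)
  (NI : nice_set U lam (xi_of phi u) M)
  (G : (R[i] -> R[i]) -> H)
  (G_iso : L2_iso (mu_star NI) A As phi (Sq M) G)
  (B : {linear H -> H}) (B_bounded : bounded_op B)
  (K : R[i] -> R[i] -> R[i])
  (B_kernel : has_kernel (mu_star NI) (Sq M) (spectrum A) G B K)
  (BN : nat -> H -> H)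
  (BN_maps : forall N, maps_to (HN A As phi N) (HN A As phi N) (BN N))
  (BN_linear : forall N, linear_on (HN A As phi N) (BN N))
  (BN_bounded : exists KD : nat, forall N v, HN A As phi N v ->
     `|BN N v| <= KD%:R * `|v|)
  (BN_Gm : forall v, Bm BN (Gm v) = Gm (B v))
  (alpha beta : R[i])
  (alpha_spec : spectrum A alpha) (beta_spec : spectrum A beta)
  (r : nat -> nat -> R)
  (r_grid : grid U lam (xi_of phi u) M alpha beta r) :
  let u_ (c : R[i]) (p : nat) : Hm U A As phi :=
    hm_class U A As phi (delta_vec lam (xi_of phi u) u (cell_of M r p c)) in
  (fun p : nat => hm_dot (u_ beta p) (Bm BN (u_ alpha p))) @ \oo -->
    K alpha beta.
Proof.
move=> u_.
have unit_xi := xi_unit phi_unit u_basis u_phi_ge0.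
have open_nu (X : set R[i]) : open X ->
    measurable (X : set (caratheodory_type (mu_star NI))).
  exact: (measurable_openT unit_xi NI).
have nu_le := nu_le1 unit_xi NI.
have clS := @closed_Sq R M; have bdS := @bounded_Sq R M; have outS := nu_SqC NI.
have Ab := A_bounded V_unitary A_def.
have total := nu_total phi_unit u_basis u_phi_ge0 G_iso.
have sigma_S := spectrum_sub open_nu nu_le clS bdS outS phi_cyclic Ab G_iso.
apply/cvg_cmodP => e e0; have e3 : 0 < e / 3 by rewrite divr_gt0.
have [d d0 Kd] := kernel_continuous B_kernel alpha_spec beta_spec e3.
pose n := Num.truncn (4 * M%:R / d).
apply: filterS (nbhs_infty_ge n) => p np.
have diam : 4 * M%:R / p.+1%:R < d.
  rewrite ltr_pdivrMr ?ltr0n// [ltRHS]mulrC -ltr_pdivrMr//.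
  by apply: lt_le_trans (truncnS_gt _) _; rewrite ler_nat ltnS.
have [s es sa] := cell_of_cell r_grid p (sigma_S _ alpha_spec) (or_introl erefl).
have [t et tb] := cell_of_cell r_grid p (sigma_S _ beta_spec) (or_intror erefl).
have mun_neq0 (w : 'I_(2 ^ p.+2) * 'I_(2 ^ p.+2)) c : spectrum A c -> cell r w c ->
    mun U lam (xi_of phi u) (cell r w) != 0.
  move=> cA wc; have wn : nbhs c (cell r w).
    by have : open (cell r w) by [exact: open_box]; rewrite openE; exact.
  have /eqP h := spectrum_nbhs open_nu nu_le clS bdS phi_cyclic Ab G_iso cA wn.
  apply/eqP => w0; apply: h; apply: etrans (nu_cell unit_xi total r_grid w) _.
  by rewrite w0.
have s0 := mun_neq0 s _ alpha_spec sa; have t0 := mun_neq0 t _ beta_spec tb.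
rewrite /u_ es et (hm_dot_delta q_neq0 V_unitary A_def As_adjoint phi_unit phi_cyclic
  M_gt_sqrt UN_unitary AN_def u_basis u_phi_ge0 G_iso r_grid Gm_def B_bounded
  BN_maps BN_linear BN_bounded BN_Gm s0 t0).
have close x y : cell r s x -> spectrum A x -> cell r t y -> spectrum A y ->
    cmod (K x y - K alpha beta) <= e / 3.
  move=> sx xA ty yA; apply: ltW; apply: Kd => //.
    exact: le_lt_trans (cell_diam r_grid sx sa) diam.
  exact: le_lt_trans (cell_diam r_grid ty tb) diam.
set x := mun _ _ _ (cell r s) in s0 *; set y := mun _ _ _ (cell r t) in t0 *.
set z := hdot _ _.
have fx : fine (mu_star NI (cell r s)) = x by rewrite (nu_cell unit_xi total r_grid).
have fy : fine (mu_star NI (cell r t)) = y by rewrite (nu_cell unit_xi total r_grid).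
have h : cmod (z - K alpha beta * (x * y)%:C) <= 2 * (e / 3) * x * y.
  rewrite -fx -fy; apply: (kernel_average open_nu nu_le clS bdS outS phi_cyclic Ab
    G_iso B_bounded B_kernel) close; [| |exact: ltW].
    exact: (measurable_box unit_xi NI).
  exact: (measurable_box unit_xi NI).
have x0 : 0 < x by rewrite lt_neqAle eq_sym s0 mun_ge0.
have y0 : 0 < y by rewrite lt_neqAle eq_sym t0 mun_ge0.
have xy0 : 0 < y^-1 * x^-1 by rewrite mulr_gt0// invr_gt0.
have -> : (y^-1 * x^-1)%:C * z - K alpha beta =
    (y^-1 * x^-1)%:C * (z - K alpha beta * (x * y)%:C).
  rewrite mulrBr mulrCA -rmorphM (_ : y^-1 * x^-1 * (x * y) = 1) ?mulr1//.
  by field; rewrite !gt_eqF.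
rewrite cmodM cmod_real (gtr0_norm xy0).
apply: le_lt_trans (ler_wpM2l (ltW xy0) h) _.
have -> : y^-1 * x^-1 * (2 * (e / 3) * x * y) = 2 * (e / 3).
  by field; rewrite !gt_eqF.
lra.
Qed.
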